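(* Let $\lambda\in[0,1]$. Let $\mu$ be a symmetric probability measure on $\mathbb{R}$, $(\nu_n)$ a sequence of symmetric probability measures on $\mathbb{R}$ and $(k_n)$ a sequence of integers tending to infinity such that $\nu_n^{\boxplus_\lambda k_n}$ converges weakly to $\mu$. Then there exists a symmetric positive finite measure $G$ on $\mathbb{R}$ such that: (1) the sequence of positive finite measures $\left(k_n\frac{t^2}{1+t^2}\,d\nu_n(t)\right)$ converges weakly to $G$; (2) the rectangular $R$-transform with ratio $\lambda$ of $\mu$ has an analytic continuation to $\mathbb{C}\setminus[0,+\infty)$, given by the formula $$C_\mu(z)=z\int_{\mathbb{R}}\frac{1+t^2}{1-zt^2}\,dG(t).$$ Moreover, $G$ is symmetric and is the only positive finite measure $F$ on $\mathbb{R}$ such that $C_\mu(z)=z\int_{\mathbb{R}}\frac{1+t^2}{1-zt^2}\,dF(t)$.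
   Context: Weak convergence of positive finite measures on $\mathbb{R}$ means convergence against all continuous bounded functions. A measure on $\mathbb{R}$ is symmetric if it is invariant under $t\mapsto -t$. Rectangular $R$-transform with ratio $\lambda\in[0,1]$. Let $z\mapsto\sqrt z$ be the analytic square root on $\mathbb{C}\setminus[0,+\infty)$ with $\sqrt{-1}=i$, and $z\mapsto z^{1/2}$ the analytic square root on $\mathbb{C}\setminus(-\infty,0]$ with $1^{1/2}=1$; $\arg$ takes values in $[0,2\pi)$. For $\alpha\in(0,\pi)$, $\beta>0$ let $\Delta_{\alpha,\beta}=\{z: |\arg z-\pi|<\alpha,\ 0<|z|<\beta\}$. For a symmetric probability measure $\mu$ let $G_\mu(z)=\int\frac{d\mu(t)}{z-t}$ and, for $z\in\mathbb{C}\setminus[0,+\infty)$, $H_\mu(z)=\lambda\, G_\mu(1/\sqrt z)^2+(1-\lambda)\sqrt z\,G_\mu(1/\sqrt z)$. There is a (unique germ of) analytic function $H_\mu^{-1}$, defined for every $\alpha\in(0,\pi)$ on $\Delta_{\alpha,\beta}$ for some $\beta>0$, with $H_\mu^{-1}(z)/z\to1$ as $z\to0$ in $\{|\arg z-\pi|<\alpha\}$ and $H_\mu\circ H_\mu^{-1}=H_\mu^{-1}\circ H_\mu=\mathrm{id}$ on such a $\Delta_{\alpha,\beta}$. Near $0$ let $U(z)=\frac{-\lambda-1+[(\lambda+1)^2+4\lambda z]^{1/2}}{2\lambda}$ ($U(z)=z$ if $\lambda=0$). Then $C_\mu(z)=U\!\left(\frac{z}{H_\mu^{-1}(z)}-1\right)$,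 which for every $\alpha\in(0,\pi)$ is defined on $\Delta_{\alpha,\beta}$ for some $\beta>0$. The map $\mu\mapsto C_\mu$ is injective. Rectangular free convolution $\boxplus_\lambda$: for symmetric probability measures $\mu,\nu$, let $M(n),N(n)$ be independent $q_1(n)\times q_2(n)$ complex random matrices with $q_1(n),q_2(n)\to\infty$, $q_1(n)/q_2(n)\to\lambda$, one of them having a distribution invariant under left and right multiplication by unitary matrices, whose symmetrized singular laws (the symmetrization of the uniform law on the spectrum of $(MM^* )^{1/2}$) converge weakly in probability to $\mu$ and $\nu$; then the symmetrized singular law of $M(n)+N(n)$ converges weakly in probability to $\mu\boxplus_\lambda\nu$. Equivalently, $\mu\boxplus_\lambda\nu$ is the unique symmetric probability measure with $C_{\mu\boxplus_\lambda\nu}=C_\mu+C_\nu$. $\nu^{\boxplus_\lambda k}$ denotes the $k$-fold $\boxplus_\lambda$-power of $\nu$.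
   Formalization: Uniqueness of G is claimed only among symmetric positive finite measures F: the integrand depends on t only through t², so a non-symmetric F (e.g. 2δ_1 in place of δ_1+δ_{-1}) gives the same formula and the literal claim fails. *)

(* Defs.v *)
From HB Require Import structures.
From mathcomp Require Import all_boot all_order all_algebra.
From mathcomp Require Import all_classical all_reals all_analysis.
From mathcomp Require Import measurable_realfun.
From mathcomp Require Import complex.

Set Implicit Arguments.
Unset Strict Implicit.
Unset Printing Implicit Defensive.

Import Order.TTheory GRing.Theory Num.Theory.
Import numFieldNormedType.Exports.

Local Open Scope classical_set_scope.
Local Open Scope ring_scope.
Local Open Scope complex_scope.

(* R[i] with the norm topology, as a normed space over itself, so that
   [derivable] is complex differentiability. *)
HB.instance Definition _ (R : rcfType) := GRing.ComAlgebra.copy R[i] R[i]^o.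
HB.instance Definition _ (R : rcfType) := Vector.copy R[i] R[i]^o.
HB.instance Definition _ (R : rcfType) := NormedModule.copy R[i] R[i]^o.

Section measures.
Context {R : realType}.
Local Notation T := (measurableTypeR R).

Definition symmetric_measure (m : {measure set T -> \bar R}) : Prop :=
  forall A : set T, measurable A -> m (-%R @^-1` A) = m A.

Definition weak_cvg (m_ : nat -> {finite_measure set T -> \bar R})
    (m : {finite_measure set T -> \bar R}) : Prop :=
  forall f : R -> R, continuous f -> bounded_fun f ->
    (\int[m_ n]_x f x @[n --> \oo] --> \int[m]_x f x)%R.

Definition cint (m : {measure set T -> \bar R}) (f : R -> R[i]) : R[i] :=
  (\int[m]_t complex.Re (f t))%R +i* (\int[m]_t complex.Im (f t))%R.

Definition jump_density (k : nat) (t : R) : R :=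
  k%:R * (t ^+ 2 / (1 + t ^+ 2)).

Lemma jump_density_ge0 k t : 0 <= jump_density k t.
Proof. by rewrite mulr_ge0// divr_ge0 ?addr_ge0 ?sqr_ge0. Qed.

Lemma jump_density_le k t : jump_density k t <= k%:R.
Proof.
rewrite ler_piMr// ler_pdivrMr ?mul1r ?lerDr//.
by rewrite ltr_pwDl ?sqr_ge0.
Qed.

Lemma measurable_jump_density k : measurable_fun [set: T] (jump_density k).
Proof.
apply: continuous_measurable_fun => t; rewrite /jump_density.
have tX : (fun s : R => s ^+ 2) x @[x --> t] --> t ^+ 2.
  exact: exprn_continuous.
apply: cvgM; first exact: cvg_cst.
apply: cvgM => //; apply: cvgV.
  by rewrite gt_eqF// ltr_pwDl ?sqr_ge0.
by apply: cvgD => //; exact: cvg_cst.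
Qed.

(* The measure k t^2 / (1 + t^2) dm(t). *)
Definition jump_measure (k : nat) (m : {finite_measure set T -> \bar R})
    (A : set T) : \bar R :=
  (\int[m]_(t in A) (jump_density k t)%:E)%E.

Section jump_measure_instance.
Variables (k : nat) (m : {finite_measure set T -> \bar R}).

Let jump_measure0 : jump_measure k m set0 = 0%E.
Proof. by rewrite /jump_measure integral_set0. Qed.

Let jump_measure_ge0 A : (0 <= jump_measure k m A)%E.
Proof. by apply: integral_ge0 => t _; rewrite lee_fin jump_density_ge0. Qed.

Let jump_measure_sigma_additive : semi_sigma_additive (jump_measure k m).
Proof.
move=> /= F mF tF mUF; rewrite /jump_measure; apply: cvg_toP.
  apply: ereal_nondecreasing_is_cvgn => a b ab.
  apply: lee_sum_nneg_natr => // j _ _.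
  by apply: integral_ge0 => /= t _; rewrite lee_fin jump_density_ge0.
rewrite ge0_integral_bigcup//=.
- apply: measurable_funTS; apply: measurableT_comp => //.
  exact: measurable_jump_density.
- by move=> t _; rewrite lee_fin jump_density_ge0.
Qed.

HB.instance Definition _ := isMeasure.Build _ _ _ (jump_measure k m)
  jump_measure0 jump_measure_ge0 jump_measure_sigma_additive.

Let jump_measure_fin : fin_num_fun (jump_measure k m).
Proof.
move=> A mA; rewrite ge0_fin_numE ?jump_measure_ge0//.
apply: (@le_lt_trans _ _ (\int[m]_(t in A) (cst k%:R%:E) t)%E).
  apply: ge0_le_integral => //.
  - by move=> t _; rewrite lee_fin jump_density_ge0.
  - apply: measurable_funTS; apply: measurableT_comp => //.
    exact: measurable_jump_density.
  - by move=> t _; rewrite lee_fin jump_density_le.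
rewrite integral_cst// lte_mul_pinfty// ?lee_fin//.
by rewrite -ge0_fin_numE// fin_num_measure.
Qed.

HB.instance Definition _ :=
  Measure_isFinite.Build _ _ _ (jump_measure k m) jump_measure_fin.

End jump_measure_instance.
End measures.

Section complex_plane.
Context {R : realType}.
Local Notation C := R[i].

(* [z^{1/2}] is [sqrtc z]: nonnegative real part, cut along the negative
   half-line.  The square root below is the one that is analytic off
   [0, +oo) and maps -1 to 'i. *)
Definition sqrt_cut (z : C) : C := 'i * sqrtc (- z).

(* The argument in [0, 2 pi); the value at 0 is junk. *)
Definition arg (z : C) : R :=
  let a := acos (complex.Re z / complex.Re `|z|) in
  if 0 <= complex.Im z then a else 2 * pi - a.

Definition sector (alpha : R) : set C :=
  [set z | z != 0 /\ `|arg z - pi| < alpha].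

Definition Delta (alpha beta : R) : set C :=
  [set z | sector alpha z /\ `|z| < beta%:C].

(* [0 <= z] in R[i] means that z is a nonnegative real. *)
Definition cut_plane : set C := [set z | ~~ (0 <= z)].

(* Only used for open sets D. *)
Definition analytic_on (D : set C) (f : C -> C) : Prop :=
  forall z, D z -> derivable f z 1.

Definition eq_germ (f g : C -> C) : Prop :=
  forall alpha : R, 0 < alpha < pi ->
  exists2 beta : R, 0 < beta & forall z, Delta alpha beta z -> f z = g z.

End complex_plane.

Section rectangular.
Context {R : realType}.
Local Notation C := R[i].
Local Notation T := (measurableTypeR R).
Variable lambda : R.

Definition cauchy_transform (mu : probability T R) (z : C) : C :=
  cint mu (fun t => (z - t%:C)^-1).

Definition rectH (mu : probability T R) (z : C) : C :=
  let s := sqrt_cut z in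
  lambda%:C * cauchy_transform mu s^-1 ^+ 2
  + (1 - lambda)%:C * s * cauchy_transform mu s^-1.

Definition is_rectHinv (mu : probability T R) (h : C -> C) : Prop :=
  forall alpha : R, 0 < alpha < pi ->
  h z / z @[z --> within (sector alpha) (nbhs 0)] --> (1 : C) /\
  exists2 beta : R, 0 < beta &
    [/\ analytic_on (Delta alpha beta) h,
        forall z, Delta alpha beta z -> rectH mu (h z) = z &
        forall z, Delta alpha beta z -> h (rectH mu z) = z].

(* A representative of the germ: its values are meaningful only on
   Delta alpha beta, for each alpha and some beta depending on alpha. *)
Definition rectHinv (mu : probability T R) : C -> C :=
  xget (fun=> 0) [set h | is_rectHinv mu h].

Definition rectU (z : C) : C :=
  if lambda == 0 then z else
  (- lambda%:C - 1 + sqrtc ((lambda%:C + 1) ^+ 2 + 4 * lambda%:C * z))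
  / (2 * lambda%:C).

Definition rectR (mu : probability T R) (z : C) : C :=
  rectU (z / rectHinv mu z - 1).

(* rho is the rectangular free convolution of mu and nu: the (unique)
   symmetric probability measure whose R-transform is the sum of theirs. *)
Definition is_rect_conv (mu nu rho : probability T R) : Prop :=
  symmetric_measure rho /\
  eq_germ (rectR rho) (fun z => rectR mu z + rectR nu z).

(* [is_rect_pow nu k rho]: rho is the k-fold power of nu, k >= 1. *)
Inductive is_rect_pow (nu : probability T R) :
    nat -> probability T R -> Prop :=
| rect_pow1 (rho : probability T R) :
    (forall A : set T, measurable A -> rho A = nu A) ->
    is_rect_pow nu 1 rho
| rect_powS (k : nat) (rho rho' : probability T R) :
    is_rect_pow nu k rho -> is_rect_conv rho nu rho' ->
    is_rect_pow nu k.+1 rho'.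

End rectangular.

Definition levy_transform {R : realType}
    (G : {finite_measure set (measurableTypeR R) -> \bar R}) (z : R[i]) : R[i] :=
  z * cint G (fun t => (1 + t%:C ^+ 2) / (1 - z * t%:C ^+ 2)).

(* Main.v *)
Require Import Defs.
From HB Require Import structures.
From mathcomp Require Import all_boot all_order all_algebra.
From mathcomp Require Import all_classical all_reals all_analysis.
From mathcomp Require Import measurable_realfun ring lra.
From mathcomp Require Import complex.

(* Put M_rho(z) = int z t^2 / (1 - z t^2) drho(t) and
   T(x) = (lambda x + 1)(x + 1).  For symmetric rho, H_rho(z) = z T(M_rho(z))
   and C_rho(H_rho(y)) = M_rho(y) for y near 0 in a sector around the negative
   half-line.  Moreover, for G_n = k_n t^2 / (1 + t^2) dnu_n, k_n M_(nu_n) is the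
   Levy transform L_(G_n), which is z int (1 + t^2) / (1 - z t^2) dG_n(t).
   Hence C_(rho_n) = k_n C_(nu_n) amounts to
     M_(rho_n)(y) = L_(G_n)(y T(M_(rho_n)(y)) / T(M_(rho_n)(y) / k_n)),
   an identity where no inverse function is left.  It is known near 0 only, in a
   neighbourhood depending on n, but both sides are analytic on the part of a
   sector where M_(rho_n) is small, which contains a neighbourhood of 0 that does
   not depend on n because rho_n converges.  On the negative half-line the
   identity bounds the mass and the tails of G_n; any limit G of G_n along an
   ultrafilter then satisfies M_mu(y) = L_G(H_mu(y)), that is, C_mu = L_G.
   Finally L_G determines G: its Taylor coefficients at -1 are given by the
   moments of t^2 / (1 + t^2) under G. *)

Set Implicit Arguments.
Unset Strict Implicit.
Unset Printing Implicit Defensive.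

Import Order.TTheory GRing.Theory Num.Theory.
Import numFieldNormedType.Exports.
Import Normc.

Local Open Scope classical_set_scope.
Local Open Scope ring_scope.
Local Open Scope complex_scope.

(** The obstacle is uniformity in n: nothing is known beforehand about nu_n, so the domain on which
    H_(nu_n) can be inverted is not controlled. The way out is that C_(rho_n) = k_n C_(nu_n)
    prescribes M_(nu_n)(y') = M_(rho_n)(y) / k_n at the point y' where H_(nu_n)(y') = H_(rho_n)(y).
    As H is z T(M), this makes y' explicit in terms of rho_n alone, and weak convergence controls
    rho_n. At a negative point -x everything is real and -L_G(-x) increases with x, so the identity
    compares integrals of positive kernels. Estimates are relative to |z| and hold in sectors with
    aperture parameter s; perturbing a point or inverting H costs a factor 2 in s. Continuation
    takes place along rays from 0, so the notion of analyticity has to be stable under composition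
    and to satisfy the identity principle on a segment, no more. Ultrafilters turn uniqueness into
    convergence: the limits along all ultrafilters are symmetric with the same transform, hence
    equal, and so the whole sequence converges. *)

Local Notation Re := complex.Re.
Local Notation Im := complex.Im.

(** * Complex modulus and integrals *)

Section modulus.
Context {R : realType}.
Implicit Types z w : R[i].

Lemma norm_normc z : `|z| = (normc z)%:C.
Proof. by case: z. Qed.

Lemma normc_zero : normc (0 : R[i]) = 0.
Proof. exact: normc0. Qed.

Lemma normc_one : normc (1 : R[i]) = 1.
Proof. exact: normc1. Qed.

Lemma normc_ge0 z : 0 <= normc z.
Proof. by case: z => a b; exact: sqrtr_ge0. Qed.

Lemma normc_eq0 z : (normc z == 0) = (z == 0).
Proof. by apply/eqP/eqP => [/eq0_normc//|->]; exact: normc0. Qed.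

Lemma normc_gt0 z : (0 < normc z) = (z != 0).
Proof. by rewrite lt_def normc_ge0 andbT normc_eq0. Qed.

Lemma normc_sqrE z : normc z ^+ 2 = Re z ^+ 2 + Im z ^+ 2.
Proof. by case: z => a b /=; rewrite sqr_sqrtr// addr_ge0 ?sqr_ge0. Qed.

Lemma normcX z n : normc (z ^+ n) = normc z ^+ n.
Proof. by elim: n => [|n IH]; rewrite ?expr0 ?normc_one// !exprS normcM IH. Qed.

Lemma normc_real (x : R) : normc x%:C = `|x|.
Proof. by rewrite /= expr0n addr0 sqrtr_sqr. Qed.

Lemma normcN z : normc (- z) = normc z.
Proof. by case: z => a b /=; rewrite !sqrrN. Qed.

Lemma normcD z w : normc (z + w) <= normc z + normc w.
Proof. exact: le_normcD. Qed.

Lemma normcB z w : normc (z - w) <= normc z + normc w.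
Proof. by rewrite -(normcN w) normcD. Qed.

Lemma distcC z w : normc (z - w) = normc (w - z).
Proof. by rewrite -normcN opprB. Qed.

Lemma lerB_normc z w : normc z - normc w <= normc (z - w).
Proof. by rewrite lerBlDr -{1}(subrK w z) normcD. Qed.

Lemma distc_triangle u z w : normc (z - w) <= normc (z - u) + normc (u - w).
Proof. by rewrite -{1}(subrK u z) -addrA normcD. Qed.

Lemma Re_le_normc z : `|Re z| <= normc z.
Proof.
by rewrite -ler_sqr ?nnegrE ?normc_ge0// real_normK ?num_real// normc_sqrE lerDl sqr_ge0.
Qed.

Lemma Im_le_normc z : `|Im z| <= normc z.
Proof.
by rewrite -ler_sqr ?nnegrE ?normc_ge0// real_normK ?num_real// normc_sqrE lerDr sqr_ge0.
Qed.

Lemma normc_le_ReIm z : normc z <= `|Re z| + `|Im z|.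
Proof.
rewrite -ler_sqr ?nnegrE ?normc_ge0 ?addr_ge0// normc_sqrE sqrrD !real_normK ?num_real//.
by rewrite -addrA (addrC (_ *+ 2)) addrA lerDl mulrn_wge0// mulr_ge0.
Qed.

Lemma cReD z w : Re (z + w) = Re z + Re w.
Proof. by case: z; case: w. Qed.

Lemma cImD z w : Im (z + w) = Im z + Im w.
Proof. by case: z; case: w. Qed.

Lemma cReN z : Re (- z) = - Re z.
Proof. by case: z. Qed.

Lemma cImN z : Im (- z) = - Im z.
Proof. by case: z. Qed.

Lemma cReM z w : Re (z * w) = Re z * Re w - Im z * Im w.
Proof. by case: z; case: w. Qed.

Lemma cImM z w : Im (z * w) = Re z * Im w + Im z * Re w.
Proof. by case: z => a b; case: w. Qed.

Lemma cRe_realM (x : R) z : Re (x%:C * z) = x * Re z.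
Proof. by case: z => a b /=; rewrite mul0r subr0. Qed.

Lemma cIm_realM (x : R) z : Im (x%:C * z) = x * Im z.
Proof. by case: z => a b /=; rewrite mul0r addr0. Qed.

Lemma complex_ext z w : Re z = Re w -> Im z = Im w -> z = w.
Proof. by case: z => a b; case: w => c d /= -> ->. Qed.

Lemma lt_norm_normc z (e : R) : (`|z| < e%:C) = (normc z < e).
Proof. by rewrite norm_normc ltcR. Qed.

Lemma gt0_complexE (e : R[i]) : 0 < e -> exists2 r : R, 0 < r & e = r%:C.
Proof. by case: e => a b; rewrite ltcE /= => /andP[/eqP -> a0]; exists a. Qed.

Lemma nbhs_normcP (z : R[i]) (A : set R[i]) :
  nbhs z A <-> exists2 e : R, 0 < e & forall w, normc (w - z) < e -> A w.
Proof.
split.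
  move=> /nbhs_ballP[e /= e0 zA]; have [r r0 er] := gt0_complexE e0.
  exists r => // w wz; apply: zA; rewrite -ball_normE /= er.
  by rewrite lt_norm_normc distcC.
move=> [e e0 zA]; apply/nbhs_ballP; exists e%:C => /=; first by rewrite ltcR.
by move=> w; rewrite -ball_normE /= lt_norm_normc distcC => /zA.
Qed.

Lemma derivable_normc (f : R[i] -> R[i]) z (l : R[i]) :
  (forall e : R, 0 < e -> exists2 d : R, 0 < d &
     forall h : R[i], h != 0 -> normc h < d -> normc ((f (z + h) - f z) / h - l) < e) ->
  derivable f z 1.
Proof.
move=> H; apply/cvg_ex; exists l.
move=> A /nbhs_normcP[e e0 eA]; rewrite nbhs_filterE /= /dnbhs /within /=.
have [d d0 dH] := H _ e0; apply/nbhs_normcP; exists d => // h.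
rewrite subr0 => hd h0; apply: eA.
suff -> : h^-1 *: (f (h *: 1 + z) - f z) = (f (z + h) - f z) / h by exact: dH.
have -> : h *: (1 : R[i]) = h by exact: mulr1.
rewrite [RHS]mulrC (addrC z); exact: erefl.
Qed.

End modulus.

Section bounded_continuous.
Context {R : realType}.
Local Notation T := (measurableTypeR R).

Definition bc_fun (f : R -> R) : Prop :=
  continuous f /\ exists K, forall t, `|f t| <= K.

Definition bc_cfun (f : R -> R[i]) : Prop :=
  [/\ continuous (fun t => Re (f t)), continuous (fun t => Im (f t)) &
      exists K, forall t, normc (f t) <= K].

Definition cts_cfun (f : R -> R[i]) : Prop :=
  continuous (fun t => Re (f t)) /\ continuous (fun t => Im (f t)).

Lemma bc_fun_bounded (f : R -> R) : bc_fun f <-> continuous f /\ bounded_fun f.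
Proof.
split=> [[cf [K fK]]|[cf [M [_ fM]]]]; split => //.
  by exists K; split; [exact: num_real|move=> x Kx t _; rewrite /= (le_trans (fK t))// ltW].
by exists (M + 1) => t; apply: fM => //; rewrite ltrDl.
Qed.

Lemma bc_fun_cst (c : R) : bc_fun (fun=> c).
Proof. by split; [exact: cst_continuous|exists `|c|]. Qed.

Lemma bc_funD (f g : R -> R) : bc_fun f -> bc_fun g -> bc_fun (fun t => f t + g t).
Proof.
move=> [cf [K fK]] [cg [L gL]]; split; first by move=> t; apply: cvgD; [exact: cf|exact: cg].
by exists (K + L) => t; rewrite (le_trans (ler_normD _ _))// lerD.
Qed.

Lemma bc_funM (f g : R -> R) : bc_fun f -> bc_fun g -> bc_fun (fun t => f t * g t).
Proof.
move=> [cf [K fK]] [cg [L gL]]; split; first by move=> t; apply: cvgM; [exact: cf|exact: cg].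
by exists (K * L) => t; rewrite normrM ler_pM.
Qed.

Lemma bc_funN (f : R -> R) : bc_fun f -> bc_fun (fun t => - f t).
Proof.
move=> [cf [K fK]]; split; first by move=> t; apply: cvgN; exact: cf.
by exists K => t; rewrite normrN.
Qed.

Lemma bc_funB (f g : R -> R) : bc_fun f -> bc_fun g -> bc_fun (fun t => f t - g t).
Proof. by move=> fb gb; apply: bc_funD => //; exact: bc_funN. Qed.

Lemma bc_funX (f : R -> R) n : bc_fun f -> bc_fun (fun t => f t ^+ n).
Proof.
move=> fb; elim: n => [|n IH]; first exact: bc_fun_cst.
under eq_fun do rewrite exprS; exact: bc_funM.
Qed.

Lemma bc_fun_opp (f : R -> R) : bc_fun f -> bc_fun (fun t => f (- t)).
Proof.
move=> [cf [K fK]]; split; last by exists K.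
by move=> t; apply: continuous_comp; [exact: oppr_continuous|exact: cf].
Qed.

Lemma bc_fun_integrable (m : {finite_measure set T -> \bar R}) (f : R -> R) :
  bc_fun f -> m.-integrable [set: T] (EFin \o f).
Proof.
move=> /bc_fun_bounded[cf bf]; apply: measurable_bounded_integrable => //.
- by rewrite -ge0_fin_numE// fin_num_measure.
- exact: continuous_measurable_fun.
Qed.

Lemma bc_cfun_Re (f : R -> R[i]) : bc_cfun f -> bc_fun (fun t => Re (f t)).
Proof.
by move=> [cR _ [K fK]]; split=> //; exists K => t; rewrite (le_trans (Re_le_normc _)).
Qed.

Lemma bc_cfun_Im (f : R -> R[i]) : bc_cfun f -> bc_fun (fun t => Im (f t)).
Proof.
by move=> [_ cI [K fK]]; split=> //; exists K => t; rewrite (le_trans (Im_le_normc _)).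
Qed.

Lemma bc_cfunP (f : R -> R[i]) (K : R) : cts_cfun f ->
  (forall t, normc (f t) <= K) -> bc_cfun f.
Proof. by move=> [cR cI] fK; split => //; exists K. Qed.

Lemma cts_cfun_cst (c : R[i]) : cts_cfun (fun=> c).
Proof. by split => t; exact: cvg_cst. Qed.

Lemma cts_cfun_real (f : R -> R) : continuous f -> cts_cfun (fun t => (f t)%:C).
Proof. by move=> cf; split => // t; exact: cvg_cst. Qed.

Lemma cts_cfunD (f g : R -> R[i]) : cts_cfun f -> cts_cfun g ->
  cts_cfun (fun t => f t + g t).
Proof.
move=> [fR fI] [gR gI]; split => t.
  by under eq_fun do rewrite cReD; apply: cvgD; [exact: fR|exact: gR].
by under eq_fun do rewrite cImD; apply: cvgD; [exact: fI|exact: gI].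
Qed.

Lemma cts_cfunM (f g : R -> R[i]) : cts_cfun f -> cts_cfun g ->
  cts_cfun (fun t => f t * g t).
Proof.
move=> [fR fI] [gR gI]; split => t.
  under eq_fun do rewrite cReM.
  by apply: cvgB; apply: cvgM; [exact: fR|exact: gR|exact: fI|exact: gI].
under eq_fun do rewrite cImM.
by apply: cvgD; apply: cvgM; [exact: fR|exact: gI|exact: fI|exact: gR].
Qed.

Lemma cts_cfunN (f : R -> R[i]) : cts_cfun f -> cts_cfun (fun t => - f t).
Proof.
move=> cf; under eq_fun do rewrite -mulN1r.
by apply: cts_cfunM => //; exact: cts_cfun_cst.
Qed.

Lemma invC_ReIm (z : R[i]) :
  z^-1 = (Re z / normc z ^+ 2) +i* (- Im z / normc z ^+ 2).
Proof. by rewrite normc_sqrE mulNr; case: z. Qed.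

Lemma cts_cfunV (f : R -> R[i]) : (forall t, f t != 0) -> cts_cfun f ->
  cts_cfun (fun t => (f t)^-1).
Proof.
move=> f0 [fR fI].
have n0 t : Re (f t) ^+ 2 + Im (f t) ^+ 2 != 0.
  by rewrite -normc_sqrE sqrf_eq0 normc_eq0.
have nc : continuous (fun t => (Re (f t) ^+ 2 + Im (f t) ^+ 2)^-1).
  move=> t; apply: cvgV => //; apply: cvgD.
    by under eq_fun do rewrite expr2; apply: cvgM; exact: fR.
  by under eq_fun do rewrite expr2; apply: cvgM; exact: fI.
split => t; under eq_fun do rewrite invC_ReIm /= normc_sqrE; apply: cvgM; try exact: nc.
  exact: fR.
by apply: cvgN; exact: fI.
Qed.

Lemma bc_cfunM (f g : R -> R[i]) : bc_cfun f -> bc_cfun g ->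
  bc_cfun (fun t => f t * g t).
Proof.
move=> [fR fI [K fK]] [gR gI [L gL]]; apply: (@bc_cfunP _ (K * L)).
  exact: cts_cfunM.
by move=> t; rewrite normcM ler_pM// normc_ge0.
Qed.

Lemma bc_cfunD (f g : R -> R[i]) : bc_cfun f -> bc_cfun g ->
  bc_cfun (fun t => f t + g t).
Proof.
move=> [fR fI [K fK]] [gR gI [L gL]]; apply: (@bc_cfunP _ (K + L)).
  exact: cts_cfunD.
by move=> t; rewrite (le_trans (normcD _ _))// lerD.
Qed.

Lemma bc_cfun_cst (c : R[i]) : bc_cfun (fun=> c).
Proof. by apply: (@bc_cfunP _ (normc c)) => //; exact: cts_cfun_cst. Qed.

Lemma bc_cfun_real (f : R -> R) : bc_fun f -> bc_cfun (fun t => (f t)%:C).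
Proof.
move=> [cf [K fK]]; apply: (@bc_cfunP _ K); first exact: cts_cfun_real.
by move=> t; rewrite normc_real.
Qed.

Lemma bc_cfunX (f : R -> R[i]) n : bc_cfun f -> bc_cfun (fun t => f t ^+ n).
Proof.
move=> fb; elim: n => [|n IH]; first exact: bc_cfun_cst.
by under eq_fun do rewrite exprS; exact: bc_cfunM.
Qed.

End bounded_continuous.

Section cint.
Context {R : realType}.
Local Notation T := (measurableTypeR R).
Variable m : {finite_measure set T -> \bar R}.
Implicit Types (f g : R -> R[i]) (c : R[i]).

Lemma eq_cint f g : f =1 g -> cint m f = cint m g.
Proof. by move=> fg; congr cint; apply/funext. Qed.

Lemma bc_Rintegral_ge0 (f : R -> R) : (forall t, 0 <= f t) ->
  (0 <= \int[m]_t f t)%R.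
Proof. by move=> f0; apply: Rintegral_ge0. Qed.

Lemma bc_le_Rintegral (f g : R -> R) : bc_fun f -> bc_fun g ->
  (forall t, f t <= g t) -> (\int[m]_t f t <= \int[m]_t g t)%R.
Proof. by move=> fb gb fg; apply: le_Rintegral => //; exact: bc_fun_integrable. Qed.

Lemma bc_RintegralD (f g : R -> R) : bc_fun f -> bc_fun g ->
  (\int[m]_t (f t + g t) = \int[m]_t f t + \int[m]_t g t)%R.
Proof. by move=> fb gb; apply: RintegralD => //; exact: bc_fun_integrable. Qed.

Lemma bc_RintegralB (f g : R -> R) : bc_fun f -> bc_fun g ->
  (\int[m]_t (f t - g t) = \int[m]_t f t - \int[m]_t g t)%R.
Proof. by move=> fb gb; apply: RintegralB => //; exact: bc_fun_integrable. Qed.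

Lemma bc_RintegralZ (c : R) (f : R -> R) : bc_fun f ->
  (\int[m]_t (c * f t) = c * \int[m]_t f t)%R.
Proof. by move=> fb; apply: RintegralZl => //; exact: bc_fun_integrable. Qed.

Lemma cintD f g : bc_cfun f -> bc_cfun g ->
  cint m (fun t => f t + g t) = cint m f + cint m g.
Proof.
move=> fb gb; apply: complex_ext => /=.
  under eq_Rintegral do rewrite cReD.
  by rewrite bc_RintegralD//; exact: bc_cfun_Re.
under eq_Rintegral do rewrite cImD.
by rewrite bc_RintegralD//; exact: bc_cfun_Im.
Qed.

Lemma cintZ c f : bc_cfun f -> cint m (fun t => c * f t) = c * cint m f.
Proof.
move=> fb; have [fR fI] := (bc_cfun_Re fb, bc_cfun_Im fb).
apply: complex_ext; rewrite /= ?cReM ?cImM /=.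
  under eq_Rintegral do rewrite cReM.
  rewrite bc_RintegralB; [|by apply: bc_funM => //; exact: bc_fun_cst..].
  by rewrite !bc_RintegralZ.
under eq_Rintegral do rewrite cImM.
rewrite bc_RintegralD; [|by apply: bc_funM => //; exact: bc_fun_cst..].
by rewrite !bc_RintegralZ.
Qed.

Lemma cintB f g : bc_cfun f -> bc_cfun g ->
  cint m (fun t => f t - g t) = cint m f - cint m g.
Proof.
move=> fb gb; rewrite -[- cint m g]mulN1r -cintZ// -cintD//.
  by apply: eq_cint => t; rewrite mulN1r.
by apply: bc_cfunM => //; exact: bc_cfun_cst.
Qed.

Lemma cint_real (f : R -> R) : cint m (fun t => (f t)%:C) = (\int[m]_t f t)%R%:C.
Proof. by apply: complex_ext => //=; rewrite Rintegral_cst// mul0r. Qed.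

(* Rotating by a unimodular constant makes the integral a nonnegative real, so
   that it is the integral of the real part. *)
Lemma normc_cint f (g : R -> R) : bc_cfun f -> bc_fun g ->
  (forall t, normc (f t) <= g t) -> normc (cint m f) <= (\int[m]_t g t)%R.
Proof.
move=> fb gb fg.
have [->|I0] := eqVneq (cint m f) 0.
  by rewrite normc_zero; apply: bc_Rintegral_ge0 => t; rewrite (le_trans _ (fg t))// normc_ge0.
set I := cint m f in I0 *.
pose u := (normc I)%:C / I.
have nu : normc u = 1.
  by rewrite /u normcM normc_real normcV ger0_norm ?normc_ge0// divff// normc_eq0.
have <- : Re (cint m (fun t => u * f t)) = normc I.
  by rewrite cintZ// -/I /u mulfVK.
have ufb : bc_cfun (fun t => u * f t) by apply: bc_cfunM => //; exact: bc_cfun_cst.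
apply: bc_le_Rintegral => //; first exact: bc_cfun_Re.
move=> t; rewrite (le_trans _ (fg t))//.
by rewrite (le_trans (ler_norm _))// (le_trans (Re_le_normc _))// normcM nu mul1r.
Qed.

End cint.

(** * Sectors and kernels *)

Section bounded_convergence.
Context {R : realType}.
Local Notation T := (measurableTypeR R).

Lemma bounded_cvg_Rintegral (m : {finite_measure set T -> \bar R})
    (f_ : nat -> R -> R) (f : R -> R) (K : R) :
  (forall n, measurable_fun [set: T] (f_ n)) -> measurable_fun [set: T] f ->
  (forall n t, `|f_ n t| <= K) -> (forall t, f_ n t @[n --> \oo] --> f t) ->
  (\int[m]_t f_ n t @[n --> \oo] --> \int[m]_t f t)%R.
Proof.
move=> mf_ mf fK ff.
have iK : m.-integrable [set: T] (EFin \o cst K) by apply: bc_fun_integrable; exact: bc_fun_cst.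
have [intf _ H] : [/\ m.-integrable [set: T] (fun t => (f t)%:E),
    (\int[m]_t `|(f_ n t)%:E - (f t)%:E|)%E @[n --> \oo] --> 0%E &
    (\int[m]_t (f_ n t)%:E)%E @[n --> \oo] --> (\int[m]_t (f t)%:E)%E].
  apply: (@dominated_convergence _ _ _ m _ measurableT (fun n t => (f_ n t)%:E)
    (fun t => (f t)%:E) (cst K%:E)) => //.
  - by move=> n; exact/measurable_EFinP.
  - exact/measurable_EFinP.
  - by apply: nearW => t _; apply: cvg_EFin; [exact: nearW|exact: ff].
  - by apply: nearW => t n _ /=; rewrite lee_fin.
apply: fine_cvg; rewrite fineK//.
exact: integrable_fin_num.
Qed.

End bounded_convergence.

Section wedge.
Context {R : realType}.
Implicit Types (z w : R[i]) (s t x : R).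

(* The sector |arg z - pi| < alpha, for s = (1 + cos alpha) / 2. *)
Definition wedge s : set R[i] := [set z | 2 * s * normc z < normc z - Re z].

Lemma wedge_neq0 s z : wedge s z -> z != 0.
Proof. by apply: contraTneq => ->; rewrite /wedge /mkset normc_zero mulr0 subr0 ltxx. Qed.

Lemma wedge_gt0 s z : wedge s z -> 0 < normc z.
Proof. by move=> /wedge_neq0; rewrite normc_gt0. Qed.

Lemma wedgeS s s' z : s' <= s -> wedge s z -> wedge s' z.
Proof.
by move=> ss; apply: le_lt_trans; rewrite ler_wpM2r ?normc_ge0// ler_wpM2l.
Qed.

Lemma cut_plane_lt z : cut_plane z -> Re z < normc z.
Proof.
rewrite /cut_plane /= => z0; have := Re_le_normc z; rewrite real_ler_norml ?num_real// => /andP[_].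
rewrite le_eqVlt => /predU1P[E|//]; exfalso; move/negP: z0; apply.
have /eqP : Im z ^+ 2 = 0 by have := normc_sqrE z; rewrite E; lra.
rewrite sqrf_eq0 => /eqP I0.
by rewrite lecE /= I0 eqxx E normc_ge0.
Qed.

Lemma wedge_cut_plane s z : 0 < s -> wedge s z -> cut_plane z.
Proof.
move=> s0 zs; have := zs; rewrite /wedge/cut_plane/= => zz; apply/negP => z0.
have Rz0 : 0 <= Re z by move: z0; rewrite lecE => /andP[].
have nz : normc z = Re z.
  by rewrite -[in LHS](RRe_real (ger0_real z0)) normc_real ger0_norm.
have := mulr_ge0 (ltW s0) Rz0; move: zz; rewrite nz; lra.
Qed.

Lemma cut_plane_wedge z : cut_plane z -> exists s, [/\ 0 < s, s < 1 & wedge s z].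
Proof.
move=> cz; have lt_z := cut_plane_lt cz.
have n0 : 0 < normc z.
  by rewrite normc_gt0; apply: contraTneq lt_z => ->; rewrite normc_zero ltxx.
have Rz : - normc z <= Re z.
  by have := Re_le_normc z; rewrite real_ler_norml ?num_real// => /andP[].
(* Half of the critical value (|z| - Re z) / (2 |z|): the inequality stays strict and the aperture
   is at most 1/2. *)
exists ((normc z - Re z) / (4 * normc z)); split.
- by rewrite divr_gt0 ?subr_gt0// mulr_gt0.
- rewrite ltr_pdivrMr ?mulr_gt0//; lra.
- rewrite /wedge/= -mulrA invfM mulrA -mulrA -!mulrA mulVf ?gt_eqF// mulr1; lra.
Qed.

(** Passing from z to w lowers |z| - Re z by at most 2 r |z| and multiplies the modulus by at most 1
    + r. Halving the aperture frees s |z|, which pays for both when 4 r <= s. *)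
Lemma wedge_perturb s r z w : s <= 1 -> 0 <= r -> 4 * r <= s ->
  wedge s z -> normc (w - z) <= r * normc z -> wedge (s / 2) w.
Proof.
move=> s1 r0 rs zs wz; have nz := wedge_gt0 zs; move: zs; rewrite /wedge/= => zs.
have h1 : normc w <= (1 + r) * normc z.
  by have := lerB_normc w z; lra.
have h2 : normc z - normc w <= r * normc z by rewrite (le_trans (lerB_normc _ _))// distcC.
have h3 : Re w <= Re z + r * normc z.
  have := le_trans (ler_norm _) (le_trans (Re_le_normc (w - z)) wz).
  by rewrite cReD cReN; lra.
have h4 : s * normc w <= s * ((1 + r) * normc z) by rewrite ler_wpM2l// (le_trans _ rs)// mulr_ge0.
have h5 : s * (r * normc z) <= r * normc z by rewrite ler_piMl// mulr_ge0// ltW.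
have h6 : 4 * r * normc z <= s * normc z by rewrite ler_wpM2r// ltW.
lra.
Qed.

Lemma wedge_quarter s z w : 0 < s -> s <= 1 -> wedge s z ->
  normc (w - z) <= s / 4 * normc z -> wedge (s / 2) w.
Proof.
move=> s0 s1; apply: wedge_perturb => //; first by rewrite divr_ge0// ltW.
by rewrite mulrC mulfVK// pnatr_eq0.
Qed.

(** With u = |z| t^2, the wedge gives Re z t^2 <= (1 - 2 s) u, so the squared modulus is at least 1
    - 2 (1 - 2 s) u + u^2 = s (1 + u)^2 + (1 - s) (1 - u)^2, and s^2 <= s. Every kernel bound in a
    sector comes from this one. *)
Lemma wedge_kernel s z t : 0 < s -> s <= 1 -> wedge s z ->
  s * (1 + normc z * t ^+ 2) <= normc (1 - z * t%:C ^+ 2).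
Proof.
move=> s0 s1; rewrite /wedge/= => zs.
have u0 : 0 <= normc z * t ^+ 2 by rewrite mulr_ge0 ?normc_ge0 ?sqr_ge0.
rewrite -ler_sqr ?nnegrE ?normc_ge0 ?mulr_ge0 ?addr_ge0 ?(ltW s0)//.
have -> : normc (1 - z * t%:C ^+ 2) ^+ 2 =
    1 - 2 * (Re z * t ^+ 2) + (normc z * t ^+ 2) ^+ 2.
  rewrite exprMn !normc_sqrE -rmorphXn; case: {zs u0} z => a b /=; ring.
set u := normc z * t ^+ 2 in u0 *.
have h1 : Re z * t ^+ 2 <= (1 - 2 * s) * u.
  rewrite /u (mulrA (1 - _)) ler_wpM2r ?sqr_ge0//; lra.
have h2 : s ^+ 2 * (1 + u) ^+ 2 <= s * (1 + u) ^+ 2.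
  by rewrite ler_wpM2r ?sqr_ge0// expr2 ler_piMl// ltW.
have h3 : 0 <= (1 - s) * (1 - u) ^+ 2 by rewrite mulr_ge0 ?sqr_ge0// subr_ge0.
rewrite exprMn; lra.
Qed.

Lemma kernel_neq0 z t : cut_plane z -> 1 - z * t%:C ^+ 2 != 0.
Proof.
move=> /cut_plane_wedge[s [s0 s1 zs]]; rewrite -normc_gt0.
rewrite (lt_le_trans _ (wedge_kernel t s0 (ltW s1) zs))//.
by rewrite mulr_gt0// ltr_pwDl// mulr_ge0 ?normc_ge0 ?sqr_ge0.
Qed.

Lemma continuous_sqr : continuous (fun t : R => t ^+ 2).
Proof. by move=> t; exact: exprn_continuous. Qed.

Lemma cts_kernelV z : cut_plane z -> cts_cfun (fun t : R => (1 - z * t%:C ^+ 2)^-1).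
Proof.
move=> cz; apply: cts_cfunV => [t|]; first exact: kernel_neq0.
apply: cts_cfunD; first exact: cts_cfun_cst.
apply/cts_cfunN/cts_cfunM; first exact: cts_cfun_cst.
under eq_fun do rewrite -rmorphXn; apply: cts_cfun_real; exact: continuous_sqr.
Qed.

Lemma cts_sqrC : cts_cfun (fun t : R => t%:C ^+ 2).
Proof.
under eq_fun do rewrite -rmorphXn; apply: cts_cfun_real; exact: continuous_sqr.
Qed.

Lemma normc_kernelV s z t : 0 < s -> s <= 1 -> wedge s z ->
  normc (1 - z * t%:C ^+ 2)^-1 <= s^-1 * (1 + normc z * t ^+ 2)^-1.
Proof.
move=> s0 s1 zs; rewrite normcV -invfM lef_pV2 ?posrE; first exact: wedge_kernel.
  by rewrite normc_gt0 kernel_neq0//; exact: wedge_cut_plane zs.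
by rewrite mulr_gt0// ltr_pwDl// mulr_ge0 ?normc_ge0 ?sqr_ge0.
Qed.

Lemma den_gt0 x t : 0 <= x -> 0 < 1 + x * t ^+ 2.
Proof. by move=> x0; rewrite ltr_pwDl// mulr_ge0 ?sqr_ge0. Qed.

Lemma bc_kernelV z : cut_plane z -> bc_cfun (fun t : R => (1 - z * t%:C ^+ 2)^-1).
Proof.
move=> cz; have [s [s0 s1 zs]] := cut_plane_wedge cz.
apply: (@bc_cfunP _ _ s^-1); first exact: cts_kernelV.
move=> t; rewrite (le_trans (normc_kernelV t s0 (ltW s1) zs))//.
rewrite ler_piMr ?invr_ge0 ?(ltW s0)// invf_le1 ?den_gt0 ?normc_ge0//.
by rewrite lerDl mulr_ge0 ?normc_ge0 ?sqr_ge0.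
Qed.

Lemma sqr_kernelV s z t : 0 < s -> s <= 1 -> wedge s z ->
  normc (t%:C ^+ 2 / (1 - z * t%:C ^+ 2)) <= (s * normc z)^-1.
Proof.
move=> s0 s1 zs; have nz := wedge_gt0 zs.
rewrite normcM normcX normc_real real_normK ?num_real//.
apply: (le_trans (ler_wpM2l (sqr_ge0 t) (normc_kernelV t s0 s1 zs))).
rewrite invfM mulrCA ler_pM2l ?invr_gt0//.
rewrite ler_pdivrMr ?den_gt0 ?(ltW nz)// mulrDr mulr1 mulKf ?gt_eqF//.
by rewrite lerDr invr_ge0 ltW.
Qed.

Lemma bc_sqr_kernelV z : cut_plane z ->
  bc_cfun (fun t : R => t%:C ^+ 2 / (1 - z * t%:C ^+ 2)).
Proof.
move=> cz; have [s [s0 s1 zs]] := cut_plane_wedge cz.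
apply: (@bc_cfunP _ _ (s * normc z)^-1) => [|t].
  by apply: cts_cfunM; [exact: cts_sqrC|exact: cts_kernelV].
by apply: sqr_kernelV => //; exact: ltW.
Qed.

Lemma bc_jump_kernel z : cut_plane z ->
  bc_cfun (fun t : R => z * t%:C ^+ 2 / (1 - z * t%:C ^+ 2)).
Proof.
move=> cz.
rewrite (_ : (fun t => _) = (fun t => z * (t%:C ^+ 2 / (1 - z * t%:C ^+ 2)))).
  exact: (bc_cfunM (bc_cfun_cst z) (bc_sqr_kernelV cz)).
by apply/funext => t; rewrite mulrA.
Qed.

Lemma bc_levy_kernel z : cut_plane z ->
  bc_cfun (fun t : R => (1 + t%:C ^+ 2) / (1 - z * t%:C ^+ 2)).
Proof.
move=> cz; under eq_fun do rewrite mulrDl mul1r.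
by apply: bc_cfunD; [exact: bc_kernelV|exact: bc_sqr_kernelV].
Qed.

(** Minus the integrand z (1 + t^2) / (1 - z t^2) at z = -x. In a wedge of aperture s it also bounds
    the modulus of this integrand at |z| = x, up to the factor 1/s; being positive and increasing in
    x, it serves as the gauge of all estimates. *)
Definition levy_kernel_abs x t : R := x * (1 + t ^+ 2) / (1 + x * t ^+ 2).

Lemma levy_kernel_abs_ge0 x t : 0 <= x -> 0 <= levy_kernel_abs x t.
Proof.
move=> x0; rewrite /levy_kernel_abs divr_ge0 ?mulr_ge0 ?addr_ge0 ?sqr_ge0//.
by rewrite mulr_ge0 ?sqr_ge0.
Qed.

Lemma levy_kernel_abs_le x t : 0 <= x -> levy_kernel_abs x t <= 1 + x.
Proof.
move=> x0; rewrite /levy_kernel_abs ler_pdivrMr ?den_gt0//.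
have := sqr_ge0 t; nra.
Qed.

Lemma levy_kernel_abs_le1 x t : 0 <= x -> x <= 1 -> levy_kernel_abs x t <= 1.
Proof.
move=> x0 x1; rewrite /levy_kernel_abs ler_pdivrMr ?den_gt0//.
have := sqr_ge0 t; nra.
Qed.

Lemma levy_kernel_abs_homo x y t : 0 <= x -> x <= y ->
  levy_kernel_abs x t <= levy_kernel_abs y t.
Proof.
move=> x0 xy; have y0 := le_trans x0 xy; rewrite /levy_kernel_abs.
rewrite ler_pdivrMr ?den_gt0// mulrAC ler_pdivlMr ?den_gt0//.
have := sqr_ge0 t; nra.
Qed.

Lemma bc_levy_kernel_abs x : 0 <= x -> bc_fun (levy_kernel_abs x).
Proof.
move=> x0; split; last first.
  by exists (1 + x) => t; rewrite ger0_norm ?levy_kernel_abs_ge0// levy_kernel_abs_le.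
move=> t; apply: cvgM.
  by apply: cvgM; [exact: cvg_cst|apply: cvgD; [exact: cvg_cst|exact: continuous_sqr]].
apply: cvgV; first by rewrite gt_eqF// den_gt0.
apply: cvgD; first exact: cvg_cst.
by apply: cvgM; [exact: cvg_cst|exact: continuous_sqr].
Qed.

End wedge.

Section levy_transform.
Context {R : realType}.
Local Notation T := (measurableTypeR R).
Variable G : {finite_measure set T -> \bar R}.
Implicit Types (z w : R[i]) (s t x : R).

Definition levy_abs x : R := (\int[G]_t levy_kernel_abs x t)%R.

Lemma levy_abs_ge0 x : 0 <= x -> 0 <= levy_abs x.
Proof. by move=> x0; apply: Rintegral_ge0 => t _; exact: levy_kernel_abs_ge0. Qed.

Lemma levy_abs_homo x y : 0 <= x -> x <= y -> levy_abs x <= levy_abs y.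
Proof.
move=> x0 xy; apply: bc_le_Rintegral => [||t].
- exact: bc_levy_kernel_abs.
- by apply: bc_levy_kernel_abs; exact: le_trans xy.
- exact: levy_kernel_abs_homo.
Qed.

(** Dominated convergence along x = 1/(n+1): for x <= 1 the kernel is at most 1, and it is at most x
    (1 + t^2), which tends to 0 for each t. *)
Lemma levy_abs_small (e : R) : 0 < e -> exists2 x : R, 0 < x <= 1 & levy_abs x < e.
Proof.
move=> e0.
have cvg0 : (levy_abs n.+1%:R^-1 @[n --> \oo] --> \int[G]_t (cst 0 t))%R.
  apply: (@bounded_cvg_Rintegral _ _ _ _ 1).
  - move=> n; apply: continuous_measurable_fun.
    by have [] : bc_fun (@levy_kernel_abs R n.+1%:R^-1) by apply: bc_levy_kernel_abs.
  - exact: measurable_cst.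
  - move=> n t; rewrite ger0_norm ?levy_kernel_abs_ge0// levy_kernel_abs_le1//.
    by rewrite invf_le1// ler1n.
  - move=> t; apply: (@squeeze_cvgr _ _ _ _ (cst 0) (fun n => n.+1%:R^-1 * (1 + t ^+ 2))).
    + apply: nearW => n /=; rewrite levy_kernel_abs_ge0//= /levy_kernel_abs.
      rewrite ler_piMr ?mulr_ge0 ?addr_ge0 ?sqr_ge0// invf_le1 ?den_gt0//.
      by rewrite lerDl mulr_ge0 ?sqr_ge0.
    + exact: cvg_cst.
    + rewrite -(mul0r (1 + t ^+ 2)); apply: cvgM; last exact: cvg_cst.
      exact: cvg_harmonic.
rewrite Rintegral_cst// mul0r in cvg0.
move/cvgrPdist_lt : cvg0 => /(_ _ e0) /filter_ex[n /=].
rewrite sub0r normrN ger0_norm ?levy_abs_ge0// => ne.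
by exists n.+1%:R^-1 => //; rewrite invr_gt0 ltr0n /= invf_le1// ler1n.
Qed.

Lemma normc_levy_num t : normc (1 + t%:C ^+ 2) = 1 + t ^+ 2.
Proof.
rewrite -rmorphXn -(rmorph1 (real_complex R)) -rmorphD normc_real ger0_norm//.
by rewrite addr_ge0 ?sqr_ge0.
Qed.

Lemma normc_levy_kernel s z t : 0 < s -> s <= 1 -> wedge s z ->
  normc ((1 + t%:C ^+ 2) / (1 - z * t%:C ^+ 2)) <=
  levy_kernel_abs (normc z) t / (s * normc z).
Proof.
move=> s0 s1 zs; have nz := wedge_gt0 zs.
rewrite normcM normc_levy_num.
apply: (le_trans (ler_wpM2l _ (normc_kernelV t s0 s1 zs))).
  by rewrite addr_ge0 ?sqr_ge0.
rewrite /levy_kernel_abs invfM le_eqVlt; apply/orP; left; apply/eqP.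
by field; rewrite !gt_eqF ?den_gt0 // ltW.
Qed.

Lemma normc_levy s z : 0 < s -> s <= 1 -> wedge s z ->
  normc (levy_transform G z) <= levy_abs (normc z) / s.
Proof.
move=> s0 s1 zs; have nz := wedge_gt0 zs.
have cz : cut_plane z := wedge_cut_plane s0 zs.
rewrite /levy_transform normcM.
rewrite (_ : _ / s = normc z * ((s * normc z)^-1 * levy_abs (normc z))); last first.
  by field; rewrite !gt_eqF.
rewrite ler_pM2l// /levy_abs -bc_RintegralZ; last by apply: bc_levy_kernel_abs; exact: ltW.
apply: normc_cint => [||t]; first exact: bc_levy_kernel.
  by apply: bc_funM; [exact: bc_fun_cst|apply: bc_levy_kernel_abs; exact: ltW].
by rewrite [leRHS]mulrC; exact: normc_levy_kernel.
Qed.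

(** The divided difference of the transform between z and w, written as one integral. *)
Definition levy_quot z w : R[i] :=
  cint G (fun t => (1 + t%:C ^+ 2) / (1 - z * t%:C ^+ 2) * (1 - w * t%:C ^+ 2)^-1).

Lemma levy_transformB z w : cut_plane z -> cut_plane w ->
  levy_transform G z - levy_transform G w = (z - w) * levy_quot z w.
Proof.
move=> cz cw; rewrite /levy_transform /levy_quot -!cintZ; last first.
- exact: bc_levy_kernel.
- exact: bc_levy_kernel.
- by apply: bc_cfunM; [exact: bc_levy_kernel|exact: bc_kernelV].
rewrite -cintB; last first.
- by apply: bc_cfunM; [exact: bc_cfun_cst|exact: bc_levy_kernel].
- by apply: bc_cfunM; [exact: bc_cfun_cst|exact: bc_levy_kernel].
apply: eq_cint => t; have := kernel_neq0 t cz; have := kernel_neq0 t cw.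
by move=> w0 z0; field; rewrite w0 z0.
Qed.

Lemma normc_levy_quot s s' z w : 0 < s -> s <= 1 -> 0 < s' -> s' <= 1 ->
  wedge s z -> wedge s' w ->
  normc (levy_quot z w) <= levy_abs (normc z) / (s * s' * normc z).
Proof.
move=> s0 s1 s0' s1' zs ws; have nz := wedge_gt0 zs.
have cz : cut_plane z := wedge_cut_plane s0 zs.
have cw : cut_plane w := wedge_cut_plane s0' ws.
rewrite [leRHS]mulrC /levy_abs -bc_RintegralZ; last by apply: bc_levy_kernel_abs; exact: ltW.
apply: normc_cint => [||t].
- by apply: bc_cfunM; [exact: bc_levy_kernel|exact: bc_kernelV].
- by apply: bc_funM; [exact: bc_fun_cst|apply: bc_levy_kernel_abs; exact: ltW].
rewrite normcM (_ : _ * _ = levy_kernel_abs (normc z) t / (s * normc z) * s'^-1); last first.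
  by field; rewrite !gt_eqF.
apply: ler_pM; rewrite ?normc_ge0//; first exact: normc_levy_kernel.
apply: (le_trans (normc_kernelV t s0' s1' ws)).
rewrite ler_piMr ?invr_ge0 ?(ltW s0')// invf_le1 ?den_gt0 ?normc_ge0//.
by rewrite lerDl mulr_ge0 ?normc_ge0 ?sqr_ge0.
Qed.

(** The constant depends on G only through [levy_abs] at |z|; a bound on the masses of a family of
    measures therefore makes the family equicontinuous. *)
Lemma levy_lipschitz s s' z w : 0 < s -> s <= 1 -> 0 < s' -> s' <= 1 ->
  wedge s z -> wedge s' w ->
  normc (levy_transform G z - levy_transform G w) <=
  levy_abs (normc z) / (s * s' * normc z) * normc (z - w).
Proof.
move=> s0 s1 s0' s1' zs ws.
rewrite levy_transformB; [|exact: wedge_cut_plane zs|exact: wedge_cut_plane ws].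
by rewrite normcM mulrC ler_wpM2r ?normc_ge0// normc_levy_quot.
Qed.

End levy_transform.

(** * Analyticity by bounded polynomial approximation *)

Section poly_norm.
Context {R : realType}.
Local Notation C := R[i].
Implicit Types (P Q : {poly C}) (r : R) (d : C).

(* The norm of a polynomial in the Wiener algebra of the disc of radius r. *)
Definition pnorm r P : R := \sum_(i < size P) normc P`_i * r ^+ i.

Lemma pnormE r P n : (size P <= n)%N -> pnorm r P = \sum_(i < n) normc P`_i * r ^+ i.
Proof.
move=> sn; rewrite /pnorm (big_ord_widen n (fun i => normc P`_i * r ^+ i))//.
rewrite big_mkcond; apply: eq_bigr => i _; case: ltnP => // iP.
by rewrite nth_default// normc_zero mul0r.
Qed.

Lemma pnorm_ge0 r P : 0 <= r -> 0 <= pnorm r P.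
Proof. by move=> r0; apply: sumr_ge0 => i _; rewrite mulr_ge0 ?normc_ge0 ?exprn_ge0. Qed.

Lemma pnormD r P Q : 0 <= r -> pnorm r (P + Q) <= pnorm r P + pnorm r Q.
Proof.
move=> r0; pose n := maxn (size P) (size Q).
rewrite (@pnormE r _ n) ?size_polyD// (@pnormE r P n) ?leq_maxl// (@pnormE r Q n) ?leq_maxr//.
rewrite -big_split; apply: ler_sum => i _ /=.
by rewrite coefD -mulrDl ler_wpM2r ?exprn_ge0// normcD.
Qed.

Lemma pnormMXaddC r P c : pnorm r (P * 'X + c%:P) = r * pnorm r P + normc c.
Proof.
have sPX : (size (P * 'X + c%:P)%R <= (size P).+1)%N.
  by rewrite size_MXaddC; case: ifP.
rewrite (pnormE r sPX) big_ord_recl /= coefD coefMX coefC !eqxx add0r expr0 mulr1 addrC.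
congr (_ + _); rewrite /pnorm mulr_sumr; apply: eq_bigr => i _.
by rewrite coefD coefMX coefC /= addr0 exprS mulrCA.
Qed.

Lemma pnormC r c : pnorm r c%:P = normc c.
Proof.
have := pnormMXaddC r 0 c; rewrite mul0r add0r => ->.
by rewrite /pnorm size_poly0 big_ord0 mulr0 add0r.
Qed.

Lemma pnormX r : pnorm r 'X = r.
Proof.
have := pnormMXaddC r 1 0; rewrite mul1r polyC0 addr0 => ->.
by rewrite -polyC1 pnormC normc_one mulr1 normc_zero addr0.
Qed.

Lemma pnormMC r c P : pnorm r (c%:P * P) = normc c * pnorm r P.
Proof.
rewrite (@pnormE r _ (size P)); last by rewrite mul_polyC size_scale_leq.
by rewrite mulr_sumr; apply: eq_bigr => i _; rewrite coefCM normcM mulrA.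
Qed.

Lemma pnormMX r P : pnorm r (P * 'X) = r * pnorm r P.
Proof. by rewrite -[P * 'X]addr0 -polyC0 pnormMXaddC normc_zero addr0. Qed.

Lemma pnormN r P : pnorm r (- P) = pnorm r P.
Proof. by rewrite -mulN1r -polyC1 -polyCN pnormMC normcN normc_one mul1r. Qed.

Lemma pnormM r P Q : 0 <= r -> pnorm r (P * Q) <= pnorm r P * pnorm r Q.
Proof.
move=> r0; elim/poly_ind: P => [|P c IH].
  by rewrite mul0r -polyC0 pnormC normc_zero mul0r.
rewrite mulrDl pnormMXaddC mulrDl (le_trans (pnormD _ _ r0))// lerD ?pnormMC//.
by rewrite mulrAC pnormMX -mulrA ler_wpM2l.
Qed.

Lemma pnorm_homo r r' P : 0 <= r -> r <= r' -> pnorm r P <= pnorm r' P.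
Proof.
move=> r0 rr; apply: ler_sum => i _; rewrite ler_wpM2l ?normc_ge0//.
by rewrite lerXn2r// nnegrE// (le_trans r0).
Qed.

Lemma normc_horner r P d : normc d <= r -> normc P.[d] <= pnorm r P.
Proof.
move=> dr; elim/poly_ind: P => [|P c IH].
  by rewrite horner0 -polyC0 pnormC.
rewrite hornerMXaddC pnormMXaddC (le_trans (normcD _ _))// lerD// normcM mulrC.
by rewrite ler_pM ?normc_ge0.
Qed.

Lemma pnorm_comp r P Q : 0 <= r -> pnorm r (Q \Po P) <= pnorm (pnorm r P) Q.
Proof.
move=> r0; elim/poly_ind: Q => [|Q c IH].
  by rewrite comp_poly0 -polyC0 !pnormC.
rewrite comp_polyD comp_polyM comp_polyX comp_polyC pnormMXaddC.
rewrite (le_trans (pnormD _ _ r0))// lerD// ?pnormC//.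
by rewrite (le_trans (pnormM _ _ r0))// mulrC ler_wpM2l ?pnorm_ge0.
Qed.

(** Horner induction. Staying in the disc of half radius makes the factor a contribute r/2, so the
    step to Q X + c yields [pnorm r Q] twice, which is exactly what the constant 2/r allows. *)
Lemma horner_lipschitz r Q a b : 0 < r -> 2 * normc a <= r -> 2 * normc b <= r ->
  normc (Q.[a] - Q.[b]) <= normc (a - b) * (2 / r * pnorm r Q).
Proof.
move=> r0 ar br; elim/poly_ind: Q => [|Q c IH].
  by rewrite !horner0 subrr normc_zero !mulr_ge0 ?normc_ge0 ?invr_ge0 ?pnorm_ge0 ?(ltW r0).
rewrite !hornerMXaddC pnormMXaddC.
have -> : Q.[a] * a + c - (Q.[b] * b + c) = (Q.[a] - Q.[b]) * a + Q.[b] * (a - b) by ring.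
rewrite (le_trans (normcD _ _))// !normcM.
have h1 : normc (Q.[a] - Q.[b]) * normc a <= normc (a - b) * (2 / r * pnorm r Q) * (r / 2).
  by apply: ler_pM; rewrite ?normc_ge0//; lra.
have h2 : normc Q.[b] * normc (a - b) <= pnorm r Q * normc (a - b).
  rewrite ler_wpM2r ?normc_ge0// normc_horner//; have := normc_ge0 b; lra.
have h3 : normc (a - b) * (2 / r * pnorm r Q) * (r / 2) = normc (a - b) * pnorm r Q.
  by field; rewrite gt_eqF.
have h4 : normc (a - b) * (2 / r * (r * pnorm r Q + normc c)) =
  2 * (normc (a - b) * pnorm r Q) + normc (a - b) * (2 / r * normc c).
  by field; rewrite gt_eqF.
have h5 : 0 <= normc (a - b) * (2 / r * normc c).
  by rewrite !mulr_ge0 ?normc_ge0 ?invr_ge0 ?(ltW r0).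
lra.
Qed.

Lemma pnorm_scale r k N P : 0 <= r -> 0 <= k -> k <= 1 ->
  (forall j, (j < N)%N -> P`_j = 0) -> pnorm (k * r) P <= k ^+ N * pnorm r P.
Proof.
move=> r0 k0 k1 P0; rewrite mulr_sumr; apply: ler_sum => i _.
rewrite exprMn mulrCA; case: (ltnP i N) => iN.
  by rewrite P0// normc_zero !mul0r !mulr0.
by rewrite ler_wpM2r ?mulr_ge0 ?normc_ge0 ?exprn_ge0// ler_wiXn2l.
Qed.

(** The constant term vanishes by letting x tend to 0; dividing by X then lowers N by one. Smallness
    along a single ray suffices. *)
Lemma coef0_of_small P (w : C) (e K : R) N : normc w = 1 -> 0 < e ->
  (forall x : R, 0 < x -> x < e -> normc P.[x%:C * w] <= K * x ^+ N) ->
  forall j, (j < N)%N -> P`_j = 0.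
Proof.
move=> w1 e0; elim: N P => [//|N IH] P PK.
have [Q [c PE]] : exists Q c, P = Q * 'X + c%:P.
  by elim/poly_ind: P {PK} => [|Q c _]; [exists 0, 0; rewrite mul0r add0r polyC0|exists Q, c].
have nx (x : R) : 0 < x -> normc (x%:C * w) = x.
  by move=> x0; rewrite normcM w1 mulr1 normc_real gtr0_norm.
have c0 : c = 0.
  apply/eqP; rewrite -normc_eq0 eq_le normc_ge0 andbT leNgt; apply/negP => c0.
  pose M := `|K| + pnorm e Q.
  have M0 : 0 <= M by rewrite addr_ge0// pnorm_ge0// ltW.
  (* At this x the inequality |c| <= M x would give |c| <= |c| M / (2 (M + 1)) < |c|. *)
  pose x := Num.min (Num.min (e / 2) 1) (normc c / (2 * (M + 1))).
  have x0 : 0 < x by rewrite !lt_min !divr_gt0//=; lra.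
  have xe : x < e.
    by apply: (@le_lt_trans _ _ (e / 2)); [rewrite !ge_min lexx|lra].
  have x1 : x <= 1 by rewrite !ge_min lexx orbT.
  have xc : x <= normc c / (2 * (M + 1)) by rewrite !ge_min lexx !orbT.
  have := PK x x0 xe; rewrite PE hornerMXaddC => h.
  have h1 : normc c <= normc (Q.[x%:C * w] * (x%:C * w) + c) + normc (Q.[x%:C * w] * (x%:C * w)).
    have := lerB_normc c (- (Q.[x%:C * w] * (x%:C * w))).
    by rewrite normcN opprK addrC (addrC c); lra.
  have h2 : normc (Q.[x%:C * w] * (x%:C * w)) <= pnorm e Q * x.
    by rewrite normcM nx// ler_wpM2r ?(ltW x0)// normc_horner// nx// ltW.
  have h3 : K * x ^+ N.+1 <= `|K| * x.
    rewrite exprS mulrCA mulrC; apply: ler_wpM2r; first exact: ltW.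
    apply: (le_trans (ler_norm _)); rewrite normrM ler_piMr// ger0_norm ?exprn_ge0 ?(ltW x0)//.
    by rewrite exprn_ile1// ltW.
  have h4 : normc c <= M * (normc c / (2 * (M + 1))).
    by apply: le_trans (ler_wpM2l M0 xc); rewrite /M; lra.
  have h5 : M * (normc c / (2 * (M + 1))) = normc c * (M / (2 * (M + 1))).
    by field; rewrite gt_eqF//; lra.
  have h6 : M / (2 * (M + 1)) < 1 by rewrite ltr_pdivrMr; lra.
  by move: h4; rewrite h5 leNgt -[X in _ < X]mulr1 ltr_pM2l// h6.
move=> [|j] jN; rewrite PE coefD coefMX coefC /= ?c0 ?addr0//.
apply: (IH Q) => // x x0 xe; have := PK x x0 xe.
rewrite PE c0 polyC0 addr0 hornerMX normcM nx// exprSr mulrA ler_pM2r//.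
Qed.

End poly_norm.

Section expandable.
Context {R : realType}.
Local Notation C := R[i].
Implicit Types (f g : C -> C) (z d : C) (r K : R).

(* Analyticity at z, in a form that is stable under composition without any
   manipulation of double series: up to order N, f is approximated by a
   polynomial whose norm is bounded independently of N. *)
Definition expandable_with K r f z := forall N, exists2 P : {poly C},
  pnorm r P <= K & forall d, normc d <= r ->
    normc (f (z + d) - P.[d]) <= K * (normc d / r) ^+ N.

Definition expandable f z := exists K r, 0 < r /\ expandable_with K r f z.

Lemma expandable_with_ge0 K r f z : 0 < r -> expandable_with K r f z -> 0 <= K.
Proof. by move=> r0 /(_ 0%N)[P PK _]; rewrite (le_trans _ PK)// pnorm_ge0// ltW. Qed.

Lemma expandable_weaken K r K' r' f z : 0 < r' -> r' <= r -> K <= K' ->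
  expandable_with K r f z -> expandable_with K' r' f z.
Proof.
move=> r0' rr KK H N; have r0 := lt_le_trans r0' rr.
have K0 := expandable_with_ge0 r0 H.
have [P PK PH] := H N; exists P.
  by rewrite (le_trans _ KK)// (le_trans _ PK)// pnorm_homo// ltW.
move=> d dr; rewrite (le_trans (PH d (le_trans dr rr)))//.
apply: ler_pM => //; first by rewrite exprn_ge0// divr_ge0 ?normc_ge0// ltW.
rewrite lerXn2r ?nnegrE ?divr_ge0 ?normc_ge0 ?(ltW r0) ?(ltW r0')//.
by rewrite ler_wpM2l ?normc_ge0// lef_pV2.
Qed.

Lemma expandable2 f g z z' : expandable f z -> expandable g z' ->
  exists K r, [/\ 0 < r, expandable_with K r f z & expandable_with K r g z'].
Proof.
move=> [K [r [r0 fK]]] [L [s [s0 gL]]]; exists (Num.max K L), (Num.min r s).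
have rs0 : 0 < Num.min r s by rewrite lt_min r0.
split => //.
  by apply: expandable_weaken fK; rewrite // ?ge_min ?le_max lexx.
by apply: expandable_weaken gL; rewrite // ?ge_min ?le_max lexx orbT.
Qed.

Lemma ratio_ge0 d r N : 0 < r -> 0 <= (normc d / r) ^+ N.
Proof. by move=> r0; rewrite exprn_ge0// divr_ge0 ?normc_ge0// ltW. Qed.

Lemma ratio_le1 d r N : 0 < r -> normc d <= r -> (normc d / r) ^+ N <= 1.
Proof.
move=> r0 dr; rewrite exprn_ile1// ?divr_ge0 ?normc_ge0 ?(ltW r0)//.
by rewrite ler_pdivrMr// mul1r.
Qed.

Lemma expandable_bound K r f z d : 0 < r -> expandable_with K r f z ->
  normc d <= r -> normc (f (z + d)) <= 2 * K.
Proof.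
move=> r0 /(_ 0%N)[P PK PH] dr; have := PH d dr; rewrite expr0 mulr1 => h.
have h1 := normc_horner P dr; have := lerB_normc (f (z + d)) P.[d]; lra.
Qed.

Lemma expandable_cst c z : expandable (fun=> c) z.
Proof.
exists (normc c), 1; split => // N; exists c%:P; first by rewrite pnormC.
by move=> d d1; rewrite hornerC subrr normc_zero mulr_ge0 ?normc_ge0 ?ratio_ge0.
Qed.

Lemma expandable_id z : expandable id z.
Proof.
exists (1 + normc z), 1; split => // N; exists ('X + z%:P).
  by rewrite (le_trans (pnormD _ _ ler01))// pnormX pnormC.
move=> d d1; rewrite hornerD hornerX hornerC /= (addrC d) subrr normc_zero.
by rewrite mulr_ge0 ?ratio_ge0// addr_ge0// normc_ge0.
Qed.

Lemma expandableD f g z : expandable f z -> expandable g z ->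
  expandable (fun x => f x + g x) z.
Proof.
move=> fe ge; have [K [r [r0 fK gK]]] := expandable2 fe ge.
exists (2 * K), r; split => // N; have [P PK PH] := fK N; have [Q QK QH] := gK N.
exists (P + Q); first by rewrite (le_trans (pnormD _ _ (ltW r0)))//; lra.
move=> d dr; rewrite hornerD.
have -> : f (z + d) + g (z + d) - (P.[d] + Q.[d]) =
  (f (z + d) - P.[d]) + (g (z + d) - Q.[d]) by ring.
have := PH d dr; have := QH d dr; have := normcD (f (z + d) - P.[d]) (g (z + d) - Q.[d]); lra.
Qed.

Lemma expandableM f g z : expandable f z -> expandable g z ->
  expandable (fun x => f x * g x) z.
Proof.
move=> fe ge; have [K [r [r0 fK gK]]] := expandable2 fe ge.
have K0 := expandable_with_ge0 r0 fK.
exists (3 * (K * K)), r; split => // N; have [P PK PH] := fK N; have [Q QK QH] := gK N.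
exists (P * Q).
  have := ler_pM (pnorm_ge0 P (ltW r0)) (pnorm_ge0 Q (ltW r0)) PK QK.
  have := pnormM P Q (ltW r0); have := mulr_ge0 K0 K0; lra.
move=> d dr; rewrite hornerM.
have -> : f (z + d) * g (z + d) - P.[d] * Q.[d] =
  (f (z + d) - P.[d]) * g (z + d) + P.[d] * (g (z + d) - Q.[d]) by ring.
rewrite (le_trans (normcD _ _))// !normcM.
have h1 := ler_pM (normc_ge0 _) (normc_ge0 _) (PH d dr) (expandable_bound r0 gK dr).
have h2 := ler_pM (normc_ge0 _) (normc_ge0 _) (le_trans (normc_horner P dr) PK) (QH d dr).
lra.
Qed.

Lemma expandableN f z : expandable f z -> expandable (fun x => - f x) z.
Proof.
move=> fe; under eq_fun do rewrite -mulN1r.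
by apply: expandableM => //; exact: expandable_cst.
Qed.

Lemma expandableB f g z : expandable f z -> expandable g z ->
  expandable (fun x => f x - g x) z.
Proof. by move=> fe ge; apply: expandableD => //; exact: expandableN. Qed.

Lemma expandable_with0 K r f z N (P : {poly C}) : 0 < r ->
  (forall d, normc d <= r -> normc (f (z + d) - P.[d]) <= K * (normc d / r) ^+ N.+1) ->
  P.[0] = f z.
Proof.
move=> r0 /(_ 0); rewrite normc_zero mul0r expr0n mulr0 addr0 => /(_ (ltW r0)) h.
apply/eqP; rewrite eq_sym -subr_eq0 -normc_eq0 eq_le normc_ge0 andbT.
exact: h.
Qed.

(** The approximants compose. With e = f(z + d) - f(z), the error splits into g(f(z) + e) - Q(e),
    small because |e|/r <= |d|/s, and Q(e) - Q(P(d)), small because Q is Lipschitz with a constant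
    that does not depend on N. Shrinking the radius from r to s keeps both e and P(d) in the half
    disc. *)
Lemma expandable_comp f g z : expandable f z -> expandable g (f z) ->
  expandable (fun x => g (f x)) z.
Proof.
move=> fe ge; have [K [r [r0 fK gK]]] := expandable2 fe ge.
have K0 := expandable_with_ge0 r0 fK.
(* The ratio of the new radius to the old one. An approximation of order 1 gives |e| <= 3 K |d| / r,
   and doubling it to enter the half disc gives the 6. *)
pose k : R := Num.min 1 (r / (6 * (K + 1))).
have K6 : 0 < 6 * (K + 1) by lra.
have k0 : 0 < k by rewrite lt_min ltr01 divr_gt0.
have k1 : k <= 1 by rewrite ge_min lexx.
have kK : 6 * (k * K) <= r.
  have : k <= r / (6 * (K + 1)) by rewrite ge_min lexx orbT.
  rewrite ler_pdivlMr//; lra.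
pose s := k * r.
have s0 : 0 < s by rewrite mulr_gt0.
have sr : s <= r by rewrite ler_piMl// ltW.
have fP N : exists P : {poly C}, [/\ pnorm s P <= r / 2 & forall d, normc d <= s ->
    [/\ 2 * normc (f (z + d) - f z) <= r * (normc d / s), 2 * normc P.[d] <= r &
     normc (f (z + d) - f z - P.[d]) <= K * (normc d / s) ^+ N.+1]].
  have [P PK PH] := fK N.+1; have P0 := expandable_with0 r0 PH.
  have [P1 P1K P1H] := fK 1%N; have P10 := expandable_with0 r0 P1H.
  have small (Q : {poly C}) (l : R) : Q.[0] = f z -> pnorm r Q <= K -> 0 <= l -> l <= 1 ->
      pnorm (l * r) (Q - (f z)%:P) <= l * (2 * K).
    move=> Q0 QK l0 l1; apply: (le_trans (@pnorm_scale _ _ _ 1 _ (ltW r0) l0 l1 _)).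
      by move=> [|//] _; rewrite coefB coefC /= -horner_coef0 Q0 subrr.
    rewrite expr1 ler_wpM2l//.
    have := pnormD Q (- (f z)%:P) (ltW r0); rewrite pnormN pnormC -Q0.
    have : normc Q.[0] <= pnorm r Q by rewrite normc_horner// normc_zero ltW.
    lra.
  exists (P - (f z)%:P); split.
    by have := small P k P0 PK (ltW k0) k1; rewrite -/s; lra.
  move=> d ds; have dr := le_trans ds sr; split.
  - have l1 : normc d / r <= 1 by rewrite ler_pdivrMr// mul1r.
    have l0 : 0 <= normc d / r by rewrite divr_ge0 ?normc_ge0// ltW.
    have := small P1 _ P10 P1K l0 l1; rewrite mulfVK ?gt_eqF// => h1.
    have := P1H d dr; rewrite expr1 => h2.
    have h3 := normc_horner (P1 - (f z)%:P) (lexx (normc d)).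
    rewrite hornerD hornerN hornerC in h3.
    have := distc_triangle P1.[d] (f (z + d)) (f z) => h4.
    have h5 : r * (normc d / s) = (normc d / r) * (r / k).
      by rewrite /s; field; rewrite !gt_eqF.
    have h6 : 6 * K <= r / k by rewrite ler_pdivlMr//; lra.
    have := ler_wpM2l l0 h6; rewrite h5; lra.
  - have := normc_horner (P - (f z)%:P) ds.
    by have := small P k P0 PK (ltW k0) k1; rewrite -/s; lra.
  - rewrite hornerD hornerN hornerC (_ : _ - _ = f (z + d) - P.[d]); last by ring.
    rewrite (le_trans (PH d dr))// ler_wpM2l// lerXn2r ?nnegrE ?divr_ge0 ?normc_ge0 ?(ltW r0) ?(ltW s0)//.
    by rewrite ler_wpM2l ?normc_ge0// lef_pV2.
exists (K + 2 / r * (K * K)), s; split => //.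
(* Orders N + 1 only: a positive exponent is what forces P(0) = f(z). Order 0 follows from order 1
   because |d|/s <= 1. *)
suff H N : exists2 P : {poly C}, pnorm s P <= K + 2 / r * (K * K) & forall d, normc d <= s ->
    normc (g (f (z + d)) - P.[d]) <= (K + 2 / r * (K * K)) * (normc d / s) ^+ N.+1.
  move=> [|N]; last exact: H.
  have [P PK PH] := H 0%N; exists P => // d ds; rewrite (le_trans (PH d ds))//.
  rewrite expr0 mulr1 ler_piMr ?ratio_le1//.
  by rewrite addr_ge0// !mulr_ge0// invr_ge0 ltW.
have rKK0 : 0 <= 2 / r * (K * K) by rewrite !mulr_ge0// invr_ge0 ltW.
have [P [Ps Pd]] := fP N; have [Q QK QH] := gK N.+1; exists (Q \Po P).
  apply: (le_trans (pnorm_comp _ _ (ltW s0))); rewrite (@le_trans _ _ K) ?lerDl//.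
  by rewrite (le_trans _ QK)// pnorm_homo ?pnorm_ge0 ?(ltW s0)//; lra.
move=> d ds; have [h1 h2 h3] := Pd d ds; rewrite horner_comp.
set e := f (z + d) - f z in h1 h3.
have fe' : f (z + d) = f z + e by rewrite /e [RHS]addrCA subrr addr0.
have er : 2 * normc e <= r.
  apply: (le_trans h1); rewrite ler_piMr ?(ltW r0)// -(expr1 (_ / _)) ratio_le1//.
have er' : normc e <= r by have := normc_ge0 e; lra.
have h4 := QH e er'.
have h5 : (normc e / r) ^+ N.+1 <= (normc d / s) ^+ N.+1.
  rewrite lerXn2r ?nnegrE ?divr_ge0 ?normc_ge0 ?(ltW r0) ?(ltW s0)//.
  rewrite ler_pdivrMr// mulrC (le_trans _ h1)//; have := normc_ge0 e; lra.
have h6 := ler_wpM2l K0 h5.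
have h7 := horner_lipschitz Q r0 er h2.
have h8 : normc (e - P.[d]) * (2 / r * pnorm r Q) <= K * (normc d / s) ^+ N.+1 * (2 / r * K).
  apply: ler_pM; rewrite ?normc_ge0 ?mulr_ge0 ?invr_ge0 ?pnorm_ge0 ?(ltW r0)//.
  by rewrite ler_wpM2l// divr_ge0// ltW.
have := distc_triangle Q.[e] (g (f (z + d))) Q.[P.[d]]; rewrite fe'.
have -> : (K + 2 / r * (K * K)) * (normc d / s) ^+ N.+1 =
  K * (normc d / s) ^+ N.+1 + K * (normc d / s) ^+ N.+1 * (2 / r * K) by ring.
lra.
Qed.

(* The sequence [F] is that of the iterated divided differences of [F 0] at z. *)
Lemma expandable_divided_difference (F : nat -> C -> C) z K r : 0 < r ->
  (forall j d, normc d <= r -> F j (z + d) = F j z + d * F j.+1 (z + d)) ->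
  (forall j d, normc d <= r -> normc (F j (z + d)) <= K / (2 * r) ^+ j) ->
  expandable (F 0%N) z.
Proof.
move=> r0 FS FK.
have K0 : 0 <= K.
  have := FK 0%N 0; rewrite normc_zero expr0 divr1 => /(_ (ltW r0)).
  exact/le_trans/normc_ge0.
(* The polynomial has the divided differences at z as coefficients. Their bound K / (2 r)^j, against
   powers of r, makes the norm a geometric series of ratio 1/2, hence the factor 2 whatever the
   degree. *)
have key N j : exists2 P : {poly C}, pnorm r P <= 2 * (K / (2 * r) ^+ j) &
    forall d, normc d <= r -> F j (z + d) - P.[d] = d ^+ N * F (j + N)%N (z + d).
  elim: N j => [|N IH] j.
    exists 0; first by rewrite -polyC0 pnormC normc_zero mulr_ge0// divr_ge0// exprn_ge0// mulr_ge0// ltW.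
    by move=> d dr; rewrite horner0 subr0 expr0 mul1r addn0.
  have [P PK PE] := IH j.+1; exists (P * 'X + (F j z)%:P).
    have := FK j 0; rewrite normc_zero addr0 => /(_ (ltW r0)) h.
    rewrite pnormMXaddC; have := ler_wpM2l (ltW r0) PK.
    have -> : r * (2 * (K / (2 * r) ^+ j.+1)) = K / (2 * r) ^+ j.
      by rewrite exprS; field; rewrite ?expf_neq0 ?mulf_neq0 ?gt_eqF//= !gt_eqF.
    lra.
  move=> d dr; rewrite hornerMXaddC FS// addnS -addSn exprS -mulrA -PE//; ring.
exists (2 * K), r; split => // N; have [P PK PE] := key N 0%N.
exists P; first by move: PK; rewrite expr0 divr1.
move=> d dr; rewrite PE// add0n normcM normcX.
apply: (le_trans (ler_wpM2l (exprn_ge0 _ (normc_ge0 _)) (FK N d dr))).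
rewrite expr_div_n exprMn invfM.
have -> : 2 * K * (normc d ^+ N / r ^+ N) = normc d ^+ N * (K * (2 * (r ^+ N)^-1)) by ring.
rewrite ler_wpM2l ?exprn_ge0 ?normc_ge0// ler_wpM2l// ler_wpM2r ?invr_ge0 ?exprn_ge0 ?(ltW r0)//.
by rewrite (@le_trans _ _ 1)// ?invf_le1 ?exprn_ege1 ?exprn_gt0// ?ler1n.
Qed.

Lemma expandable_inv z : z != 0 -> expandable (fun x => x^-1) z.
Proof.
move=> z0; have nz : 0 < normc z by rewrite normc_gt0.
have zd d : normc d <= normc z / 2 -> normc z / 2 <= normc (z + d) /\ z + d != 0.
  move=> dz; have h : normc z / 2 <= normc (z + d).
    by have := lerB_normc z (- d); rewrite normcN opprK; lra.
  by split => //; rewrite -normc_gt0; lra.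
(* The divided difference of 1/x between z and x is -1/(z x), so the iterated ones are explicit. *)
pose F j (x : C) := (- z^-1) ^+ j * x^-1.
rewrite (_ : (fun x => x^-1) = F 0%N); last by apply/funext => x; rewrite /F mul1r.
apply: (@expandable_divided_difference F z (2 / normc z) (normc z / 2)).
- by rewrite divr_gt0.
- move=> j d /zd[_ zd0]; rewrite /F exprS; field; by rewrite ?z0 ?zd0.
- move=> j d /zd[h zd0]; rewrite /F normcM normcX normcN !normcV mulrC.
  rewrite (_ : 2 * (normc z / 2) = normc z) ?exprVn; last by field.
  rewrite ler_wpM2r ?invr_ge0 ?exprn_ge0 ?normc_ge0//.
  by rewrite -invf_div lef_pV2 ?posrE ?divr_gt0 ?normc_gt0.
Qed.

Lemma expandableV f z : expandable f z -> f z != 0 -> expandable (fun x => (f x)^-1) z.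
Proof. by move=> fe f0; apply: (@expandable_comp f (fun x => x^-1)) => //; exact: expandable_inv. Qed.

Lemma pnorm_tail (P : {poly C}) N r d : 0 < r -> normc d <= r -> (forall j, (j < N)%N -> P`_j = 0) ->
  normc P.[d] <= (normc d / r) ^+ N * pnorm r P.
Proof.
move=> r0 dr P0; have l0 : 0 <= normc d / r by rewrite divr_ge0 ?normc_ge0// ltW.
have l1 : normc d / r <= 1 by rewrite ler_pdivrMr// mul1r.
apply: le_trans (pnorm_scale (ltW r0) l0 l1 P0).
by rewrite normc_horner// mulfVK// gt_eqF.
Qed.

Lemma expandable_taylor1 f z : expandable f z -> exists l K r, 0 < r /\
  forall d, normc d <= r -> normc (f (z + d) - f z - l * d) <= K * normc d ^+ 2.
Proof.
move=> [K [r [r0 fK]]]; have [P PK PH] := fK 2%N.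
have P0 := expandable_with0 r0 PH.
pose Q := P - ((P`_1)%:P * 'X + (P`_0)%:P).
exists P`_1, ((K + pnorm r Q) / r ^+ 2), r; split => // d dr.
have Q0 j : (j < 2)%N -> Q`_j = 0.
  by case: j => [|[|//]] _; rewrite coefB coefD coefMX !coefC /= ?add0r ?addr0 subrr.
have := PH d dr; have := pnorm_tail r0 dr Q0.
have -> : Q.[d] = P.[d] - f z - P`_1 * d.
  by rewrite /Q hornerD hornerN hornerMXaddC hornerC -horner_coef0 P0; ring.
have := distc_triangle P.[d] (f (z + d)) (f z + P`_1 * d).
rewrite !opprD !addrA expr_div_n.
have -> : (K + pnorm r Q) / r ^+ 2 * normc d ^+ 2 =
  K * (normc d ^+ 2 / r ^+ 2) + normc d ^+ 2 / r ^+ 2 * pnorm r Q by ring.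
lra.
Qed.

Lemma expandable_derivable f z : expandable f z -> derivable f z 1.
Proof.
move=> /expandable_taylor1[l [K [r [r0 H]]]].
apply: (@derivable_normc _ f z l) => e e0.
have K0 : 0 < `|K| + 1 by rewrite ltr_wpDl.
exists (Num.min r (e / (`|K| + 1))); first by rewrite lt_min r0 divr_gt0.
move=> h h0; rewrite lt_min => /andP[hr he]; have nh : 0 < normc h by rewrite normc_gt0.
have -> : (f (z + h) - f z) / h - l = (f (z + h) - f z - l * h) / h by field.
rewrite normcM normcV ltr_pdivrMr//; apply: (le_lt_trans (H h (ltW hr))).
rewrite expr2 mulrA ltr_pM2r//; move: he; rewrite ltr_pdivlMr//.
have := ler_norm K; nra.
Qed.

(** Vanishing on the segment makes the approximant of order N small of order N there, so it has no
    term of degree below N. Hence |f(z + d)| <= 2 K (|d|/r)^N for every N, with the same K, and the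
    right side tends to 0. *)
Lemma expandable_vanish f z (u : C) (e : R) : normc u = 1 -> 0 < e -> expandable f z ->
  (forall x : R, 0 < x -> x < e -> f (z + x%:C * u) = 0) ->
  exists2 r, 0 < r & forall d, normc d < r -> f (z + d) = 0.
Proof.
move=> u1 e0 [K [r [r0 fK]]] f0; exists r => // d dr.
have K0 := expandable_with_ge0 r0 fK.
have l0 : 0 <= normc d / r by rewrite divr_ge0 ?normc_ge0// ltW.
have l1 : normc d / r < 1 by rewrite ltr_pdivrMr// mul1r.
have bound N : normc (f (z + d)) <= 2 * K * (normc d / r) ^+ N.
  have [P PK PH] := fK N.
  have er0 : 0 < Num.min e r by rewrite lt_min e0.
  have P0 j : (j < N)%N -> P`_j = 0.
    apply: (@coef0_of_small _ _ _ _ (K / r ^+ N) _ u1 er0) => x x0.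
    rewrite lt_min => /andP[xe xr].
    have nx : normc (x%:C * u) = x by rewrite normcM u1 mulr1 normc_real gtr0_norm.
    have := PH (x%:C * u); rewrite nx f0// sub0r normcN expr_div_n => /(_ (ltW xr)).
    by rewrite mulrA mulrAC.
  have := PH d (ltW dr); have := pnorm_tail r0 (ltW dr) P0.
  have := ler_wpM2l (exprn_ge0 N l0) PK.
  have := lerB_normc (f (z + d)) P.[d]; lra.
apply/eqP; rewrite -normc_eq0 eq_le normc_ge0 andbT.
have cvg0 : 2 * K * (normc d / r) ^+ n @[n --> \oo] --> 2 * K * (0 : R).
  by apply: cvgM; [exact: cvg_cst|apply: cvg_expr; rewrite ger0_norm].
rewrite mulr0 in cvg0; rewrite -(cvg_lim _ cvg0)//.
apply: limr_ge; first by apply/cvg_ex; exists 0.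
by apply: nearW => n; exact: bound.
Qed.

(** Connectedness of the ray: at the supremum a of the initial segments where f vanishes,
    [expandable_vanish] in the backward direction -u gives zeros on a full disc around a, hence
    beyond a. *)
Lemma expandable_ray f (u : C) (b e : R) : normc u = 1 -> 0 < e ->
  (forall x : R, 0 < x -> x < b -> expandable f (x%:C * u)) ->
  (forall x : R, 0 < x -> x < e -> x < b -> f (x%:C * u) = 0) ->
  forall x : R, 0 < x -> x < b -> f (x%:C * u) = 0.
Proof.
move=> u1 e0 fe f0 x x0 xb; apply: contrapT => fx.
pose S : set R := [set y | 0 < y <= x /\ forall t, 0 < t -> t < y -> f (t%:C * u) = 0].
have supS : has_sup S.
  split; last by exists x => y [/andP[]].
  exists (Num.min e x); split; first by rewrite lt_min e0 x0/= ge_min lexx orbT.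
  by move=> t t0; rewrite lt_min => /andP[te tx]; apply: f0 => //; exact: lt_trans xb.
set a := sup S.
have a0 : 0 < a.
  apply: (@lt_le_trans _ _ (Num.min e x)); first by rewrite lt_min e0.
  apply: ub_le_sup; first by case: supS.
  split; first by rewrite lt_min e0 x0/= ge_min lexx orbT.
  by move=> t t0; rewrite lt_min => /andP[te tx]; apply: f0 => //; exact: lt_trans xb.
have ax : a <= x by apply: ge_sup => //; [case: supS|move=> y [/andP[]]].
have fa t : 0 < t -> t < a -> f (t%:C * u) = 0.
  move=> t0 ta; have [y [_ yS] ty] := sup_gt supS.1 ta; exact: yS.
have nu1 : normc (- u) = 1 by rewrite normcN.
have fea := fe a a0 (le_lt_trans ax xb).
have [|r r0 fr] := expandable_vanish nu1 a0 fea.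
  move=> t t0 ta; rewrite mulrN -mulrBl -rmorphB; apply: fa; rewrite ?subr_gt0//.
  by rewrite ltrBlDr ltrDl.
have fa' t : 0 < t -> t < a + r -> f (t%:C * u) = 0.
  move=> t0 tar; case: (ltP t a) => [|ta]; first exact: fa.
  rewrite -(subrK (a%:C * u) (t%:C * u)) addrC; apply: fr.
  rewrite -mulrBl -rmorphB normcM u1 mulr1 normc_real ger0_norm ?subr_ge0//.
  by rewrite ltrBlDl.
case: (ltP x (a + r)) => [xar|arx]; first by apply: fx; exact: fa'.
have : S (a + r) by split => //; rewrite arx addr_gt0.
move=> /(ub_le_sup supS.2); rewrite -/a leNgt ltrDl r0//.
Qed.

End expandable.

(** * Analyticity of the Levy transform off the nonnegative half-line *)

Section levy_expandable.
Context {R : realType}.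
Local Notation T := (measurableTypeR R).
Variable G : {finite_measure set T -> \bar R}.
Implicit Types (z w d : R[i]) (s t x : R).

(** Each divided difference at z beyond the first multiplies the integrand by t^2 / (1 - z t^2),
    which is bounded by 1 / (s |z|). The geometric growth required by
    [expandable_divided_difference] follows. *)
Lemma expandable_levy z : cut_plane z -> expandable (levy_transform G) z.
Proof.
move=> cz; have [s [s0 s1 zs]] := cut_plane_wedge cz; have nz := wedge_gt0 zs.
pose v (t : R) := t%:C ^+ 2 / (1 - z * t%:C ^+ 2).
pose k j w (t : R) := (1 + t%:C ^+ 2) / (1 - w * t%:C ^+ 2) * (1 - z * t%:C ^+ 2)^-1 * v t ^+ j.
pose F j w := if j is j'.+1 then cint G (k j' w) else levy_transform G w.
(* Small enough for the disc to stay in the wedge of aperture s/2 ([wedge_quarter]), and 2 r <= s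
   |z| as the bound on the kernels requires. *)
pose r := s * normc z / 4.
have r0 : 0 < r by rewrite divr_gt0// mulr_gt0.
have near d : normc d <= r -> [/\ wedge (s / 2) (z + d), normc z <= 2 * normc (z + d) &
    normc (z + d) <= 2 * normc z].
  move=> dr; have sz : s * normc z <= normc z by rewrite ler_piMl// ltW.
  move: dr; rewrite /r => dr; split.
  - apply: (wedge_quarter s0 (ltW s1) zs).
    by rewrite (addrC z) addrK; lra.
  - by have := lerB_normc z (- d); rewrite opprK normcN; lra.
  - by have := normcD z d; lra.
have s20 : 0 < s / 2 by lra.
have s21 : s / 2 <= 1 by lra.
have cd d : normc d <= r -> cut_plane (z + d) by move=> /near[zd _ _]; exact: wedge_cut_plane zd.
have bk j w : cut_plane w -> bc_cfun (k j w).
  move=> cw; apply: bc_cfunM; last by apply: bc_cfunX; exact: bc_sqr_kernelV.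
  by apply: bc_cfunM; [exact: bc_levy_kernel|exact: bc_kernelV].
pose B := levy_abs G (2 * normc z).
have B0 : 0 <= B by rewrite levy_abs_ge0// mulr_ge0// ltW.
have lev d : normc d <= r -> levy_abs G (normc (z + d)) <= B.
  by move=> /near[_ _ h]; apply: levy_abs_homo => //; exact: normc_ge0.
have kd j d : normc d <= r ->
    normc (cint G (k j (z + d))) <= 4 * B / (s ^+ 2 * normc z) / (2 * r) ^+ j.
  move=> dr; have [zd h1 h2] := near d dr.
  pose c := ((s / 2) * normc (z + d))^-1 * s^-1 * (s * normc z)^-1 ^+ j.
  have nzd := wedge_gt0 zd.
  have c0 : 0 <= c.
    by rewrite /c !mulr_ge0 ?exprn_ge0 ?invr_ge0 ?mulr_ge0// ?invr_ge0 ltW.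
  apply: (@le_trans _ _ (c * levy_abs G (normc (z + d)))).
    rewrite -bc_RintegralZ; last by apply: bc_levy_kernel_abs; exact: ltW.
    apply: normc_cint => [||t]; first by apply: bk; exact: cd.
      by apply: bc_funM; [exact: bc_fun_cst|apply: bc_levy_kernel_abs; exact: ltW].
    have hA := normc_levy_kernel t s20 s21 zd.
    have hB : normc (1 - z * t%:C ^+ 2)^-1 <= s^-1.
      apply: (le_trans (normc_kernelV t s0 (ltW s1) zs)).
      rewrite ler_piMr ?invr_ge0 ?(ltW s0)// invf_le1 ?den_gt0 ?(ltW nz)//.
      by rewrite lerDl mulr_ge0 ?(ltW nz) ?sqr_ge0.
    have hV : normc (v t) ^+ j <= (s * normc z)^-1 ^+ j.
      rewrite lerXn2r ?nnegrE ?normc_ge0 ?invr_ge0 ?mulr_ge0 ?(ltW nz) ?(ltW s0)//.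
      by apply: sqr_kernelV => //; exact: ltW.
    rewrite /k normcM normcM normcX.
    rewrite (_ : c * _ = levy_kernel_abs (normc (z + d)) t / (s / 2 * normc (z + d)) *
      s^-1 * (s * normc z)^-1 ^+ j); last by rewrite /c; ring.
    by rewrite !ler_pM ?mulr_ge0 ?exprn_ge0 ?normc_ge0.
  rewrite mulrC -/B; apply: (@le_trans _ _ (B * c)); first by rewrite ler_wpM2r// lev.
  rewrite [leRHS](_ : _ = B * (4 / (s ^+ 2 * normc z) * ((2 * r) ^+ j)^-1)); last by ring.
  have sn0 := mulr_ge0 (ltW s0) (ltW nz).
  rewrite ler_wpM2l// /c ler_pM ?mulr_ge0 ?invr_ge0 ?exprn_ge0 ?mulr_ge0 ?invr_ge0 ?sn0
    ?(ltW s0) ?(ltW nz) ?(ltW nzd)//.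
    rewrite -invfM -[4 / _]invf_div lef_pV2 ?posrE ?divr_gt0 ?mulr_gt0 ?exprn_gt0//.
    rewrite ler_pdivrMr// (_ : _ * 4 = 2 * s ^+ 2 * normc (z + d)); last by field.
    have := ler_wpM2l (sqr_ge0 s) h1; lra.
  rewrite exprVn lef_pV2 ?posrE ?exprn_gt0 ?mulr_gt0//.
  rewrite lerXn2r ?nnegrE ?mulr_ge0 ?(ltW s0) ?(ltW nz) ?(ltW r0)//.
  by rewrite /r; have := mulr_gt0 s0 nz; lra.
(* The second term covers the transform itself; the first covers the integrals, the extra 2 r
   compensating the shift of index between [F j.+1] and [k j]. *)
pose K := 4 * B / (s ^+ 2 * normc z) * (2 * r) + B / (s / 2).
have K10 : 0 <= 4 * B / (s ^+ 2 * normc z).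
  by rewrite divr_ge0 ?mulr_ge0 ?sqr_ge0// ltW.
have K20 : 0 <= B / (s / 2) by rewrite divr_ge0// ltW.
apply: (@expandable_divided_difference _ F z K r) => //.
- move=> [|j] d dr /=.
    have hB := levy_transformB G (cd d dr) cz.
    rewrite (addrC z) addrK in hB; rewrite (addrC z).
    rewrite (_ : cint G _ = levy_quot G (d + z) z) -?hB ?(addrC (levy_transform G z)) ?subrK//.
    by apply: eq_cint => t; rewrite /k expr0 mulr1.
  rewrite -cintZ; last by apply: bk; exact: cd.
  rewrite -cintD; last 2 first.
  - exact: bk.
  - by apply: bc_cfunM; [exact: bc_cfun_cst|apply: bk; exact: cd].
  apply: eq_cint => t; rewrite /k (exprS (v t)).
  have := kernel_neq0 t cz; have := kernel_neq0 t (cd _ dr).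
  by move: (v t ^+ j) => vj h1 h2; rewrite /v; field; rewrite h1 h2.
- move=> [|j] d dr /=.
    rewrite expr0 divr1; have [zd h1 h2] := near d dr.
    apply: (le_trans (normc_levy G s20 s21 zd)).
    rewrite /K (@le_trans _ _ (B / (s / 2)))//.
      by rewrite ler_wpM2r ?lev// invr_ge0 ltW.
    by rewrite lerDr mulr_ge0// mulr_ge0// ltW.
  apply: (le_trans (kd j d dr)).
  rewrite [leRHS](_ : _ = K / (2 * r) / (2 * r) ^+ j); last by rewrite (exprS (2 * r)) invfM mulrA.
  have r20 : 0 < 2 * r by rewrite mulr_gt0.
  rewrite ler_wpM2r ?invr_ge0 ?exprn_ge0 ?(ltW r20)//.
  by rewrite ler_pdivlMr ?mulr_gt0// /K lerDl.
Qed.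

End levy_expandable.

Section contraction.
Context {R : realType}.

Lemma cvg_geometric_increments (u : nat -> R) (c : R) :
  (forall n, `|u n.+1 - u n| <= c * 2^-1 ^+ n) -> cvgn u.
Proof.
move=> uc; rewrite (_ : u = fun n => u 0%N + series (telescope u) n); last first.
  by apply/funext => n; exact: eq_sum_telescope.
apply: is_cvgD; first exact: is_cvg_cst.
apply: normed_cvg.
apply: (@series_le_cvg _ _ (geometric c 2^-1)) => //.
- by move=> n; exact: normr_ge0.
- by move=> n; exact: le_trans (normr_ge0 _) (uc n).

- by apply: is_cvg_geometric_series; rewrite ger0_norm//; lra.
Qed.

(** Banach iteration from the centre of the disc, with the limit obtained separately for real and
    imaginary parts. *)
Lemma contraction_fixpoint (g : R[i] -> R[i]) (z : R[i]) (r : R) :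
  (forall y, normc (y - z) <= r -> normc (g y - z) <= r) ->
  (forall y y', normc (y - z) <= r -> normc (y' - z) <= r ->
     normc (g y - g y') <= 2^-1 * normc (y - y')) ->
  0 <= r -> exists2 y, normc (y - z) <= r & g y = y.
Proof.
move=> gr gc r0; pose y n := iter n g z.
have yr n : normc (y n - z) <= r.
  by elim: n => [|n IH]; [rewrite subrr normc_zero|exact: gr].
have yS n : normc (y n.+1 - y n) <= r * 2^-1 ^+ n.
  elim: n => [|n IH]; first by rewrite expr0 mulr1; exact: (yr 1%N).
  by apply: (le_trans (gc _ _ (yr n.+1) (yr n))); rewrite exprS mulrCA ler_wpM2l.
have /cvg_ex[a ya] : cvgn (fun n => Re (y n)).
  apply: (@cvg_geometric_increments _ r) => n; rewrite (le_trans _ (yS n))//.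
  by rewrite -cReN -cReD Re_le_normc.
have /cvg_ex[b yb] : cvgn (fun n => Im (y n)).
  apply: (@cvg_geometric_increments _ r) => n; rewrite (le_trans _ (yS n))//.
  by rewrite -cImN -cImD Im_le_normc.
pose l : R[i] := a +i* b.
have yl (e : R) : 0 < e -> exists n, normc (y n - l) < e /\ normc (y n.+1 - l) < e.
  move=> e0; have e20 : 0 < e / 2 by lra.
  have near_l : \forall n \near \oo, normc (y n - l) < e.
    have /cvgrPdist_lt/(_ _ e20) := ya; have /cvgrPdist_lt/(_ _ e20) := yb.
    apply: filter_app2; near=> n => hb ha.
    apply: (le_lt_trans (normc_le_ReIm _)); rewrite cReD cReN cImD cImN /=.
    by move: ha hb; rewrite distrC (distrC b); lra.
  have near_l' : \forall n \near \oo, normc (y n.+1 - l) < e.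
    by have [N _ HN] := near_l; exists N => //= n Nn; exact: (HN n.+1 (leqW Nn)).
  by have [n] := filter_ex (filterI near_l near_l'); exists n.
Unshelve. all: try by end_near.
have lr : normc (l - z) <= r.
  apply/ler_addgt0Pl => e e0; have [n [h _]] := yl e e0.
  by have := distc_triangle (y n) l z; have := yr n; rewrite (distcC l (y n)); lra.
exists l => //; apply/eqP; rewrite -subr_eq0 -normc_eq0 eq_le normc_ge0 andbT.
apply/ler_addgt0Pl => e e0; have e20 : 0 < e / 2 by lra.
have [n [h1 h2]] := yl _ e20.
have := gc _ _ lr (yr n); rewrite (distcC l (y n)) => h3.
have := distc_triangle (y n.+1) (g l) l; rewrite -/(y n.+1); move: h3; rewrite -[g (y n)]/(y n.+1); lra.
Qed.

End contraction.

(** * Inversion of H *)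

Section rectT.
Context {R : realType}.
Variables (lambda : R) (lambda01 : 0 <= lambda <= 1).
Local Notation C := R[i].
Implicit Types (x y : C).

Definition rectT x : C := (lambda%:C * x + 1) * (x + 1).

Lemma normc_lambda : normc lambda%:C <= 1.
Proof. by rewrite normc_real ger0_norm; case/andP: lambda01. Qed.

Lemma rectT_lipschitz x y : normc x <= 1 -> normc y <= 1 ->
  normc (rectT x - rectT y) <= 4 * normc (x - y).
Proof.
move=> x1 y1; have -> : rectT x - rectT y = (1 + lambda%:C * (1 + (x + y))) * (x - y).
  by rewrite /rectT; ring.
rewrite normcM ler_wpM2r ?normc_ge0// (le_trans (normcD _ _))// normc_one normcM.
have h1 : normc (1 + (x + y)) <= 3.
  by have := normcD 1 (x + y); have := normcD x y; rewrite normc_one; lra.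
have := ler_pM (normc_ge0 _) (normc_ge0 _) normc_lambda h1; lra.
Qed.

Lemma rectT0 : rectT 0 = 1.
Proof. by rewrite /rectT mulr0 !add0r mul1r. Qed.

Lemma rectT_near1 x : normc x <= 1 -> normc (rectT x - 1) <= 4 * normc x.
Proof.
move=> x1; have := @rectT_lipschitz x 0 x1; rewrite normc_zero ler01 rectT0 subr0.
exact.
Qed.

Lemma expandable_rectT f z : expandable f z -> expandable (fun w => rectT (f w)) z.
Proof.
move=> fe; apply: expandableM; apply: expandableD; try exact: expandable_cst; last by [].
by apply: expandableM => //; exact: expandable_cst.
Qed.

(** The radicand is the square of w = 2 lambda x + lambda + 1, and |x| <= 1/2 gives Re w > 0, which
    selects w among the two square roots. *)
Lemma rectU_rectT x : 2 * normc x <= 1 -> rectU lambda (rectT x - 1) = x.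
Proof.
move=> x1; rewrite /rectU; case: ifPn => [/eqP l0|l0].
  by rewrite /rectT l0 mul0r add0r mul1r addrK.
pose w : C := 2 * lambda%:C * x + lambda%:C + 1.
have -> : (lambda%:C + 1) ^+ 2 + 4 * lambda%:C * (rectT x - 1) = w ^+ 2.
  by rewrite /rectT /w; ring.
have lC0 : lambda%:C != 0 by rewrite -normc_eq0 normc_real normr_eq0.
have Rw : 0 < Re w.
  rewrite /w !cReD /= (_ : 2 * lambda%:C * x = (2 * lambda)%:C * x); last first.
    by rewrite rmorphM rmorph_nat.
  rewrite cReM /= mul0r subr0.
  have := Re_le_normc x; rewrite real_ler_norml ?num_real// => /andP[h _].
  have /andP[l1 l2] := lambda01; nra.
have sw : sqrtc (w ^+ 2) = w.
  have : sqrtc (w ^+ 2) ^+ 2 = w ^+ 2 by exact: sqr_sqrtc.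
  move/eqP; rewrite eqf_sqr => /orP[/eqP//|/eqP h].
  have : 0 <= Re (sqrtc (w ^+ 2)) by case: (w ^+ 2) => a b /=; exact: sqrtr_ge0.
  by rewrite h cReN oppr_ge0 leNgt Rw.
by rewrite sw /w; field; rewrite lC0.
Qed.

End rectT.

Section inversion.
Context {R : realType}.
Local Notation T := (measurableTypeR R).
Variables (lambda : R) (lambda01 : 0 <= lambda <= 1).
Variable G : {finite_measure set T -> \bar R}.
Local Notation C := R[i].
Local Notation L := (levy_transform G).
Implicit Types (z w y : C) (s b k : R).

Definition wedge_disc s b : set C := [set z | wedge s z /\ normc z < b].

(** The function H of a symmetric rho when G is [jump_measure 1 rho] (see [rectH_levyH]); the
    inversion below works for any finite G. *)
Definition levyH z : C := z * rectT lambda (L z).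

Lemma levy_small s k : 0 < s -> s <= 1 -> 0 < k -> exists2 b, 0 < b &
  forall z, wedge_disc s b z -> levy_abs G (normc z) <= k /\ normc (L z) <= k.
Proof.
move=> s0 s1 k0; have [b /andP[b0 b1] Gb] := levy_abs_small G (mulr_gt0 s0 k0).
exists b => // z [zs zb].
have h : levy_abs G (normc z) <= s * k.
  by rewrite (le_trans _ (ltW Gb))// levy_abs_homo ?normc_ge0// ltW.
split; first by rewrite (le_trans h)// ler_piMl// ltW.
by rewrite (le_trans (normc_levy G s0 s1 zs))// ler_pdivrMr// mulrC.
Qed.

(** The second bound makes H - id a contraction near 0 in the sector; existence and uniqueness of
    preimages both rest on it. *)
Lemma levyH_near_id s k : 0 < s -> s <= 1 -> 0 < k -> exists2 b, 0 < b &
  forall z w, wedge_disc s b z -> wedge_disc s b w ->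
    normc (levyH z - z) <= k * normc z /\
    normc (levyH z - z - (levyH w - w)) <= k * normc (z - w).
Proof.
move=> s0 s1 k0; pose e := Num.min 1 (s ^+ 2 * k / 8).
have e0 : 0 < e by rewrite lt_min ltr01 divr_gt0// mulr_gt0// exprn_gt0.
have e1 : e <= 1 by rewrite ge_min lexx.
have ek : e <= s ^+ 2 * k / 8 by rewrite ge_min lexx orbT.
have s21 : s ^+ 2 <= 1 by rewrite exprn_ile1// ltW.
have ek' : e <= k / 8 by rewrite (le_trans ek)// -mulrA ler_piMl// divr_ge0// ltW.
have [b b0 bL] := levy_small s0 s1 e0; exists b => // z w zb wb.
have [az Lz] := bL z zb; have [aw Lw] := bL w wb.
have near y : normc (L y) <= e -> normc (rectT lambda (L y) - 1) <= k / 2.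
  by move=> h; have := @rectT_near1 _ _ lambda01 (L y) (le_trans h e1); lra.
split.
  rewrite /levyH (_ : _ - z = z * (rectT lambda (L z) - 1)); last by ring.
  by rewrite normcM mulrC ler_wpM2r ?normc_ge0// (le_trans (near _ Lz))//; lra.
rewrite /levyH (_ : _ - _ = (z - w) * (rectT lambda (L w) - 1) +
  z * (rectT lambda (L z) - rectT lambda (L w))); last by ring.
have nz := wedge_gt0 zb.1.
have h1 : normc (L z - L w) <= k / 8 / normc z * normc (z - w).
  apply: (le_trans (levy_lipschitz G s0 s1 s0 s1 zb.1 wb.1)).
  rewrite ler_wpM2r ?normc_ge0// ler_pdivrMr ?mulr_gt0//.
  rewrite (_ : _ * (_ * _) = s ^+ 2 * k / 8); first exact: le_trans ek.
  by field; rewrite gt_eqF.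
have h2 : normc z * (normc (L z - L w)) <= k / 8 * normc (z - w).
  apply: (le_trans (ler_wpM2l (ltW nz) h1)); rewrite le_eqVlt; apply/orP; left; apply/eqP.
  by field; rewrite gt_eqF.
have h3 := @rectT_lipschitz _ _ lambda01 _ _ (le_trans Lz e1) (le_trans Lw e1).
have h4 := ler_wpM2l (ltW nz) h3.
have h5 := ler_wpM2l (normc_ge0 (z - w)) (near _ Lw).
apply: (le_trans (normcD _ _)); rewrite !normcM; lra.
Qed.

(** The radius is proportional to |z| - Re z, which measures the distance to the cut, and not to an
    aperture, so that a single [levyHinv] serves all sectors. *)
Definition inv_disc z : set C := [set y | 16 * normc (y - z) <= normc z - Re z].

Definition levyHinv z : C := xget 0 [set y | inv_disc z y /\ levyH y = z].

Lemma inv_disc_wedge s z y : 0 < s -> s <= 1 -> wedge s z -> inv_disc z y ->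
  [/\ wedge (s / 2) y, normc y <= 2 * normc z & normc z <= 2 * normc y].
Proof.
rewrite /wedge /inv_disc /mkset => s0 s1 zs yz.
have h1 := le_trans (ler_norm _) (Re_le_normc (y - z)).
rewrite cReD cReN in h1.
have h2 := lerB_normc z y; have h3 := lerB_normc y z; rewrite (distcC z) in h2.
have h4 := Re_le_normc z; move: h4; rewrite real_ler_norml ?num_real// => /andP[h4 h5].
have h6 : 0 <= normc y - (7 / 8) * normc z by lra.
have h7 : 0 <= (9 / 8) * normc z - normc y by lra.
split; [|lra|lra].
have h8 := mulr_ge0 (ltW s0) h7; lra.
Qed.

Lemma levyHinv_exists s : 0 < s -> s <= 1 -> exists2 b, 0 < b &
  forall z, wedge_disc s b z -> inv_disc z (levyHinv z) /\ levyH (levyHinv z) = z.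
Proof.
move=> s0 s1; have s20 : 0 < s / 2 by lra. have s21 : s / 2 <= 1 by lra.
(* On the disc |y| <= 2 |z|, so |H y - y| <= s |z| / 8, less than the radius (|z| - Re z) / 16
   because 2 s |z| < |z| - Re z. Thus y |-> z - (H y - y) maps the disc to itself. *)
have s160 : 0 < s / 16 by lra.
have [b b0 bH] := levyH_near_id s20 s21 s160; exists (b / 2); first by lra.
move=> z [zs zb].
suff : [set y | inv_disc z y /\ levyH y = z] !=set0 by exact: xgetPex.
have nz := wedge_gt0 zs.
pose r := (normc z - Re z) / 16.
have disc y : normc (y - z) <= r -> inv_disc z y by rewrite /r /inv_disc /mkset; lra.
have discb y : normc (y - z) <= r -> wedge_disc (s / 2) b y /\ normc y <= 2 * normc z.
  move=> /disc /(inv_disc_wedge s0 s1 zs)[h1 h2 _]; split => //; split => //; lra.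
have [|||y yr gy] := @contraction_fixpoint _ (fun y => z - (levyH y - y)) z r.
- move=> y /discb[yb yz]; have [h _] := bH y y yb yb.
  rewrite addrAC subrr add0r normcN (le_trans h)//.
  rewrite /r; move: zs; rewrite /wedge /mkset => zs.
  have := ler_wpM2l (ltW s160) yz; lra.
- move=> y y' /discb[yb _] /discb[yb' _]; have [_ h] := bH y y' yb yb'.
  rewrite [X in normc X](_ : _ = - (levyH y - y - (levyH y' - y'))); last by rewrite /=; ring.
  by rewrite normcN (le_trans h)// ler_wpM2r ?normc_ge0//; lra.
- by rewrite /r divr_ge0// subr_ge0; exact: le_trans (ler_norm _) (Re_le_normc z).
exists y; split; first exact: disc.
have gy' : z - (levyH y - y) = y by exact: gy.
rewrite -[RHS](subrK (levyH y - y)) gy'; ring.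
Qed.

Lemma levyH_inj s : 0 < s -> s <= 1 -> exists2 b, 0 < b &
  forall z w, wedge_disc s b z -> wedge_disc s b w ->
    normc (z - w) <= 2 * normc (levyH z - levyH w).
Proof.
move=> s0 s1; have k0 : 0 < 2^-1 :> R by lra.
have [b b0 bH] := levyH_near_id s0 s1 k0; exists b => // z w zb wb.
have [_ h] := bH z w zb wb.
have h2 : z - w = (levyH z - levyH w) - (levyH z - z - (levyH w - w)) by ring.
have := normcB (levyH z - levyH w) (levyH z - z - (levyH w - w)); rewrite -h2; lra.
Qed.

Lemma levyHinv_spec s k : 0 < s -> s <= 1 -> 0 < k -> exists2 b, 0 < b &
  forall z, wedge_disc s b z ->
  [/\ levyH (levyHinv z) = z, levyHinv (levyH z) = z,
      wedge_disc (s / 2) (2 * b) (levyHinv z), wedge_disc (s / 2) (2 * b) (levyH z) &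
      normc (levyHinv z - z) <= k * normc z].
Proof.
move=> s0 s1 k0.
(* The aperture is halved twice, from z to H z and from H z to its preimage, so injectivity is
   invoked in the wedge of aperture s/4; moduli double twice, hence the division of the radius by
   4. *)
have [s20 s21 s40 s41] : [/\ 0 < s / 2, s / 2 <= 1, 0 < s / 4 & s / 4 <= 1] by split; lra.
have [b1 b10 H1] := levyHinv_exists s20 s21.
have [b2 b20 H2] := levyH_inj s40 s41.
pose k' := Num.min (k / 2) (s / 64).
have k'0 : 0 < k' by rewrite lt_min !divr_gt0.
have k'k : k' <= k / 2 by rewrite ge_min lexx.
have k's : k' <= s / 64 by rewrite ge_min lexx orbT.
have [b3 b30 H3] := levyH_near_id s40 s41 k'0.
pose b := Num.min b1 (Num.min b2 b3) / 4.
have b0 : 0 < b by rewrite divr_gt0// !lt_min b10 b20.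
have bb1 : 4 * b <= b1 by rewrite /b mulrC mulfVK ?pnatr_eq0// ge_min lexx.
have bb2 : 4 * b <= b2 by rewrite /b mulrC mulfVK ?pnatr_eq0// !ge_min lexx orbT.
have bb3 : 4 * b <= b3 by rewrite /b mulrC mulfVK ?pnatr_eq0// !ge_min lexx !orbT.
exists b => // z [zs zb]; have nz := wedge_gt0 zs.
have zs2 : wedge (s / 2) z by apply: wedgeS zs; lra.
have zs4 : wedge (s / 4) z by apply: wedgeS zs; lra.
have [y1 y2] : inv_disc z (levyHinv z) /\ levyH (levyHinv z) = z.
  by apply: H1; split => //; lra.
have [y3 y4 y5] := inv_disc_wedge s0 s1 zs y1.
have y6 : wedge (s / 4) (levyHinv z) by apply: wedgeS y3; lra.
have yb3 : wedge_disc (s / 4) b3 (levyHinv z) by split => //; lra.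
have zb3 : wedge_disc (s / 4) b3 z by split => //; lra.
have [h1 _] := H3 z z zb3 zb3; have [h2 _] := H3 _ _ yb3 yb3.
have sz : s * normc z <= normc z by rewrite ler_piMl// ltW.
have k'z : k' * normc z <= s / 64 * normc z by rewrite ler_wpM2r// ltW.
have wHz : wedge (s / 2) (levyH z).
  apply: (@wedge_perturb _ s (s / 64) z) => //; try lra.
have nHz : normc (levyH z) < 2 * b.
  by have := lerB_normc (levyH z) z; lra.
have Hz1 : inv_disc (levyH z) z.
  rewrite /inv_disc /mkset distcC; move: wHz; rewrite /wedge /mkset => wHz.
  have h3 : s / 2 * normc z <= s * normc (levyH z).
    have := lerB_normc z (levyH z); rewrite distcC => h3.
    have : normc z <= 2 * normc (levyH z) by lra.
    move=> /(ler_wpM2l (ltW s20)); lra.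
  have := mulr_gt0 s0 nz; lra.
split => //.
- have [x1 x2] : inv_disc (levyH z) (levyHinv (levyH z)) /\
      levyH (levyHinv (levyH z)) = levyH z.
    by apply: H1; split => //; lra.
  have [x3 x4 x5] := inv_disc_wedge s20 s21 wHz x1.
  have := H2 (levyHinv (levyH z)) z; rewrite x2 subrr normc_zero mulr0 => h.
  apply/eqP; rewrite -subr_eq0 -normc_eq0 eq_le normc_ge0 andbT.
  by apply: h; split => //; [by apply: wedgeS x3; lra|lra|lra].
- by split => //; lra.
- move: h2; rewrite y2 distcC => h2; apply: (le_trans h2).
  have := ler_wpM2l (ltW k'0) y4; have := ler_wpM2r (ltW nz) k'k; lra.
Qed.

Lemma levyHinv_lipschitz s : 0 < s -> s <= 1 -> exists2 b, 0 < b &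
  forall z w, wedge_disc s b z -> wedge_disc s b w ->
    normc (levyHinv z - levyHinv w) <= 2 * normc (z - w).
Proof.
move=> s0 s1; have [b b0 Hb] := levyHinv_spec s0 s1 ltr01.
have [s20 s21] : 0 < s / 2 /\ s / 2 <= 1 by split; lra.
have [c c0 Hc] := levyH_inj s20 s21.
exists (Num.min b (c / 2)); first by rewrite lt_min b0 divr_gt0.
move=> z w [zs]; rewrite lt_min => /andP[zb zc] [ws]; rewrite lt_min => /andP[wb wc].
have [z1 _ [z2 _] _ z3] := Hb z (conj zs zb); have [w1 _ [w2 _] _ w3] := Hb w (conj ws wb).
rewrite -[in leRHS]z1 -[in leRHS]w1; apply: Hc; split => //.
  by have := lerB_normc (levyHinv z) z; lra.
by have := lerB_normc (levyHinv w) w; lra.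
Qed.

Lemma expandable_levyH z : cut_plane z -> expandable levyH z.
Proof.
move=> cz; apply: expandableM; first exact: expandable_id.
exact/expandable_rectT/expandable_levy.
Qed.

End inversion.

(** * Sectors given by the argument, and differentiability of an inverse *)

Section sectors.
Context {R : realType}.
Implicit Types (z w : R[i]) (s b alpha beta : R).

(** Whatever the sign of Im z, |arg z - pi| = pi - acos (Re z / |z|), and cos is decreasing on
    [0, pi]. *)
Lemma sector_wedge alpha z : 0 < alpha < pi ->
  sector alpha z <-> wedge ((1 + cos alpha) / 2) z.
Proof.
move=> /andP[a0 api].
suff H : z != 0 -> (`|arg z - pi| < alpha) = (2 * ((1 + cos alpha) / 2) * normc z < normc z - Re z).
  split=> [[z0]|zs]; first by rewrite H.
  by have z0 := wedge_neq0 zs; split => //; rewrite H.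
move=> z0; have nz : 0 < normc z by rewrite normc_gt0.
have : `|Re z| <= normc z := Re_le_normc z.
rewrite real_ler_norml ?num_real// => /andP[Rz1 Rz2].
set x := Re z / normc z.
have x1 : -1 <= x <= 1 by rewrite /x ler_pdivlMr// ler_pdivrMr// mulN1r mul1r Rz1.
have -> : `|arg z - pi| = pi - acos x.
  rewrite /arg norm_normc /= -/x; case: ifP => _.
    by rewrite distrC ger0_norm// subr_ge0 acos_lepi.
  rewrite (_ : _ - pi = pi - acos x); last by ring.
  by rewrite ger0_norm// subr_ge0 acos_lepi.
rewrite ltrBlDl -ltrBlDr.
have -> : (pi - alpha < acos x) = (cos (acos x) < cos (pi - alpha)).
  rewrite ltr_cos// in_itv/= ?acos_ge0 ?acos_lepi//.
  by rewrite subr_ge0 (ltW api)/= lerBlDr lerDl ltW.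
rewrite acosK ?in_itv//.
rewrite (_ : cos (pi - alpha) = - cos alpha); last first.
  by rewrite cosB cospi sinpi mul0r addr0 mulN1r.
rewrite /x ltr_pdivrMr//.
by apply/idP/idP; lra.
Qed.

Lemma DeltaE alpha beta z : 0 < alpha < pi ->
  Delta alpha beta z <-> wedge_disc ((1 + cos alpha) / 2) beta z.
Proof.
move=> ha; rewrite /Delta /wedge_disc /mkset lt_norm_normc.
by split => -[h1 h2]; split => //; exact/(sector_wedge z ha).
Qed.

Lemma angle_aperture alpha : 0 < alpha < pi -> 0 < (1 + cos alpha) / 2 < 1.
Proof.
move=> /andP[a0 api].
have h1 : cos alpha < cos 0 by rewrite ltr_cos// in_itv/= ?lexx ?pi_ge0// (ltW a0) (ltW api).
have h2 : cos pi < cos alpha by rewrite ltr_cos// in_itv/= ?lexx ?pi_ge0// (ltW a0) (ltW api).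
by move: h1 h2; rewrite cos0 cospi; lra.
Qed.

Lemma aperture_angle s : 0 < s < 1 -> exists2 alpha, 0 < alpha < pi & s = (1 + cos alpha) / 2.
Proof.
move=> /andP[s0 s1]; exists (acos (2 * s - 1)).
  have h : -1 <= 2 * s - 1 <= 1 by lra.
  rewrite acos_gt0 ?acos_ltpi//; lra.
by rewrite acosK ?in_itv/=; lra.
Qed.

Lemma eq_germP (f g : R[i] -> R[i]) : eq_germ f g <->
  forall s, 0 < s < 1 -> exists2 b, 0 < b & forall z, wedge_disc s b z -> f z = g z.
Proof.
split=> [H s /aperture_angle[alpha a01 ->]|H alpha a01].
  have [b b0 Hb] := H _ a01; exists b => // z /(DeltaE _ _ a01); exact: Hb.
have [b b0 Hb] := H _ (angle_aperture a01); exists b => // z /(DeltaE _ _ a01); exact: Hb.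
Qed.

Lemma wedge_disc_open s b z : 0 < s -> s <= 1 -> wedge_disc s b z ->
  exists2 r, 0 < r & forall w, normc (w - z) < r -> wedge_disc s b w.
Proof.
move=> s0 s1 [zs zb]; move: zs; rewrite /wedge /mkset => zs.
pose r := Num.min (b - normc z) ((normc z - Re z - 2 * s * normc z) / 4).
exists r; first by rewrite lt_min subr_gt0 zb divr_gt0//; lra.
move=> w; rewrite lt_min => /andP[wb ws].
have h1 := lerB_normc w z; have h2 := lerB_normc z w; rewrite (distcC z) in h2.
have h3 := le_trans (ler_norm _) (Re_le_normc (w - z)); rewrite cReD cReN in h3.
split; rewrite /wedge /mkset; last by lra.
have h4 : s * (normc w - normc z) <= normc (w - z).
  by rewrite (le_trans (ler_wpM2l (ltW s0) h1))// ler_piMl// normc_ge0.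
lra.
Qed.

(** Put x = h(z + e) - h(z). The expansion of H at h(z) reads e = l x + O(x^2), and |x| <= 2 |e|
    turns the error into O(e^2). Dividing by l e gives the derivative 1/l of h. *)
Lemma derivable_inverse (H h : R[i] -> R[i]) z r : 0 < r -> expandable H (h z) ->
  (forall w, normc (w - z) < r -> H (h w) = w /\ normc (h w - h z) <= 2 * normc (w - z)) ->
  derivable h z 1.
Proof.
move=> r0 /expandable_taylor1[l [K [r1 [r10 HK]]]] hH.
have zz : normc (z - z) < r by rewrite subrr normc_zero.
have [Hz _] := hH z zz.
pose K' := `|K| + 1; have K0 : 0 < K' by rewrite ltr_wpDl.
pose d0 := Num.min r (r1 / 2).
have d00 : 0 < d0 by rewrite lt_min r0 divr_gt0.
have key e : normc e < d0 ->
    normc (e - l * (h (z + e) - h z)) <= 4 * K' * normc e ^+ 2.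
  rewrite lt_min => /andP[er er1].
  have zez : z + e - z = e by ring.
  have [h1 h2] : H (h (z + e)) = z + e /\ normc (h (z + e) - h z) <= 2 * normc e.
    by have := hH (z + e); rewrite zez; apply.
  have := HK (h (z + e) - h z); rewrite (addrC (h z)) subrK h1 Hz zez => /(_ _)/le_trans; apply; first by lra.
  have h3 : normc (h (z + e) - h z) ^+ 2 <= 4 * normc e ^+ 2.
    by rewrite (_ : 4 * _ = (2 * normc e) ^+ 2) ?lerXn2r ?nnegrE ?mulr_ge0 ?normc_ge0//; ring.
  have h4 : K <= K' by rewrite /K'; have := ler_norm K; lra.
  have := ler_wpM2r (sqr_ge0 (normc (h (z + e) - h z))) h4.
  have := ler_wpM2l (ltW K0) h3; lra.
(* With l = 0 the estimate [key] would read |e| <= 4 K' |e|^2, which fails at the small e chosen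
   here. *)
have l0 : l != 0.
  apply/eqP => l0; pose e : R := Num.min (d0 / 2) (8 * K')^-1.
  have K80 : 0 < 8 * K' by rewrite mulr_gt0.
  have e0 : 0 < e by rewrite lt_min divr_gt0//= invr_gt0.
  have ne : normc e%:C = e by rewrite normc_real gtr0_norm.
  have := key e%:C; rewrite ne l0 mul0r subr0 ne => he.
  have ed : e < d0.
    apply: (@le_lt_trans _ _ (d0 / 2)); [by rewrite ge_min lexx|lra].
  have := he ed; rewrite expr2 mulrA -{1}(mul1r e) ler_pM2r//.
  have : 8 * K' * e <= 1.
    by rewrite -ler_pdivlMl// mulr1 ge_min lexx orbT.
  lra.
have nl : 0 < normc l by rewrite normc_gt0.
apply: (@derivable_normc _ h z l^-1) => e e0.
exists (Num.min d0 (e * normc l / (4 * K'))).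
  by rewrite lt_min d00 divr_gt0 ?mulr_gt0.
move=> x x0; rewrite lt_min => /andP[xd xe].
have nx : 0 < normc x by rewrite normc_gt0.
have -> : (h (z + x) - h z) / x - l^-1 = - ((x - l * (h (z + x) - h z)) / (l * x)).
  by field; rewrite l0 x0.
rewrite normcN normcM normcV normcM ltr_pdivrMr ?mulr_gt0//.
apply: (le_lt_trans (key x xd)); rewrite expr2 !mulrA ltr_pM2r//.
by move: xe; rewrite ltr_pdivlMr ?mulr_gt0// mulrC.
Qed.

End sectors.

(** * Measures with density and rectangular transforms *)

Section jump_measure_integral.
Context {R : realType}.
Local Notation T := (measurableTypeR R).
Variables (k : nat) (m : {finite_measure set T -> \bar R}).

Lemma jump_measure_dominates : jump_measure k m `<< m.
Proof.
apply/null_content_dominatesP => A mA mA0.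
rewrite /jump_measure null_set_integral//.
by apply/measurable_EFinP/measurable_funTS; exact: measurable_jump_density.
Qed.

Lemma bc_jump_density : bc_fun (@jump_density R k).
Proof.
split; last by exists k%:R => t; rewrite ger0_norm ?jump_density_ge0 ?jump_density_le.
move=> t; apply: cvgM; first exact: cvg_cst.
apply: cvgM; first exact: continuous_sqr.
apply: cvgV; first by rewrite gt_eqF// ltr_pwDl ?sqr_ge0.
by apply: cvgD; [exact: cvg_cst|exact: continuous_sqr].
Qed.

(** The density and the Radon-Nikodym derivative have the same integral over every measurable set,
    so they agree almost everywhere for m. *)
Lemma ge0_integral_jump_measure (f : R -> \bar R) : (forall t, 0 <= f t)%E ->
  measurable_fun [set: T] f ->
  (\int[jump_measure k m]_t f t = \int[m]_t (f t * (jump_density k t)%:E))%E.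
Proof.
move=> f0 mf.
have dom := jump_measure_dominates.
rewrite -(Radon_Nikodym_SigmaFinite.change_of_variables dom f0 measurableT mf).
have mj : measurable_fun [set: T] (EFin \o @jump_density R k).
  by apply/measurable_EFinP; exact: measurable_jump_density.
have mg := measurable_int _ (Radon_Nikodym_SigmaFinite.f_integrable dom).
apply: ae_eq_integral => //; [exact: emeasurable_funM|exact: emeasurable_funM|].
apply: ae_eqe_mul2l; apply: integral_ae_eq => //.
  exact: Radon_Nikodym_SigmaFinite.f_integrable.
by move=> E _ mE; rewrite -Radon_Nikodym_SigmaFinite.f_integral.
Qed.

Lemma Rintegral_jump_measure (f : R -> R) : bc_fun f ->
  (\int[jump_measure k m]_t f t = \int[m]_t (f t * jump_density k t))%R.
Proof.
have ge0 (g : R -> R) : bc_fun g -> (forall t, 0 <= g t) ->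
    (\int[jump_measure k m]_t g t = \int[m]_t (g t * jump_density k t))%R.
  move=> gb g0; rewrite /Rintegral ge0_integral_jump_measure//.
    by apply/measurable_EFinP; exact: continuous_measurable_fun gb.1.
move=> fb; have [cf [K fK]] := fb.
(* Adding the bound K makes the integrand nonnegative; the contribution of the constant is then
   subtracted. *)
have Kb := bc_fun_cst K; have fKb := bc_funD fb Kb.
have jb := bc_jump_density.
have h1 : (\int[jump_measure k m]_t (f t + K) = \int[m]_t ((f t + K) * jump_density k t))%R.
  by apply: ge0 => // t; have := fK t; rewrite ler_norml => /andP[]; lra.
have h2 : (\int[jump_measure k m]_t K = \int[m]_t (K * jump_density k t))%R.
  by apply: ge0 => // t; exact: le_trans (fK t).
move: h1; rewrite bc_RintegralD// h2.
under [X in _ = X -> _]eq_Rintegral do rewrite mulrDl.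
rewrite bc_RintegralD; [|exact: bc_funM..].
by move=> /addIr.
Qed.

Definition jump_transform (z : R[i]) : R[i] :=
  cint m (fun t => z * t%:C ^+ 2 / (1 - z * t%:C ^+ 2)).

Lemma levy_jump_measure z : cut_plane z ->
  levy_transform (jump_measure k m) z = k%:R * jump_transform z.
Proof.
move=> cz; rewrite /levy_transform /jump_transform.
have lb := bc_levy_kernel cz.
have zb := bc_jump_kernel cz.
have jb := bc_cfun_real bc_jump_density.
have -> : cint (jump_measure k m) (fun t => (1 + t%:C ^+ 2) / (1 - z * t%:C ^+ 2)) =
    cint m (fun t => (jump_density k t)%:C * ((1 + t%:C ^+ 2) / (1 - z * t%:C ^+ 2))).
  apply: complex_ext => /=; rewrite Rintegral_jump_measure.
  - by apply: eq_Rintegral => t _; rewrite cRe_realM [LHS]mulrC.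
  - exact: bc_cfun_Re.
  - by apply: eq_Rintegral => t _; rewrite cIm_realM [LHS]mulrC.
  - exact: bc_cfun_Im.
rewrite -!cintZ//; last exact: bc_cfunM.
apply: eq_cint => t; rewrite /jump_density rmorphM rmorph_nat rmorphM fmorphV rmorphD rmorph1 rmorphXn.
have h1 := kernel_neq0 t cz.
have h2 : 1 + t%:C ^+ 2 != 0.
  by rewrite -normc_gt0 normc_levy_num ltr_pwDl ?sqr_ge0.
by field; rewrite h1 h2.
Qed.

End jump_measure_integral.

Section symmetric.
Context {R : realType}.
Local Notation T := (measurableTypeR R).

Lemma Rintegral_opp (m : {finite_measure set T -> \bar R}) (f : R -> R) :
  symmetric_measure m -> bc_fun f -> (\int[m]_t f (- t) = \int[m]_t f t)%R.
Proof.
move=> sm fb; congr fine.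
have mN : measurable_fun [set: T] (-%R : T -> T).
  by apply: continuous_measurable_fun; exact: oppr_continuous.
have mf : measurable_fun [set: T] (EFin \o f).
  by apply/measurable_EFinP; exact: continuous_measurable_fun fb.1.
have := @integral_pushforward _ _ T T R _ mN m [set: T] _ mf
  (bc_fun_integrable m (bc_fun_opp fb)) measurableT.
rewrite preimage_setT => <-; apply: eq_measure_integral => A mA _.
exact: sm.
Qed.

Lemma cint_opp (m : {finite_measure set T -> \bar R}) (f : R -> R[i]) :
  symmetric_measure m -> bc_cfun f -> cint m (fun t => f (- t)) = cint m f.
Proof.
move=> sm fb; apply: complex_ext => /=.
  by rewrite (Rintegral_opp sm (bc_cfun_Re fb)).
by rewrite (Rintegral_opp sm (bc_cfun_Im fb)).
Qed.

End symmetric.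

Section square_root.
Context {R : realType}.
Implicit Types z : R[i].

Lemma sqr_sqrt_cut z : sqrt_cut z ^+ 2 = z.
Proof. by rewrite /sqrt_cut exprMn sqr_sqrtc sqr_i mulN1r opprK. Qed.

Lemma Im_sqrt_cut_inv z : cut_plane z -> Im (sqrt_cut z)^-1 != 0.
Proof.
move=> cz; apply/eqP => I0; move/negP: cz; apply.
rewrite -[z]invrK -(sqr_sqrt_cut z) -exprVn.
have -> : (sqrt_cut z)^-1 = (Re (sqrt_cut z)^-1)%:C by apply: complex_ext.
by rewrite -rmorphXn invr_ge0 ler0c sqr_ge0.
Qed.

End square_root.

Section rectangular.
Context {R : realType}.
Local Notation T := (measurableTypeR R).
Local Notation C := R[i].
Implicit Types (z : C).

Lemma bc_cauchy_kernel (a : C) : Im a != 0 -> bc_cfun (fun t : R => (a - t%:C)^-1).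
Proof.
move=> a0; have h (t : R) : `|Im a| <= normc (a - t%:C).
  by have := Im_le_normc (a - t%:C); rewrite cImD cImN /= oppr0 addr0.
have h0 (t : R) : a - t%:C != 0.
  by rewrite -normc_gt0 (lt_le_trans _ (h t))// normr_gt0.
apply: (@bc_cfunP _ _ `|Im a|^-1) => [|t].
  apply: cts_cfunV => //; apply: cts_cfunD; first exact: cts_cfun_cst.
  apply: cts_cfunN; apply: cts_cfun_real => t; exact: cvg_id.
by rewrite normcV lef_pV2 ?posrE ?normr_gt0// normc_gt0.
Qed.

Lemma cint_cst (mu : probability T R) (c : C) : cint mu (fun=> c) = c.
Proof.
have h : fine (mu [set: R]) = 1 by rewrite (probability_setT mu).
by apply: complex_ext => /=; rewrite Rintegral_cst// [fine _]h mulr1.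
Qed.

(** By symmetry the Cauchy kernel may be averaged over t and -t: the mean of 1/(1/s - t) and 1/(1/s
    + t) is s / (1 - s^2 t^2), with s^2 = z. The choice of the square root thus disappears from
    H. *)
Lemma cauchy_transform_sqrt_cut (mu : probability T R) z : symmetric_measure mu ->
  cut_plane z ->
  cauchy_transform mu (sqrt_cut z)^-1 = sqrt_cut z * (1 + jump_transform mu z).
Proof.
move=> smu cz; set s := sqrt_cut z.
have I0 : Im s^-1 != 0 by exact: Im_sqrt_cut_inv.
have s0 : s != 0.
  by apply: contraNneq I0 => ->; rewrite invr0.
have s2 : s ^+ 2 = z := sqr_sqrt_cut z.
have cb := bc_cauchy_kernel I0.
have cbN : bc_cfun (fun t : R => (s^-1 - (- t)%:C)^-1).
  apply: (@bc_cfunP _ _ (`|Im s^-1|^-1)) => [|t].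
    have [c1 c2 _] := cb; split => t.
      by apply: (@continuous_comp _ _ _ (fun t : R => - t) (fun t => Re (s^-1 - t%:C)^-1));
        [exact: oppr_continuous|exact: c1].
    by apply: (@continuous_comp _ _ _ (fun t : R => - t) (fun t => Im (s^-1 - t%:C)^-1));
      [exact: oppr_continuous|exact: c2].
  rewrite normcV lef_pV2 ?posrE ?normr_gt0//.
    by have := Im_le_normc (s^-1 - (- t)%:C); rewrite cImD cImN /= oppr0 addr0.
  rewrite normc_gt0; apply: contraNneq I0 => /eqP; rewrite subr_eq0 => /eqP ->.
  by [].
have kb := bc_kernelV cz.
have -> : 1 + jump_transform mu z = cint mu (fun t => (1 - z * t%:C ^+ 2)^-1).
  rewrite -[X in X + _](cint_cst mu) -cintD; last 2 first.
  - exact: bc_cfun_cst.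
  - exact: bc_jump_kernel.
  by apply: eq_cint => t; have := kernel_neq0 t cz => h; field; rewrite h.
rewrite -cintZ//.
have -> : cauchy_transform mu s^-1 = 2^-1 *
    (cint mu (fun t => (s^-1 - t%:C)^-1) + cint mu (fun t => (s^-1 - (- t)%:C)^-1)).
  rewrite (@cint_opp _ mu (fun t => (s^-1 - t%:C)^-1) smu cb) /cauchy_transform.
  by field.
rewrite -cintD// -cintZ; last exact: bc_cfunD.
apply: eq_cint => t; rewrite rmorphN opprK.
have h := kernel_neq0 t cz; rewrite -s2 in h *.
have h' : (1 - s * t%:C) * (1 + s * t%:C) != 0.
  by rewrite (_ : _ * _ = 1 - s ^+ 2 * t%:C ^+ 2)//; ring.
move: h'; rewrite mulf_eq0 negb_or => /andP[h1 h2].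
field; apply/and4P; split => //.
- by rewrite exprMn; exact: h.
- by rewrite mulrC; exact: h2.
- by rewrite mulNr mulrC; exact: h1.
Qed.

Variables (lambda : R) (lambda01 : 0 <= lambda <= 1).
Variable mu : probability T R.
Hypothesis smu : symmetric_measure mu.
Local Notation J := (jump_measure 1 mu).

Lemma levy_jump1 z : cut_plane z -> levy_transform J z = jump_transform mu z.
Proof. by move=> cz; rewrite levy_jump_measure// mul1r. Qed.

Lemma rectH_levyH z : cut_plane z -> rectH lambda mu z = levyH lambda J z.
Proof.
move=> cz; rewrite /rectH /levyH cauchy_transform_sqrt_cut// levy_jump1//.
have s2 := sqr_sqrt_cut z; rewrite /rectT exprMn s2 -mulrA (mulrA (sqrt_cut z)) -expr2 s2.
by rewrite rmorphB rmorph1; ring.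
Qed.

Lemma is_rectHinv_levyHinv : is_rectHinv lambda mu (levyHinv lambda J).
Proof.
move=> alpha a01; have /andP[s0 s1] := angle_aperture a01.
set s := (1 + cos alpha) / 2 in s0 s1.
split.
  move=> A /nbhs_normcP[e e0 eA].
  have [b b0 Hb] := levyHinv_spec lambda01 J s0 (ltW s1) (divr_gt0 e0 (ltr0Sn R 1)).
  apply/nbhs_normcP; exists b => // z; rewrite subr0 => zb za.
  have zs : wedge s z by apply/(sector_wedge z a01).
  have [_ _ _ _ h] := Hb z (conj zs zb); apply: eA.
  have nz := wedge_gt0 zs; have z0 := wedge_neq0 zs.
  rewrite (_ : _ - 1 = (levyHinv lambda J z - z) / z); last by field.
  rewrite normcM normcV ltr_pdivrMr// (le_lt_trans h)// ltr_pM2r//; lra.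
have [b b0 Hb] := levyHinv_spec lambda01 J s0 (ltW s1) ltr01.
have [c c0 Hc] := levyHinv_lipschitz lambda01 J s0 (ltW s1).
have s20 : 0 < s / 2 by lra.
exists (Num.min b c); first by rewrite lt_min b0.
have D z : Delta alpha (Num.min b c) z -> wedge_disc s b z /\ wedge_disc s c z.
  by move=> /(DeltaE _ _ a01)[zs]; rewrite lt_min => /andP[zb zc]; split.
split.
- move=> z /(DeltaE _ _ a01) zD.
  have [r r0 rD] := wedge_disc_open s0 (ltW s1) zD.
  have zz : normc (z - z) < r by rewrite subrr normc_zero.
  have [zb zc] := D z ((DeltaE _ _ a01).2 zD).
  have [_ _ [hz _] _ _] := Hb z zb.
  apply: (@derivable_inverse _ (levyH lambda J) _ _ r) => //.
    by apply: expandable_levyH; exact: wedge_cut_plane hz.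
  move=> w /rD wD; have [wb wc] := D w ((DeltaE _ _ a01).2 wD).
  by have [? _ _ _ _] := Hb w wb; split => //; exact: Hc.
- move=> z /D[zb _]; have [h _ [hz _] _ _] := Hb z zb.
  by rewrite rectH_levyH//; exact: wedge_cut_plane hz.
- move=> z /D[zb _]; have [_ h _ _ _] := Hb z zb.
  by rewrite rectH_levyH//; exact: wedge_cut_plane zb.1.
Qed.

(** Existence is enough: whichever representative [xget] returns, it has the defining property, and
    [rectR_levyH] and [rectR_rectHinv] use nothing else about it. *)
Lemma rectHinvP : is_rectHinv lambda mu (rectHinv lambda mu).
Proof.
apply: (@xgetPex _ _ [set h | is_rectHinv lambda mu h]).
by exists (levyHinv lambda J); exact: is_rectHinv_levyHinv.
Qed.

(** At the point H(y), the quotient of H(y) by its preimage y is T(M(y)), and U inverts x |-> T(x) -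
    1 for small x. *)
Lemma rectR_levyH_eq y : 2 * normc (levy_transform J y) <= 1 -> y != 0 ->
  rectHinv lambda mu (levyH lambda J y) = y ->
  rectR lambda mu (levyH lambda J y) = levy_transform J y.
Proof.
move=> Ly y0 hy; rewrite /rectR hy /levyH mulrAC mulfV// mul1r.
exact: rectU_rectT.
Qed.

Lemma rectR_levyH s : 0 < s -> s < 1 -> exists2 b, 0 < b &
  forall y, wedge_disc s b y -> rectR lambda mu (levyH lambda J y) = levy_transform J y.
Proof.
move=> s0 s1; have s01 : 0 < s < 1 by rewrite s0.
have [alpha a01 sE] := aperture_angle s01.
have [_ [b b0 [_ _ Hb]]] := rectHinvP a01.
have h20 : 0 < 2^-1 :> R by lra.
have [c c0 Hc] := levy_small J s0 (ltW s1) h20.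
exists (Num.min b c); first by rewrite lt_min b0.
move=> y [ys]; rewrite lt_min => /andP[yb yc].
have [_ Ly] := Hc y (conj ys yc).
apply: rectR_levyH_eq; [by rewrite -ler_pdivlMl// mulr1|exact: wedge_neq0 ys|].
rewrite -rectH_levyH; last exact: wedge_cut_plane ys.
by apply: Hb; apply/(DeltaE _ _ a01); rewrite -sE.
Qed.

(** Complements [rectR_levyH]: germs are compared at points z, so every z near 0 has to be reached
    as H(y), with y as close to 0 as desired and in a sector only slightly wider. *)
Lemma rectR_rectHinv s c : 0 < s -> s < 1 -> 0 < c -> exists2 b, 0 < b &
  forall z, wedge_disc s b z -> exists y,
    [/\ wedge_disc (s / 2) c y, levyH lambda J y = z &
        rectR lambda mu z = levy_transform J y].
Proof.
move=> s0 s1 c0; have s01 : 0 < s < 1 by rewrite s0.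
have [alpha a01 sE] := aperture_angle s01.
have [cvg1 [b b0 [_ Hb _]]] := rectHinvP a01.
have s20 : 0 < s / 2 by lra. have s21 : s / 2 <= 1 by lra.
have h20 : 0 < 2^-1 :> R by lra.
have [b1 b10 Hb1] := levy_small J s20 s21 h20.
have s40 : 0 < s / 4 by lra.
(* The limit 1 of h(z)/z, with the relative error s/4 that [wedge_quarter] tolerates. *)
have [b2 b20 Hb2] : exists2 b2, 0 < b2 & forall z, wedge_disc s b2 z ->
    normc (rectHinv lambda mu z - z) <= s / 4 * normc z.
  have : nbhs (1 : C) [set x | normc (x - 1) < s / 4].
    by apply/nbhs_normcP; exists (s / 4).
  move=> /cvg1 /nbhs_normcP[b2 b20 Hb2]; exists b2 => // z [zs zb].
  have := Hb2 z; rewrite subr0 => /(_ zb) /= H.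
  have nz := wedge_gt0 zs; have z0 := wedge_neq0 zs.
  have := H ((sector_wedge z a01).2 _); rewrite -sE => /(_ zs).
  rewrite (_ : _ - 1 = (rectHinv lambda mu z - z) / z); last by field.
  by rewrite normcM normcV ltr_pdivrMr// => /ltW.
pose b3 := Num.min (Num.min b b2) (Num.min (b1 / 2) (c / 2)).
exists b3; first by rewrite !lt_min b0 b20 !divr_gt0.
move=> z [zs]; rewrite !lt_min => /andP[/andP[zb zb2] /andP[zb1 zc]].
have h := Hb2 z (conj zs zb2).
set y := rectHinv lambda mu z in h *.
have ys : wedge (s / 2) y by exact: (wedge_quarter s0 (ltW s1) zs h).
have yz : normc y <= 2 * normc z.
  have := lerB_normc y z; have := normc_ge0 z; have := ler_piMl (normc_ge0 z) (ltW s1); lra.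
have cy : cut_plane y by exact: wedge_cut_plane ys.
have Hyz : levyH lambda J y = z.
  by rewrite -rectH_levyH//; apply: Hb; apply/(DeltaE _ _ a01); rewrite -sE.
have [_ Ly] : levy_abs J (normc y) <= 2^-1 /\ normc (levy_transform J y) <= 2^-1.
  by apply: Hb1; split => //; lra.
exists y; split => //; first by split => //; lra.
rewrite -{1}Hyz; apply: rectR_levyH_eq; [|exact: wedge_neq0 ys|by rewrite Hyz].
by rewrite -ler_pdivlMl// mulr1; exact: Ly.
Qed.

End rectangular.

(** * Convolution powers *)

Section rect_pow.
Context {R : realType}.
Local Notation T := (measurableTypeR R).
Local Notation C := R[i].
Variables (lambda : R) (lambda01 : 0 <= lambda <= 1).

Lemma rectR_ext (mu nu : probability T R) :
  (forall A : set T, measurable A -> mu A = nu A) -> rectR lambda mu = rectR lambda nu.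
Proof.
move=> munu; have cE : cauchy_transform mu = cauchy_transform nu.
  apply/funext => z; rewrite /cauchy_transform /cint; congr (_ +i* _);
    by congr fine; apply: eq_measure_integral => A mA _; exact: munu.
have HE : rectH lambda mu = rectH lambda nu by apply/funext => z; rewrite /rectH cE.
apply/funext => z; rewrite /rectR; suff -> : rectHinv lambda mu = rectHinv lambda nu by [].
rewrite /rectHinv; congr xget; apply/seteqP; split => h /=; rewrite /is_rectHinv HE; exact.
Qed.

Lemma is_rect_powP (nu rho : probability T R) k : symmetric_measure nu ->
  is_rect_pow lambda nu k rho ->
  [/\ (0 < k)%N, symmetric_measure rho &
      eq_germ (rectR lambda rho) (fun z => k%:R * rectR lambda nu z)].
Proof.
move=> snu; elim=> [{}rho rhonu|{}k rho1 rho2 _ [k0 srho1 IH] [srho2 conv]]; split => //.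
- move=> A mA; have mNA : measurable (-%R @^-1` A : set T).
    rewrite -[X in measurable X]setTI.
    exact: (continuous_measurable_fun (@oppr_continuous R R)).
  exact: etrans (rhonu _ mNA) (etrans (snu A mA) (esym (rhonu _ mA))).
- by apply/eq_germP => s s01; exists 1 => // z _; rewrite (rectR_ext rhonu) mul1r.
- apply/eq_germP => s s01.
  have [b b0 Hb] := (eq_germP _ _).1 conv s s01.
  have [c c0 Hc] := (eq_germP _ _).1 IH s s01.
  exists (Num.min b c); first by rewrite lt_min b0.
  move=> z [zs]; rewrite lt_min => /andP[zb zc].
  by rewrite Hb// Hc// -natr1 mulrDl mul1r.
Qed.

Variables (nu rho : probability T R) (k : nat).
Hypotheses (snu : symmetric_measure nu) (srho : symmetric_measure rho) (k0 : (0 < k)%N).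
Hypothesis germ : eq_germ (rectR lambda rho) (fun z => k%:R * rectR lambda nu z).
Local Notation M := (levy_transform (jump_measure 1 rho)).
Local Notation T_ := (rectT lambda).

(** The solution y' of H_nu(y') = H_rho(y) once M_nu(y') is known to be M_rho(y) / k: a
    subordination function that does not involve nu. *)
Definition subord (y : C) : C := y * T_ (M y) / T_ (M y / k%:R).

Lemma levy_jump_germ s : 0 < s -> s < 1 -> exists2 e : R, 0 < e &
  forall y, wedge_disc s e y -> M y = levy_transform (jump_measure k nu) (subord y).
Proof.
move=> s0 s1.
have [s20 s21] : 0 < s / 2 /\ s / 2 < 1 by split; lra.
have [b1 b10 H1] := rectR_levyH lambda01 srho s0 s1.
have [b2 b20 H2] := (eq_germP _ _).1 germ (s / 2) (introT andP (conj s20 s21)).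
have [b3 b30 H3] := rectR_rectHinv lambda01 snu s20 s21 ltr01.
have [b4 b40 H4] := levyH_near_id lambda01 (jump_measure 1 rho) s0 (ltW s1) (divr_gt0 s0 (ltr0Sn R 3)).
pose b := Num.min (Num.min b1 b4) (Num.min (b2 / 2) (b3 / 2)).
exists b; first by rewrite !lt_min b10 b40 !divr_gt0.
move=> y [ys]; rewrite !lt_min => /andP[/andP[yb1 yb4] /andP[yb2 yb3]].
set z := levyH lambda (jump_measure 1 rho) y.
have [h _] := H4 y y (conj ys yb4) (conj ys yb4); rewrite -/z in h.
have ny := normc_ge0 y.
have zs : wedge (s / 2) z by exact: (wedge_quarter s0 (ltW s1) ys h).
have zy : normc z <= 2 * normc y.
  have := lerB_normc z y; have := ler_piMl ny (ltW s1); lra.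
have zE : rectR lambda rho z = M y by apply: H1.
have zb3 : normc z < b3 by lra.
have [y' [y's Hy' Ry']] := H3 z (conj zs zb3).
have cy' : cut_plane y' by apply: wedge_cut_plane y's.1; lra.
have zE' : M y = k%:R * levy_transform (jump_measure 1 nu) y'.
  by rewrite -zE H2 ?Ry'//; split => //; lra.
have kC0 : k%:R != 0 :> C by rewrite pnatr_eq0 -lt0n.
have My' : levy_transform (jump_measure 1 nu) y' = M y / k%:R.
  by rewrite zE' mulrC mulKf.
have z0 := wedge_neq0 zs.
have y'E : y' = subord y.
  move: Hy'; rewrite /levyH My' => Hy'; rewrite /subord -[y * _]/z -Hy' mulfK//.
  by apply: contraNneq z0 => T0; rewrite -Hy' T0 mulr0.
by rewrite -y'E zE' !levy_jump_measure// mul1r.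
Qed.

Lemma normc_natV (x : C) : normc (x / k%:R) <= normc x.
Proof.
rewrite normcM normcV -(rmorph_nat (real_complex R)) normc_real normr_nat.
by rewrite ler_piMr ?normc_ge0// invf_le1 ?ltr0n// ler1n.
Qed.

(** Both values of T lie within s/16 of 1, so their difference is at most s/8; dividing by a value
    of modulus at least 1/2 gives s/4, the perturbation allowed by [wedge_quarter]. This is the
    origin of 64. *)
Lemma subord_near s y : 0 < s -> s < 1 -> normc (M y) <= s / 64 ->
  normc (subord y - y) <= s / 4 * normc y /\ T_ (M y / k%:R) != 0.
Proof.
move=> s0 s1 My; have My1 : normc (M y) <= 1 by lra.
have Mk := le_trans (normc_natV (M y)) My.
have Mk1 : normc (M y / k%:R) <= 1 by lra.
have h1 := rectT_near1 lambda01 My1; have h2 := rectT_near1 lambda01 Mk1.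
set t := T_ (M y / k%:R) in h2 *.
have t2 : 2^-1 <= normc t.
  by have := lerB_normc 1 (1 - t); rewrite normc_one opprB addrCA subrr addr0 (distcC 1); lra.
have t0 : t != 0 by rewrite -normc_gt0; lra.
split => //; rewrite /subord -/t.
rewrite (_ : _ - y = y * ((T_ (M y) - t) / t)); last by field.
rewrite normcM mulrC ler_wpM2r ?normc_ge0// normcM normcV ler_pdivrMr; last by lra.
have := distc_triangle 1 (T_ (M y)) t; rewrite (distcC 1).
have := ler_wpM2l (ltW s0) t2; lra.
Qed.

(** The germ identity propagates along the ray through y. On it M is small, so [subord] is analytic
    with values off the cut. The radius b depends on a bound for M only, in contrast to the radius
    of the germ. *)
Lemma levy_jump_subord s b : 0 < s -> s < 1 ->
  (forall y, wedge_disc s b y -> normc (M y) <= s / 64) ->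
  forall y, wedge_disc s b y -> M y = levy_transform (jump_measure k nu) (subord y).
Proof.
move=> s0 s1 Mb y [ys yb]; have ny := wedge_gt0 ys.
have [e e0 He] := levy_jump_germ s0 s1.
pose u := y / (normc y)%:C.
have nyC : (normc y)%:C != 0 by rewrite -normc_eq0 normc_real normr_eq0 gt_eqF.
have u1 : normc u = 1.
  by rewrite /u normcM normcV normc_real ger0_norm ?normc_ge0// divff// gt_eqF.
(* The wedge is a cone, so it contains the whole open ray through y. *)
have us (x : R) : 0 < x -> wedge s (x%:C * u).
  move=> x0; move: ys; rewrite /wedge /mkset normcM u1 mulr1 normc_real gtr0_norm//.
  rewrite cRe_realM /u mulrC -fmorphV (mulrC y) cRe_realM => ys.
  rewrite -subr_gt0 (_ : _ - _ = x / normc y * (normc y - Re y - 2 * s * normc y)).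
    by rewrite mulr_gt0 ?divr_gt0// subr_gt0 mulrC.
  by field; rewrite gt_eqF.
have ux (x : R) : 0 < x -> normc (x%:C * u) = x.
  by move=> x0; rewrite normcM u1 mulr1 normc_real gtr0_norm.
pose f w := M w - levy_transform (jump_measure k nu) (subord w).
have fe (x : R) : 0 < x -> x < b -> expandable f (x%:C * u).
  move=> x0 xb; have ws := us x x0; set w := x%:C * u in ws *.
  have cw : cut_plane w by exact: wedge_cut_plane ws.
  have Me : expandable M w by exact: expandable_levy.
  have [h t0] : normc (subord w - w) <= s / 4 * normc w /\ T_ (M w / k%:R) != 0.
    by apply: subord_near => //; apply: Mb; split => //; rewrite ux.
  have ws' : wedge (s / 2) (subord w) by exact: (wedge_quarter s0 (ltW s1) ws h).
  apply: expandableB => //; apply: expandable_comp; last first.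
    by apply: expandable_levy; apply: wedge_cut_plane ws'; lra.
  apply: expandableM.
    by apply: expandableM; [exact: expandable_id|exact: expandable_rectT].
  apply: expandableV => //; apply: expandable_rectT.
  by apply: expandableM => //; exact: expandable_cst.
have f0 : f ((normc y)%:C * u) = 0.
  apply: (expandable_ray u1 e0 fe) => // x x0 xe _.
  by apply/eqP; rewrite subr_eq0; apply/eqP; apply: He; split; [exact: us|rewrite ux].
move: f0; rewrite /u mulrC mulfVK// => /eqP; rewrite subr_eq0 => /eqP //.
Qed.

End rect_pow.

(** * Bounds on measures from the negative half-line *)

Section mass_bounds.
Context {R : realType}.
Local Notation T := (measurableTypeR R).
Variable G : {finite_measure set T -> \bar R}.
Implicit Types x t : R.

Lemma wedge_neg s x : s < 1 -> 0 < x -> wedge s (- x%:C : R[i]).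
Proof.
move=> s1 x0; rewrite /wedge /mkset normcN normc_real gtr0_norm// cReN /= opprK.
have s1' : 0 < 1 - s by rewrite subr_gt0.
have := mulr_gt0 x0 s1'; lra.
Qed.

Lemma levy_transform_neg x : 0 < x -> levy_transform G (- x%:C) = - (levy_abs G x)%:C.
Proof.
move=> x0; have cx : cut_plane (- x%:C : R[i]).
  by apply: (@wedge_cut_plane _ (2^-1)); [lra|apply: wedge_neg => //; lra].
have kb := bc_cfun_real (bc_levy_kernel_abs (ltW x0)).
rewrite -[RHS]mulN1r /levy_transform /levy_abs -cint_real -(cintZ G _ kb) -cintZ; last exact: bc_levy_kernel.
apply: eq_cint => t; rewrite /levy_kernel_abs.
rewrite !(rmorphM, fmorphV, rmorphD, rmorph1, rmorphXn) /=.
have := kernel_neq0 t cx; rewrite mulNr opprK => h.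
by field; rewrite h.
Qed.

Lemma levy_abs_mass x : 0 < x -> x <= 1 -> x * fine (G [set: R]) <= levy_abs G x.
Proof.
move=> x0 x1; rewrite -Rintegral_cst//; apply: bc_le_Rintegral => [||t].
- exact: bc_fun_cst.
- by apply: bc_levy_kernel_abs; exact: ltW.
rewrite /levy_kernel_abs ler_pdivlMr ?den_gt0 ?(ltW x0)// ler_pM2l// lerD2l.
by rewrite ler_piMl// sqr_ge0.
Qed.

(** Where x t^2 >= 1, the kernel is at least x t^2 / (1 + x t^2) >= 1/2. *)
Lemma levy_abs_tail x (A : set T) : 0 < x -> measurable A ->
  (forall t, A t -> 1 <= x * t ^+ 2) -> fine (G A) <= 2 * levy_abs G x.
Proof.
move=> x0 mA Ax.
have -> : fine (G A) = (\int[G]_t \1_A t)%R.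
  by rewrite /Rintegral integral_indic// setIT.
have lb : bc_fun (levy_kernel_abs x) by apply: bc_levy_kernel_abs; exact: ltW.
rewrite /levy_abs -bc_RintegralZ//; apply: le_Rintegral => //.
- apply: (eq_integrable measurableT (EFin \o \1_A)) => //.
  apply: measurable_bounded_integrable => //.
    by rewrite -ge0_fin_numE// fin_num_measure.
  exists 1; split => // y y1 t _; rewrite /= indicE (le_trans _ (ltW y1))//.
  by rewrite ger0_norm// lern1 leq_b1.
- by apply: bc_fun_integrable; apply: bc_funM => //; exact: bc_fun_cst.
move=> t _; rewrite indicE; case: (boolP (t \in A)) => [/set_mem/Ax h|_] /=.
  rewrite /levy_kernel_abs mulrA ler_pdivlMr ?den_gt0 ?(ltW x0)//; nra.
by rewrite mulr_ge0// levy_kernel_abs_ge0// ltW.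
Qed.

End mass_bounds.

Section jump_bound.
Context {R : realType}.
Local Notation T := (measurableTypeR R).
Local Notation C := R[i].
Variables (lambda : R) (lambda01 : 0 <= lambda <= 1).
Variables (nu rho : probability T R) (k : nat) (k0 : (0 < k)%N).

(** At -x the identity is an equality of positive numbers: with m the left value, m is [levy_abs] of
    the jump measure of nu at p = x t(m) / t(m/k), where t(a) = (1 - lambda a) (1 - a). As m <= 1/2,
    t(m) >= 1/4 and t(m/k) <= 1, so p >= x/4 and monotonicity concludes. *)
Lemma levy_abs_jump_le (x : R) : 0 < x ->
  2 * levy_abs (jump_measure 1 rho) x <= 1 ->
  levy_transform (jump_measure 1 rho) (- x%:C) =
    levy_transform (jump_measure k nu) (subord lambda rho k (- x%:C)) ->
  levy_abs (jump_measure k nu) (x / 4) <= levy_abs (jump_measure 1 rho) x.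
Proof.
move=> x0; rewrite /subord levy_transform_neg//; set m := levy_abs _ x => m2.
have m0 : 0 <= m by exact/levy_abs_ge0/ltW.
pose t (a : R) := (1 - lambda * a) * (1 - a).
have TE (a : R) : rectT lambda (- a%:C) = (t a)%:C.
  by rewrite /rectT /t rmorphM !rmorphB rmorph1 rmorphM /=; ring.
have mk0 : 0 <= m / k%:R by rewrite divr_ge0.
have mk1 : m / k%:R <= m by rewrite ler_piMr// invf_le1 ?ltr0n// ler1n.
have -> : - m%:C / k%:R = - (m / k%:R)%:C by rewrite rmorphM fmorphV rmorph_nat mulNr.
rewrite !TE; pose p := x * t m / t (m / k%:R).
have -> : - x%:C * (t m)%:C / (t (m / k%:R))%:C = - p%:C.
  by rewrite /p !(rmorphM, fmorphV) !mulNr.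
have [l0 l1] := andP lambda01.
have tle (a : R) : 0 <= a -> 2 * a <= 1 -> 4^-1 <= t a /\ t a <= 1.
  move=> a0 a1; have u0 := mulr_ge0 l0 a0; have u1 := ler_wpM2r a0 l1.
  have h1 : 0 <= 2^-1 - lambda * a by lra.
  have h2 : 0 <= 2^-1 - a by lra.
  have := mulr_ge0 h1 h2; have := mulr_ge0 u0 h2; rewrite /t; split; lra.
have [t1 t2] := tle m m0 m2; have [t3 t4] := tle _ mk0 ltac:(lra).
have px : x / 4 <= p.
  by rewrite /p ler_pdivlMr; nra.
have p0 : 0 < p by rewrite (lt_le_trans _ px)// divr_gt0.
rewrite levy_transform_neg// => /eqP; rewrite eqr_opp => /eqP /complexI ->.
by apply: levy_abs_homo => //; rewrite divr_ge0// ltW.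
Qed.

End jump_bound.

(** * Helly's theorem along an ultrafilter *)

Section ultrafilter.
Context {R : realType}.

(** A cluster point exists by compactness of the segment, and an ultrafilter converges to each of
    its cluster points. *)
Lemma ultra_bounded_cvg (I : Type) (U : set_system I) {UU : UltraFilter U} (a : I -> R) (B : R) :
  U [set n | `|a n| <= B] -> exists l : R, a n @[n --> U] --> l.
Proof.
move=> aB; have : (a n @[n --> U]) `[- B, B]%classic.
  by apply: filterS aB => n aBn; rewrite /= in_itv/= -ler_norml; exact: aBn.
move=> /(@segment_compact R (- B) B _ _)[l [_ cl]]; exists l => V Vl.
have [//|UnV] := in_ultra_setVsetC (a @^-1` V) UU.
have := cl (~` V) V; rewrite /nbhs/= => /(_ _ Vl)[|x []//].
exact: UnV.
Qed.

Lemma nbhs_ultra (a : nat -> R) (l : R) :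
  (forall U : set_system nat, UltraFilter U -> \oo `<=` U -> a n @[n --> U] --> l) ->
  a n @[n --> \oo] --> l.
Proof.
move=> H V Vl; apply: contrapT => nV.
(* The filter generated by [\oo] and the complement of the preimage of V; it is proper precisely
   because V is assumed to refute convergence. *)
pose F : set_system nat := [set A | \oo (A `|` a @^-1` V)].
have FF : ProperFilter F.
  split; first by rewrite /F/= set0U.
  split; first by rewrite /F/= setTU; exact: filterT.
  - move=> A B FA FB; rewrite /F/= setUIl; exact: filterI.
  - move=> A B AB FA; apply: (@filterS _ \oo _ _ _ _ FA) => n [/AB|]; [by left|by right].
have [U [UU FU]] := ultraFilterLemma FF.
have ooU : \oo `<=` U.
  by move=> A ooA; apply: FU; apply: filterS ooA; exact: subsetUl.
have UV : U (a @^-1` V) by exact: (H U UU ooU V Vl).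
have UnV : U (~` (a @^-1` V)).
  by apply: FU; rewrite /F/= setUC setUv; exact: filterT.
have UI : U ((a @^-1` V) `&` ~` (a @^-1` V)) by exact: filterI.
by have [n []] := filter_ex UI.
Qed.

(** Pairs refuting the claim at scale 1/(n+1) have a common limit along an ultrafilter, against
    continuity there. Only s is confined to the segment; t may leave it slightly. *)
Lemma segment_unif_continuous (f : R -> R) (a b e : R) : continuous f -> 0 < e ->
  exists2 d : R, 0 < d & forall s t, a <= s <= b -> `|s - t| <= d -> `|f s - f t| <= e.
Proof.
move=> cf e0; apply: contrapT => H.
have ex n : exists st : R * R, [/\ a <= st.1 <= b, `|st.1 - st.2| <= n.+1%:R^-1 &
    e < `|f st.1 - f st.2|].
  apply: contrapT => Hn; apply: H; exists n.+1%:R^-1 => // s t sab st.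
  by rewrite leNgt; apply/negP => fst; apply: Hn; exists (s, t).
have [st stP] := choice ex.
have [U [UU ooU]] := @ultraFilterLemma nat \oo _.
have [p sp] : exists p : R, (st n).1 @[n --> U] --> p.
  apply: (@ultra_bounded_cvg _ _ _ _ (`|a| + `|b|)); apply: filterE => n /=.
  have [/andP[h1 h2] _ _] := stP n.
  rewrite ler_norml; have := ler_norm b; have := ler_norm (- a); rewrite normrN.
  by have := normr_ge0 a; have := normr_ge0 b; lra.
have d0 : (st n).1 - (st n).2 @[n --> U] --> (0 : R).
  apply/cvgrPdist_le => k k0; apply: ooU.
  have /cvgrPdist_le/(_ _ k0) := @cvg_harmonic R.
  apply: filterS => n; rewrite !sub0r !normrN [in `|_^-1|]ger0_norm// => h.
  by have [_ h' _] := stP n; exact: le_trans h.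
have tp : (st n).2 @[n --> U] --> p.
  rewrite -(subr0 p) (_ : (fun n => (st n).2) = (fun n => (st n).1 - ((st n).1 - (st n).2))).
    exact: cvgB.
  by apply/funext => n; ring.
have : f (st n).1 - f (st n).2 @[n --> U] --> f p - f p.
  by apply: cvgB; [exact: (cvg_comp _ _ sp (cf p))|exact: (cvg_comp _ _ tp (cf p))].
rewrite subrr => /cvgrPdist_le/(_ _ e0)/filter_ex[n /=].
by rewrite sub0r normrN leNgt; have [_ _ ->] := stP n.
Qed.

End ultrafilter.

(** * Riemann-Stieltjes sums and summation by parts *)

Section step_approximation.
Context {R : realType}.
Local Notation T := (measurableTypeR R).
Implicit Types m : {finite_measure set T -> \bar R}.

Lemma fin_measure_fine m (A : set T) : measurable A -> (fine (m A))%:E = m A.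
Proof. by move=> mA; rewrite fineK// fin_num_measure. Qed.

Lemma fine_measureU m (A B : set T) : measurable A -> measurable B ->
  A `&` B = set0 -> fine (m (A `|` B)) = fine (m A) + fine (m B).
Proof. by move=> mA mB AB; rewrite measureU// fineD// fin_num_measure. Qed.

Lemma fine_le_measure m (A B : set T) : measurable A -> measurable B -> A `<=` B ->
  fine (m A) <= fine (m B).
Proof.
by move=> mA mB AB; rewrite fine_le ?fin_num_measure// le_measure// inE.
Qed.

Lemma fine_measure_itvoc m (a b : R) : a <= b ->
  fine (m `]a, b]%classic) = fine (m `]-oo, b]%classic) - fine (m `]-oo, a]%classic).
Proof.
move=> ab; have -> : `]-oo, b]%classic = `]-oo, a] `|` `]a, b]%classic :> set R.
  apply/seteqP; split => x /=; rewrite !in_itv/=.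
    by move=> xb; case: (leP x a) => xa; [left|right]; rewrite ?xa.
  by move=> [xa|/andP[]//]; exact: le_trans ab.
rewrite fine_measureU//; first by rewrite addrC addKr.
apply/seteqP; split => x //= []; rewrite !in_itv/= => xa /andP[].
by rewrite ltNge xa.
Qed.

Lemma Rintegral_cell m (A : set T) (f : R -> R) (c e : R) : measurable A -> bc_fun f ->
  (forall t, A t -> `|f t - c| <= e) ->
  `|(\int[m]_(t in A) f t)%R - c * fine (m A)| <= e * fine (m A).
Proof.
move=> mA fb fc; have intf (g : R -> R) : bc_fun g -> m.-integrable A (EFin \o g).
  by move=> gb; apply: (integrableS measurableT) => //; exact: bc_fun_integrable.
have cb := bc_fun_cst c; have eb := bc_fun_cst e.
rewrite -Rintegral_cst// -RintegralB//; [|exact: intf..].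
apply: (le_trans (le_normr_Rintegral _ _)) => //; first by apply: intf; exact: bc_funB.
rewrite -Rintegral_cst//; apply: le_Rintegral => //; last exact: intf.
apply: intf; have [cfc [K fK]] := bc_funB fb cb; split.
  by move=> t; apply: cvg_norm; exact: cfc.
by exists K => t; rewrite normr_id.
Qed.

Lemma step_approx_cells m (f : R -> R) (x : nat -> R) (e : R) N : bc_fun f ->
  (forall i, x i <= x i.+1) -> 
  (forall i t, (i < N)%N -> x i < t <= x i.+1 -> `|f t - f (x i)| <= e) ->
  `|(\int[m]_(t in `]x 0%N, x N]) f t)%R -
    \sum_(i < N) f (x i) * fine (m `]x i, x i.+1]%classic)| <= e * fine (m `]x 0%N, x N]%classic).
Proof.
move=> fb xS; have x0 n : x 0%N <= x n by elim: n => // n /le_trans; apply.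
have intf (A : set T) : measurable A -> m.-integrable A (EFin \o f).
  by move=> mA; apply: (integrableS measurableT) => //; exact: bc_fun_integrable.
elim: N => [|N IH] fe.
  by rewrite big_ord0 set_itvoc0 Rintegral_set0 measure0/= subrr normr0 mulr0.
have disj : `]x 0%N, x N]%classic `&` `]x N, x N.+1]%classic = set0 :> set R.
  apply/seteqP; split => t //= []; rewrite !in_itv/= => /andP[_ tN] /andP[].
  by rewrite ltNge tN.
have -> : `]x 0%N, x N.+1]%classic = `]x 0%N, x N] `|` `]x N, x N.+1]%classic :> set R.
  apply/seteqP; split => t /=; rewrite !in_itv/=.
    by move=> /andP[h1 h2]; case: (leP t (x N)) => h; [left|right]; rewrite ?h1 ?h2 ?h.
  by move=> [/andP[-> h]|/andP[h ->]] /=; [exact: le_trans (xS N)|rewrite (le_lt_trans (x0 N))].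
rewrite Rintegral_setU//; last 2 first.
- exact/intf/measurableU.
- by apply/disj_setPS; rewrite disj.
rewrite fine_measureU// big_ord_recr /= mulrDr.
have h1 := IH (fun i t iN => fe i t (ltnW iN)).
have h2 : `|(\int[m]_(t in `]x N, x N.+1]) f t)%R - f (x N) * fine (m `]x N, x N.+1]%classic)| <=
    e * fine (m `]x N, x N.+1]%classic).
  by apply: Rintegral_cell => // t; rewrite /= in_itv/=; exact: fe.
rewrite (_ : _ - _ = ((\int[m]_(t in `]x 0%N, x N]) f t)%R -
    \sum_(i < N) f (x i) * fine (m `]x i, x i.+1]%classic)) +
  ((\int[m]_(t in `]x N, x N.+1]) f t)%R - f (x N) * fine (m `]x N, x N.+1]%classic))); last by ring.
by rewrite (le_trans (ler_normD _ _))// lerD.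
Qed.

Lemma step_approx m (f : R -> R) (x : nat -> R) (e K : R) N : bc_fun f -> 0 <= e ->
  (forall t, `|f t| <= K) -> (forall i, x i <= x i.+1) -> 
  (forall i t, (i < N)%N -> x i < t <= x i.+1 -> `|f t - f (x i)| <= e) ->
  `|(\int[m]_t f t)%R - \sum_(i < N) f (x i) * fine (m `]x i, x i.+1]%classic)| <=
  e * fine (m [set: R]) + K * fine (m (~` `]x 0%N, x N]%classic)).
Proof.
move=> fb e0 fK xS fe; have intf (A : set T) : measurable A -> m.-integrable A (EFin \o f).
  by move=> mA; apply: (integrableS measurableT) => //; exact: bc_fun_integrable.
have mI : measurable (`]x 0%N, x N]%classic : set T) by [].
have mC := measurableC mI.
have -> : (\int[m]_t f t)%R = (\int[m]_(t in `]x 0%N, x N]) f t)%R +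
    (\int[m]_(t in ~` `]x 0%N, x N]) f t)%R.
  rewrite -Rintegral_setU//; first by rewrite setUv.
    by rewrite setUv; exact: intf.
  by apply/disj_setPS; rewrite setICr.
have h1 := step_approx_cells m fb xS fe.
have h2 : `|(\int[m]_(t in ~` `]x 0%N, x N]) f t)%R| <= K * fine (m (~` `]x 0%N, x N]%classic)).
  have := @Rintegral_cell m _ f 0 K mC fb; rewrite mul0r subr0; apply => t _.
  by rewrite subr0.
have h3 : e * fine (m `]x 0%N, x N]%classic) <= e * fine (m [set: R]).
  by rewrite ler_wpM2l// fine_le_measure.
rewrite addrAC (le_trans (ler_normD _ _))// lerD//; exact: le_trans h3.
Qed.

(* Summation by parts: the differences [F i - P i] need not be small, but f varies
   by at most e between consecutive indices. *)
Lemma abel_bound (f P F : nat -> R) (e K B : R) N : 0 <= e ->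
  (forall i, `|f i| <= K) -> (forall i, (i < N)%N -> `|f i - f i.+1| <= e) ->
  (forall i, P i <= F i <= P i.+1) -> P N.+1 - P 0%N <= B ->
  `|\sum_(i < N) f i * (P i.+1 - P i) - \sum_(i < N) f i * (F i.+1 - F i)| <=
  e * B + K * (P 1%N - P 0%N) + K * (P N.+1 - P N).
Proof.
move=> e0 fK fe PF PB; pose E i := F i - P i.
have E0 i : 0 <= E i by rewrite subr_ge0; case/andP: (PF i).
have EP i : E i <= P i.+1 - P i by rewrite lerD2r; case/andP: (PF i).
(* The boundary terms are kept apart; each further index costs at most e E(n+1), hence at most e
   times an increment of P, and these telescope. *)
have key n : (n <= N)%N -> `|\sum_(i < n) f i * (E i.+1 - E i) - (f n * E n - f 0%N * E 0%N)| <=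
    e * (P n.+1 - P 1%N).
  elim: n => [|n IH] nN; first by rewrite big_ord0 !subrr normr0 mulr0.
  have := IH (ltnW nN); rewrite big_ord_recr /= => h.
  rewrite (_ : _ - _ = (\sum_(i < n) f i * (E i.+1 - E i) - (f n * E n - f 0%N * E 0%N)) +
    (f n - f n.+1) * E n.+1); last by ring.
  apply: (le_trans (ler_normD _ _)); rewrite normrM (ger0_norm (E0 _)).
  have := ler_pM (normr_ge0 _) (E0 _) (fe n nN) (EP n.+1); lra.
have -> : \sum_(i < N) f i * (P i.+1 - P i) - \sum_(i < N) f i * (F i.+1 - F i) =
    - \sum_(i < N) f i * (E i.+1 - E i).
  rewrite -sumrB -sumrN; apply: eq_bigr => i _; rewrite /E; ring.
rewrite normrN; set S := \sum_(i < N) _.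
have h := key N (leqnn N); rewrite -/S in h.
have h1 : `|f N * E N| <= K * (P N.+1 - P N) by rewrite normrM (ger0_norm (E0 _)) ler_pM.
have h0 : `|f 0%N * E 0%N| <= K * (P 1%N - P 0%N) by rewrite normrM (ger0_norm (E0 _)) ler_pM.
have h2 : `|S| <= `|S - (f N * E N - f 0%N * E 0%N)| + `|f N * E N| + `|f 0%N * E 0%N|.
  rewrite -addrA -{1}(subrK (f N * E N - f 0%N * E 0%N) S).
  by rewrite (le_trans (ler_normD _ _))// lerD2l ler_normB.
have h3 : e * (P N.+1 - P 1%N) <= e * B.
  by rewrite ler_wpM2l//; have /andP[] := PF 0%N; lra.
lra.
Qed.

End step_approximation.

Section helly.
Context {R : realType}.
Local Notation T := (measurableTypeR R).

Lemma cvg_measure_itv (m : {measure set T -> \bar R}) :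
  m `](- n%:R), n%:R]%classic @[n --> \oo] --> m [set: R].
Proof.
pose I (n : nat) : set T := `](- n%:R), n%:R]%classic.
have mI n : measurable (I n) by exact: measurable_itv.
rewrite -(bigcup_itvT false false).
apply: (@nondecreasing_cvg_mu _ T R m I) => //; first exact: bigcupT_measurable.
by move=> i j ij; apply/subsetPset/subset_itv; rewrite leBSide/= ?lerN2 ler_nat.
Qed.

Lemma measure_tail (m : {finite_measure set T -> \bar R}) (e : R) : 0 < e ->
  exists A0 : R, forall A, A0 <= A -> fine (m (~` `](- A), A]%classic)) <= e.
Proof.
move=> e0; pose I (n : nat) : set T := `](- n%:R), n%:R]%classic.
have : fine (m (I n)) @[n --> \oo] --> fine (m [set: R]).
  by apply: fine_cvg; rewrite fineK ?fin_num_measure//; exact: cvg_measure_itv.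
move=> /cvgrPdist_le/(_ _ e0)/filter_ex[n /= ne].
exists n%:R => A nA; apply: (@le_trans _ _ (fine (m (~` I n)))).
  apply: fine_le_measure; [by apply: measurableC; exact: measurable_itv..|].
  by apply: subsetC; apply: subset_itv; rewrite leBSide/= ?lerN2.
have mIn : measurable (I n) by exact: measurable_itv.
have := fine_measureU m mIn (measurableC mIn) (setICr _); rewrite setUv => h.
by move: ne; rewrite h addrC addKr => /(le_trans (ler_norm _)).
Qed.

Lemma cumulative_finite_measure (f : cumulative R R) (B : R) :
  (forall x, 0 <= f x <= B) ->
  exists G : {finite_measure set T -> \bar R}, forall a b, a <= b ->
    fine (G `]a, b]%classic) = f b - f a.
Proof.
move=> fB; pose mu := lebesgue_stieltjes_measure f.
have muE (a b : R) : a <= b -> mu `]a, b]%classic = (f b - f a)%:E.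
  move=> ab; rewrite /mu /lebesgue_stieltjes_measure /measure_extension.
  by rewrite measurable_mu_extE/= ?wlength_itv_bnd//; exact: is_ocitv.
have muT : (mu [set: R] <= B%:E)%E.
  have mI : mu `](- n%:R), n%:R]%classic @[n --> \oo] --> mu [set: R].
    exact: cvg_measure_itv.
  rewrite -(cvg_lim _ mI)//; apply: lime_le; first by apply/cvg_ex; eexists; exact: mI.
  apply: nearW => n; rewrite /= muE ?lee_fin; last by rewrite ge0_cp.
  by have /andP[_ h1] := fB n%:R; have /andP[h2 _] := fB (- n%:R); lra.
have fin : fin_num_fun mu.
  move=> A mA; rewrite ge0_fin_numE//; apply: (@le_lt_trans _ _ B%:E); last exact: ltry.
  by apply: le_trans muT; apply: le_measure => //; rewrite inE.
pose G : {finite_measure set T -> \bar R} := HB.pack mu (Measure_isFinite.Build _ _ _ mu fin).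
by exists G => a b ab; rewrite [G _]muE.
Qed.

Variables (U : set_system nat) (UU : UltraFilter U).
Variables (G_ : nat -> {finite_measure set T -> \bar R}) (B : R).
Hypothesis mass : U [set n | fine (G_ n [set: R]) <= B].
Hypothesis tight : forall e : R, 0 < e ->
  exists A, U [set n | fine (G_ n (~` `](- A), A]%classic)) <= e].

Let F_ n x : R := fine (G_ n `]-oo, x]%classic).

Let F_ge0 n x : 0 <= F_ n x.
Proof. by rewrite fine_ge0. Qed.

Let F_homo n x y : x <= y -> F_ n x <= F_ n y.
Proof. by move=> xy; apply: fine_le_measure => //; exact: subset_itvl. Qed.

Let F_le n x : F_ n x <= fine (G_ n [set: R]).
Proof. exact: fine_le_measure. Qed.

Let Fcvg x : exists l : R, F_ n x @[n --> U] --> l.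
Proof.
apply: (@ultra_bounded_cvg _ _ U UU _ B); apply: filterS mass => n /= h.
by rewrite ger0_norm// (le_trans (F_le n x)).
Qed.

Let Phi := projT1 (choice Fcvg).

Let PhiP x : F_ n x @[n --> U] --> Phi x.
Proof. exact: (projT2 (choice Fcvg)). Qed.

Let le_ultra (a b : nat -> R) (k l : R) : a n @[n --> U] --> k -> b n @[n --> U] --> l ->
  U [set n | a n <= b n] -> k <= l.
Proof.
by move=> ak bl ab; rewrite -(cvg_lim _ ak)// -(cvg_lim _ bl)//;
  apply: ler_lim => //; apply/cvg_ex; eexists; [exact: ak|exact: bl].
Qed.

Let cst_ultra (c : R) : (fun _ : nat => c) n @[n --> U] --> c.
Proof. exact: cvg_cst. Qed.

Let Phi_ge0 x : 0 <= Phi x.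
Proof. by apply: (le_ultra (@cst_ultra _) (@PhiP x)); apply: filterE => n /=. Qed.

Let Phi_homo x y : x <= y -> Phi x <= Phi y.
Proof. by move=> xy; apply: (le_ultra (@PhiP x) (@PhiP y)); apply: filterE => n /=; exact: F_homo. Qed.

Let Phi_le x : Phi x <= B.
Proof.
apply: (le_ultra (@PhiP x) (@cst_ultra _)); apply: filterS mass => n /= h.
exact: le_trans (F_le n x) h.
Qed.

(** The pointwise limit Phi of the distribution functions is monotone but need not be right
    continuous; its right limit Psi is, and Phi(x) <= Psi(x) <= Phi(y) whenever x < y. *)
Let Psi x := inf [set Phi y | y in [set y | x < y]].

Let Psi_inf x : has_inf [set Phi y | y in [set y | x < y]].
Proof.
split; first by exists (Phi (x + 1)), (x + 1) => //=; rewrite ltrDl.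
by exists 0 => _ [y _ <-].
Qed.

Let Psi_le x y : x < y -> Psi x <= Phi y.
Proof. by move=> xy; apply: ge_inf; [case: (Psi_inf x)|exists y]. Qed.

Let le_Psi x k : (forall y, x < y -> k <= Phi y) -> k <= Psi x.
Proof. by move=> H; apply: lb_le_inf; [case: (Psi_inf x)|move=> _ [y /= xy <-]; exact: H]. Qed.

Let Phi_le_Psi x : Phi x <= Psi x.
Proof. by apply: le_Psi => y /ltW; exact: Phi_homo. Qed.

Let Psi_homo : {homo Psi : x y / x <= y}.
Proof. by move=> x y xy; apply: le_Psi => z yz; apply: Psi_le; exact: le_lt_trans yz. Qed.

Let Psi_rc : right_continuous Psi.
Proof.
move=> x; apply/cvgrPdist_le => e e0.
have [_ [y /= xy <-] ye] := inf_adherent e0 (Psi_inf x).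
near=> t; have xt : x < t by near: t; exact: nbhs_right_gt.
have ty : t < y by near: t; exact: nbhs_right_lt.
rewrite distrC ger0_norm ?subr_ge0 ?Psi_homo ?(ltW xt)// lerBlDl.
exact: le_trans (Psi_le ty) (ltW ye).
Unshelve. all: by end_near. Qed.

(** The grid is arbitrary, not made of continuity points of the limit: Phi and Psi may differ at its
    nodes, but they interlace, so [abel_bound] makes their Stieltjes sums close. Tightness controls
    the two end cells. *)
Theorem helly : exists G : {finite_measure set T -> \bar R},
  forall f : R -> R, bc_fun f -> (\int[G_ n]_t f t @[n --> U] --> \int[G]_t f t)%R.
Proof.
pose cPsi : cumulative R R := HB.pack Psi (isCumulative.Build R _ R Psi Psi_homo Psi_rc).
have Psi_B x : 0 <= cPsi x <= B.
  apply/andP; split; first exact: le_trans (Phi_ge0 x) (Phi_le_Psi x).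
  by apply: le_trans (Phi_le (x + 1)); apply: Psi_le; rewrite ltrDl.
have [G GE] := cumulative_finite_measure Psi_B.
exists G => f fb; have [cf [K fK]] := fb.
have K0 : 0 <= K by exact: le_trans (fK 0).
have B0 : 0 <= B by exact: le_trans (Phi_ge0 0) (Phi_le 0).
apply/cvgrPdist_le => d d0.
pose MG := fine (G [set: R]).
have MG0 : 0 <= MG by rewrite fine_ge0.
(* The errors add up to e (2 B + MG + 4 K + 1); the rest is slack. *)
pose e := d / (3 * B + MG + 4 * K + 2).
have den0 : 0 < 3 * B + MG + 4 * K + 2 by lra.
have e0 : 0 < e by rewrite divr_gt0.
have [A1 tA1] := tight e0; have [A2 tA2] := measure_tail G e0.
(* The extra 1 exceeds the mesh, so the first cell of the grid and the cell after the last node lie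
   outside ]-A1, A1]. *)
pose A := Num.max 0 (Num.max A1 A2) + 1.
have A0 : 1 <= A by rewrite lerDr le_max lexx.
have AA1 : A1 + 1 <= A by rewrite lerD2r !le_max lexx orbT.
have AA2 : A2 <= A by rewrite (@le_trans _ _ (A2 + 1)) ?lerDl// lerD2r !le_max lexx !orbT.
have [eta eta0 fe] := segment_unif_continuous (- A) (A + 1) cf e0.
have [N N0 Neta] : exists2 N : nat, (0 < N)%N & 2 * A / N%:R <= Num.min eta 1.
  have m0 : 0 < Num.min eta 1 by rewrite lt_min eta0 ltr01.
  exists (Num.truncn (2 * A / Num.min eta 1)).+1 => //.
  by rewrite ler_pdivrMr ?ltr0n// [leRHS]mulrC -ler_pdivrMr// ltW// truncnS_gt.
have NR0 : 0 < N%:R :> R by rewrite ltr0n.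
pose h := 2 * A / N%:R.
have h0 : 0 < h by rewrite divr_gt0//; lra.
have heta : h <= eta by apply: le_trans Neta _; rewrite ge_min lexx.
have h1 : h <= 1 by apply: le_trans Neta _; rewrite ge_min lexx orbT.
pose x i := - A + i%:R * h.
have xS i : x i.+1 = x i + h by rewrite /x -natr1; ring.
have xSlt i : x i < x i.+1 by rewrite xS ltrDl.
have x0E : x 0%N = - A by rewrite /x mul0r addr0.
have xNE : x N = A by rewrite /x /h mulrC mulfVK ?gt_eqF//; ring.
have xle i j : (i <= j)%N -> x i <= x j.
  by move=> ij; rewrite /x lerD2l ler_wpM2r ?(ltW h0)// ler_nat.
have fcell i t : (i < N)%N -> x i < t <= x i.+1 -> `|f t - f (x i)| <= e.
  move=> iN /andP[xt tx]; rewrite distrC; apply: fe; last first.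
    by rewrite distrC ger0_norm; move: tx; rewrite xS; lra.
  have := xle 0%N i (leq0n i); have := xle i N (ltnW iN); rewrite x0E xNE; lra.
have fstep i : (i < N)%N -> `|f (x i) - f (x i.+1)| <= e.
  by move=> iN; rewrite distrC; apply: fcell => //; rewrite xSlt lexx.
pose S (P : nat -> R) := \sum_(i < N) f (x i) * (P i.+1 - P i).
have Sn : S (fun i => F_ n (x i)) @[n --> U] --> S (Phi \o x).
  apply: (@cvg_big _ _ _ _ _ _ _ _ _ (fun (i : 'I_N) n => f (x i) * (F_ n (x i.+1) - F_ n (x i)))).
    exact: add_continuous.
  by move=> i _; apply: cvgM; [exact: cvg_cst|apply: cvgB; exact: PhiP].
have tight_inc a b : (b <= - A + 1) || (A - 1 <= a) -> a <= b -> Phi b - Phi a <= e.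
  move=> ab_out ab; 
  have cba : F_ n b - F_ n a @[n --> U] --> Phi b - Phi a by apply: cvgB; exact: PhiP.
  apply: (le_ultra cba (@cst_ultra _)); apply: filterS tA1 => n /= hn.
  rewrite -[X in X <= _]/(F_ n b - F_ n a) -fine_measure_itvoc//.
  apply: le_trans hn; apply: fine_le_measure => //; first by apply: measurableC; exact: measurable_itv.
  move=> t /=; rewrite !in_itv/= => /andP[at_ tb] /andP[t1 t2].
  by move: ab_out => /orP[]; lra.
have SG : `|S (Phi \o x) - S (Psi \o x)| <= e * B + K * e + K * e.
  apply: (le_trans (@abel_bound _ (f \o x) (Phi \o x) (Psi \o x) e K B N (ltW e0) _ _ _ _)) => //=.
  - by move=> i; rewrite Phi_le_Psi Psi_le.
  - by have := Phi_le (x N.+1); have := Phi_ge0 (x 0%N); lra.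
  - rewrite !lerD// ler_wpM2l//.
      by apply: tight_inc; rewrite ?(ltW (xSlt _))// xS x0E lerD2l h1.
    by apply: tight_inc; rewrite ?(ltW (xSlt _))// xNE lerBlDr lerDl ler01 orbT.
have step (m : {finite_measure set T -> \bar R}) :=
  step_approx m fb (ltW e0) fK (fun i => ltW (xSlt i)) fcell.
have stepG : `|(\int[G]_t f t)%R - S (Psi \o x)| <= e * MG + K * e.
  have := step G; rewrite x0E xNE.
  under eq_bigr do rewrite GE ?(ltW (xSlt _))//.
  move=> /le_trans; apply; rewrite lerD2l ler_wpM2l// tA2//.
have stepn n : fine (G_ n [set: R]) <= B -> fine (G_ n (~` `](- A1), A1]%classic)) <= e ->
    `|(\int[G_ n]_t f t)%R - S (fun i => F_ n (x i))| <= e * B + K * e.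
  move=> nB nA; have := step (G_ n); rewrite x0E xNE.
  under eq_bigr do rewrite fine_measure_itvoc ?(ltW (xSlt _))//.
  move=> /le_trans; apply; apply: lerD; first by rewrite ler_wpM2l// ltW.
  rewrite ler_wpM2l// (le_trans _ nA)// fine_le_measure//;
    [by apply: measurableC; exact: measurable_itv..|].
  by apply: subsetC => t /=; rewrite !in_itv/=; lra.
have dE : d = e * (3 * B + MG + 4 * K + 2) by rewrite /e mulfVK ?gt_eqF.
have /cvgrPdist_le/(_ _ e0) Sne := Sn.
apply: filterS3 mass tA1 Sne => n /= hB hA hS.
have s1 := stepn n hB hA.
have s2 : `|(\int[G]_t f t)%R - (\int[G_ n]_t f t)%R| <=
    `|(\int[G]_t f t)%R - S (Psi \o x)| + (`|S (Phi \o x) - S (Psi \o x)| +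
    (`|S (Phi \o x) - S (fun i => F_ n (x i))| + `|(\int[G_ n]_t f t)%R - S (fun i => F_ n (x i))|)).
  rewrite (_ : _ - _ = ((\int[G]_t f t)%R - S (Psi \o x)) + (- (S (Phi \o x) - S (Psi \o x)) +
    ((S (Phi \o x) - S (fun i => F_ n (x i))) +
     - ((\int[G_ n]_t f t)%R - S (fun i => F_ n (x i)))))); last by ring.
  rewrite (le_trans (ler_normD _ _))// lerD2l (le_trans (ler_normD _ _))// normrN lerD2l.
  by rewrite (le_trans (ler_normD _ _))// normrN.
have eB := mulr_ge0 (ltW e0) B0; have eK := mulr_ge0 (ltW e0) K0.
by apply: (le_trans s2); rewrite dE; move: SG stepG s1 hS; rewrite /=; lra.
Qed.

End helly.

(** * Uniqueness of the Levy measure *)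

Section measure_rays.
Context {R : realType}.
Local Notation T := (measurableTypeR R).

Lemma eq_measure_rays (m1 m2 : {measure set T -> \bar R}) : fin_num_fun m1 ->
  (forall x : R, m1 `[x, +oo[%classic = m2 `[x, +oo[%classic) ->
  forall A, measurable A -> m1 A = m2 A.
Proof.
move=> fin H A; apply: (@measure_unique _ R T (@RGenCInfty.G R) (fun n => `[- n%:R, +oo[%classic)
  _ _ _ _ m1 m2).
- exact: RGenCInfty.measurableE.
- move=> _ _ [x ->] [y ->]; exists (Num.max x y); apply/seteqP; split => t /=;
    by rewrite !in_itv/= !andbT ge_max => /andP.
- by move=> n; exists (- n%:R).
- apply/seteqP; split => // t _; exists (Num.truncn `|t|).+1 => //=.
  rewrite in_itv/= andbT lerNl; apply: (le_trans (ler_norm _)).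
  by rewrite normrN ltW// truncnS_gt.
- by move=> _ [x ->]; exact: H.
- by move=> n; rewrite -ge0_fin_numE// fin.
Qed.

Lemma measurable_opp_preimage (A : set T) : measurable A -> measurable (-%R @^-1` A : set T).
Proof.
move=> mA; rewrite -[X in measurable X]setTI.
exact: (continuous_measurable_fun (@oppr_continuous R R)).
Qed.

(** Continuous cut-offs equal to 1 on [x, +oo[ and tending to 0 elsewhere, through which integrals
    of bounded continuous functions determine the measures of rays. *)
Definition ramp (x : R) (j : nat) (t : R) : R := Num.min 1 (Num.max 0 (1 + j%:R * (t - x))).

Lemma bc_ramp x j : bc_fun (ramp x j).
Proof.
split; last first.
  exists 1 => t; rewrite ger0_norm /ramp ?ge_min ?lexx//.
  by rewrite le_min ler01 le_max lexx.
have c1 : continuous (fun t : R => 1 + j%:R * (t - x)).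
  move=> t; apply: cvgD; first exact: cvg_cst.
  apply: cvgM; first exact: cvg_cst.
  by apply: cvgB; [exact: cvg_id|exact: cvg_cst].
move=> t; apply: (@continuous_min _ _ (fun=> 1) (fun t => Num.max 0 (1 + j%:R * (t - x)))).
  exact: cvg_cst.
apply: (@continuous_max _ _ (fun=> 0) (fun t => 1 + j%:R * (t - x))); last exact: c1.
exact: cvg_cst.
Qed.

Lemma cvg_ramp x t : ramp x j t @[j --> \oo] --> (\1_(`[x, +oo[%classic) t : R).
Proof.
apply/cvgrPdist_le => e e0; rewrite indicE mem_setE in_itv/= andbT.
case: (leP x t) => xt /=.
  near=> j; rewrite /ramp (_ : Num.max _ _ = 1 + j%:R * (t - x)); last first.
    by apply/max_idPr; rewrite addr_ge0// mulr_ge0// subr_ge0.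
  rewrite (_ : Num.min _ _ = 1) ?subrr ?normr0 ?ltW//.
  by apply/min_idPl; rewrite lerDl mulr_ge0// subr_ge0.
near=> j; rewrite /ramp (_ : Num.max _ _ = 0).
  rewrite (_ : Num.min _ _ = 0) ?subrr ?normr0 ?ltW//.
  by apply/min_idPr.
apply/max_idPl.
have jx : (x - t)^-1 <= j%:R by near: j; exact: nbhs_infty_ger.
have xt0 : 0 < x - t by rewrite subr_gt0.
have := ler_wpM2r (ltW xt0) jx; rewrite mulVf ?gt_eqF//; lra.
Unshelve. all: by end_near. Qed.

Lemma symmetric_Rintegral (G : {finite_measure set T -> \bar R}) :
  (forall f, bc_fun f -> (\int[G]_t f (- t) = \int[G]_t f t)%R) -> symmetric_measure G.
Proof.
move=> H.
have mN : measurable_fun [set: T] (-%R : T -> T).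
  by apply: continuous_measurable_fun; exact: oppr_continuous.
pose N : {mfun T >-> T} := HB.pack (-%R : T -> T) (isMeasurableFun.Build _ _ _ _ _ mN).
suff E A : measurable A -> G A = pushforward G N A by move=> A mA; exact: esym (E A mA).
apply: eq_measure_rays; first by move=> B mB; exact: fin_num_measure.
move=> x; set I := `[x, +oo[%classic : set T.
have mI : measurable I by exact: measurable_itv.
have mNI := measurable_opp_preimage mI.
have indE (B : set T) : measurable B -> (\int[G]_t \1_B t)%R = fine (G B).
  by move=> mB; rewrite /Rintegral integral_indic// setIT.
have rampb j t : `|ramp x j t| <= 1.
  by rewrite ger0_norm /ramp ?ge_min ?lexx// le_min ler01 le_max lexx.
have c1 : (\int[G]_t ramp x j t @[j --> \oo] --> \int[G]_t \1_I t)%R.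
  apply: (@bounded_cvg_Rintegral _ _ _ _ 1) => //.
  - by move=> j; exact: continuous_measurable_fun (bc_ramp x j).1.
  - exact: cvg_ramp.
have c2 : (\int[G]_t ramp x j (- t) @[j --> \oo] --> \int[G]_t \1_(-%R @^-1` I) t)%R.
  apply: (@bounded_cvg_Rintegral _ _ _ _ 1) => //.
  - by move=> j; exact: continuous_measurable_fun (bc_fun_opp (bc_ramp x j)).1.
  - by move=> t; exact: cvg_ramp.
have : (\int[G]_t \1_I t)%R = (\int[G]_t \1_(-%R @^-1` I) t)%R.
  apply: (cvg_unique _ c1); first exact: Rhausdorff.
  rewrite (_ : (fun j => (\int[G]_t ramp x j t)%R) = fun j => (\int[G]_t ramp x j (- t))%R)//.
  by apply/funext => j; exact: esym (H _ (bc_ramp x j)).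
by rewrite (indE _ mI) (indE _ mNI) => e;
  exact: etrans (esym (fin_measure_fine G mI)) (etrans (congr1 EFin e) (fin_measure_fine G mNI)).
Qed.

End measure_rays.

(** * Polynomials converging to the indicator of an initial segment of [0, 1] *)

Section polynomial_indicator.
Context {R : realType}.
Implicit Types (x v th : R).

Lemma bernoulli_le x m : 0 <= x -> x <= 1 -> 1 - m%:R * x <= (1 - x) ^+ m.
Proof.
move=> x0 x1; elim: m => [|m IH]; first by rewrite mul0r subr0 expr0.
rewrite exprS -natr1; have h : 0 <= 1 - x by lra.
have := ler_wpM2l h IH; have : 0 <= m%:R * (x * x) by rewrite !mulr_ge0.
lra.
Qed.

Lemma bernoulli_inv x m : 0 <= x -> x <= 1 -> (1 + m%:R * x) * (1 - x) ^+ m <= 1.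
Proof.
move=> x0 x1; elim: m => [|m IH]; first by rewrite mul0r addr0 expr0 mulr1.
rewrite exprS; apply: le_trans IH; rewrite mulrA ler_wpM2r ?exprn_ge0 ?subr_ge0//.
rewrite -natr1; have : 0 <= (m%:R + 1) * (x * x) by rewrite !mulr_ge0// addr_ge0.
lra.
Qed.

(* The factor n in the exponent makes the values at v = th tend to 0. *)
Definition flat_poly th n : {poly R} :=
  (1 - 'X^n) ^+ (Num.truncn (n%:R / th ^+ n)).+1.

Lemma flat_polyE th n v :
  (flat_poly th n).[v] = (1 - v ^+ n) ^+ (Num.truncn (n%:R / th ^+ n)).+1.
Proof. by rewrite /flat_poly horner_exp hornerD hornerN hornerXn -polyC1 hornerC. Qed.

Lemma flat_poly_01 th n v : 0 <= v <= 1 -> 0 <= (flat_poly th n).[v] <= 1.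
Proof.
move=> /andP[v0 v1]; rewrite flat_polyE.
have h : 0 <= 1 - v ^+ n by rewrite subr_ge0 exprn_ile1.
by rewrite exprn_ge0// exprn_ile1// lerBlDr lerDl exprn_ge0.
Qed.

Lemma cvg_natr_expr (q : R) : 0 <= q -> q < 1 -> n%:R * q ^+ n @[n --> \oo] --> (0 : R).
Proof.
move=> q0 q1; have [->|qn0] := eqVneq q 0.
  apply/cvgrPdist_le => e e0; near=> n; rewrite expr0n.
  have /negbTE -> : n != 0%N by rewrite -lt0n; near: n; exact: nbhs_infty_gt.
  by rewrite mulr0 subrr normr0 ltW.
have q00 : 0 < q by rewrite lt_def qn0.
(* [bernoulli_inv] at 1 - r gives n r^n <= 1/(1 - r), so n q^n = n r^n r^n is at most r^n / (1 -
   r). *)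
pose r := Num.sqrt q.
have r0 : 0 < r by rewrite sqrtr_gt0.
have rq : q = r * r by rewrite -expr2 sqr_sqrtr.
have r1 : r < 1.
  by rewrite ltNge; apply/negP => r1; have := ler_pM ler01 ler01 r1 r1; rewrite -rq mulr1 leNgt q1.
have c0 : (1 - r)^-1 * r ^+ n @[n --> \oo] --> (1 - r)^-1 * (0 : R).
  by apply: cvgM; [exact: cvg_cst|apply: cvg_expr; rewrite ger0_norm// ltW].
rewrite mulr0 in c0; apply: (squeeze_cvgr _ (@cvg_cst R 0 nat \oo _) c0).
apply: nearW => n; rewrite mulr_ge0 ?exprn_ge0//= rq exprMn mulrA ler_wpM2r ?exprn_ge0 ?(ltW r0)//.
have h := @bernoulli_inv (1 - r) n; rewrite opprB addrCA subrr addr0 in h.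
have := h _ _; rewrite subr_ge0 (ltW r1) lerBlDr lerDl (ltW r0) => /(_ erefl erefl) h'.
rewrite -[leRHS]mul1r ler_pdivlMr ?subr_gt0//.
have := exprn_ge0 n (ltW r0); lra.
Unshelve. all: by end_near. Qed.

(** The exponent m is about n / th^n. If v < th, then m v^n <= n (v/th)^n + v^n tends to 0 and
    Bernoulli bounds the value below by 1 - m v^n. If v >= th, then m v^n >= n and the value is at
    most 1/(1 + m v^n) <= 1/(n + 1). *)
Lemma cvg_flat_poly th v : 0 < th < 1 -> 0 <= v <= 1 ->
  (flat_poly th n).[v] @[n --> \oo] --> (if v < th then 1 else 0 : R).
Proof.
move=> /andP[th0 th1] v01; have /andP[v0 v1] := v01.
pose M n := (Num.truncn (n%:R / th ^+ n)).+1.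
have M1 n : n%:R / th ^+ n <= (M n)%:R by rewrite ltW// truncnS_gt.
have M2 n : (M n)%:R <= n%:R / th ^+ n + 1.
  by rewrite /M -natr1 lerD2r truncn_le// divr_ge0// exprn_ge0// ltW.
have vn n : 0 <= v ^+ n <= 1 by rewrite exprn_ge0//= exprn_ile1.
case: (ltP v th) => vth.
  have q1 : v / th < 1 by rewrite ltr_pdivrMr// mul1r.
  have q0 : 0 <= v / th by rewrite divr_ge0// ltW.
  have c1 : 1 - (n%:R * (v / th) ^+ n + v ^+ n) @[n --> \oo] --> 1 - (0 + 0 : R).
    apply: cvgB; first exact: cvg_cst.
    apply: cvgD; first exact: cvg_natr_expr.
    by apply: cvg_expr; rewrite ger0_norm// (lt_trans vth).
  rewrite addr0 subr0 in c1.
  apply: (squeeze_cvgr _ c1 (@cvg_cst R 1 nat \oo _)).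
  apply: nearW => n; have /andP[_ ->] := @flat_poly_01 th n v v01; rewrite andbT flat_polyE.
  have /andP[h1 h2] := vn n; apply: le_trans (bernoulli_le _ h1 h2); rewrite -/(M n).
  have := ler_wpM2r h1 (M2 n); rewrite expr_div_n.
  rewrite (_ : n%:R * (v ^+ n / th ^+ n) = n%:R / th ^+ n * v ^+ n); last by ring.
  lra.
apply: (squeeze_cvgr _ (@cvg_cst R 0 nat \oo _) (@cvg_harmonic R)).
apply: nearW => n; have /andP[-> _] /= := @flat_poly_01 th n v v01; rewrite flat_polyE -/(M n).
have /andP[h1 h2] := vn n.
have h3 := bernoulli_inv (M n) h1 h2.
have h4 : n%:R <= (M n)%:R * v ^+ n.
  apply: le_trans (ler_wpM2r h1 (M1 n)); rewrite mulrAC -mulrA ler_peMr//.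
  by rewrite ler_pdivlMr ?exprn_gt0// mul1r lerXn2r ?nnegrE ?(ltW th0).
rewrite /harmonic/= -[leRHS]mul1r ler_pdivlMr// mulrC.
apply: le_trans h3; rewrite ler_wpM2r ?exprn_ge0 ?subr_ge0//.
by rewrite -natr1 addrC lerD2l.
Qed.

End polynomial_indicator.

Section levy_moments.
Context {R : realType}.
Local Notation T := (measurableTypeR R).
Implicit Types (t u x : R).

Definition sqr_ratio t : R := t ^+ 2 / (1 + t ^+ 2).

Lemma sqr_ratio_01 t : 0 <= sqr_ratio t <= 1.
Proof.
have t0 : 0 < 1 + t ^+ 2 by rewrite ltr_pwDl ?sqr_ge0.
by rewrite /sqr_ratio divr_ge0 ?sqr_ge0 ?(ltW t0)//= ler_pdivrMr// mul1r lerDr.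
Qed.

Lemma bc_sqr_ratio : bc_fun sqr_ratio.
Proof.
split; last by exists 1 => t; have /andP[h1 h2] := sqr_ratio_01 t; rewrite ger0_norm.
move=> t; apply: cvgM; first exact: continuous_sqr.
apply: cvgV; first by rewrite gt_eqF// ltr_pwDl ?sqr_ge0.
by apply: cvgD; [exact: cvg_cst|exact: continuous_sqr].
Qed.

Lemma sqr_ratio_lt a t : 0 < a -> (sqr_ratio t < sqr_ratio a) = (- a < t < a).
Proof.
move=> a0; have t0 : 0 < 1 + t ^+ 2 by rewrite ltr_pwDl ?sqr_ge0.
have a20 : 0 < 1 + a ^+ 2 by rewrite ltr_pwDl ?sqr_ge0.
rewrite -ltr_norml -(ltr_sqr (x := `|t|)) ?nnegrE ?(ltW a0)// real_normK ?num_real//.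
rewrite /sqr_ratio ltr_pdivrMr// mulrAC ltr_pdivlMr//.
by apply/idP/idP; lra.
Qed.

(** Its integral is, up to sign, the divided difference of [levy_abs] of order j + 1 with node 1
    taken j + 1 times and node u once ([levy_absB1], [resolvent_momentB1]). *)
Definition resolvent_moment j u t : R := sqr_ratio t ^+ j / (1 + u * t ^+ 2).

Lemma bc_resolvent_moment j u : 0 <= u -> bc_fun (resolvent_moment j u).
Proof.
move=> u0; apply: bc_funM; first exact/bc_funX/bc_sqr_ratio.
split; last first.
  exists 1 => t; rewrite ger0_norm ?invr_ge0 ?(ltW (den_gt0 _ _))// invf_le1 ?den_gt0//.
  by rewrite lerDl mulr_ge0 ?sqr_ge0.
move=> t; apply: cvgV; first by rewrite gt_eqF// den_gt0.
apply: cvgD; first exact: cvg_cst.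
by apply: cvgM; [exact: cvg_cst|exact: continuous_sqr].
Qed.

Section one_measure.
Variable G : {finite_measure set T -> \bar R}.

Lemma levy_abs_one : levy_abs G 1 = fine (G [set: R]).
Proof.
rewrite -[RHS]mul1r -Rintegral_cst// /levy_abs; apply: eq_Rintegral => t _.
by rewrite /levy_kernel_abs !mul1r divff// gt_eqF// ltr_pwDl ?sqr_ge0.
Qed.

Lemma levy_absB1 u : 0 < u ->
  levy_abs G u - levy_abs G 1 = (u - 1) * (\int[G]_t resolvent_moment 0 u t)%R.
Proof.
move=> u0; rewrite /levy_abs -bc_RintegralB; [|exact/bc_levy_kernel_abs/ltW|exact: bc_levy_kernel_abs].
rewrite -bc_RintegralZ; last exact/bc_resolvent_moment/ltW.
apply: eq_Rintegral => t _; rewrite /levy_kernel_abs /resolvent_moment expr0.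
field; rewrite !gt_eqF ?den_gt0 ?(ltW u0)//.
by rewrite ltr_pwDl ?sqr_ge0.
Qed.

Lemma resolvent_momentB1 j u : 0 < u ->
  (\int[G]_t resolvent_moment j u t)%R - (\int[G]_t resolvent_moment j 1 t)%R =
  (1 - u) * (\int[G]_t resolvent_moment j.+1 u t)%R.
Proof.
move=> u0; rewrite -bc_RintegralB; [|exact/bc_resolvent_moment/ltW|exact: bc_resolvent_moment].
rewrite -bc_RintegralZ; last exact/bc_resolvent_moment/ltW.
apply: eq_Rintegral => t _; rewrite /resolvent_moment (exprS (sqr_ratio t)).
move: (sqr_ratio t ^+ j) => vj; rewrite /sqr_ratio.
by field; rewrite !gt_eqF ?den_gt0 ?(ltW u0)// ltr_pwDl ?sqr_ge0.
Qed.

Lemma resolvent_moment_lipschitz j u : 0 < u ->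
  `|(\int[G]_t resolvent_moment j u t)%R - (\int[G]_t resolvent_moment j 1 t)%R| <=
  `|1 - u| * fine (G [set: R]).
Proof.
move=> u0; rewrite resolvent_momentB1// normrM ler_wpM2l//.
have mb : bc_fun (resolvent_moment j.+1 u) by exact/bc_resolvent_moment/ltW.
have m0 t : 0 <= resolvent_moment j.+1 u t.
  rewrite /resolvent_moment divr_ge0 ?exprn_ge0 ?(ltW (den_gt0 _ (ltW u0)))//.
  by have /andP[] := sqr_ratio_01 t.
rewrite ger0_norm ?Rintegral_ge0// -[leRHS]mul1r -Rintegral_cst//.
apply: bc_le_Rintegral => //; first exact: bc_fun_cst.
move=> t; rewrite /resolvent_moment ler_pdivrMr ?den_gt0 ?(ltW u0)// mul1r.
have /andP[h1 h2] := sqr_ratio_01 t.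
by rewrite (@le_trans _ _ 1) ?exprn_ile1// lerDl mulr_ge0 ?sqr_ge0// ltW.
Qed.

Lemma resolvent_moment_one j : (\int[G]_t resolvent_moment j 1 t)%R =
  (\int[G]_t sqr_ratio t ^+ j)%R - (\int[G]_t sqr_ratio t ^+ j.+1)%R.
Proof.
rewrite -bc_RintegralB; [|exact/bc_funX/bc_sqr_ratio..].
apply: eq_Rintegral => t _; rewrite /resolvent_moment (exprS (sqr_ratio t)).
move: (sqr_ratio t ^+ j) => vj; rewrite /sqr_ratio.
by field; rewrite gt_eqF// ltr_pwDl ?sqr_ge0.
Qed.

End one_measure.

Variables F G : {finite_measure set T -> \bar R}.

(** Analytic continuation of the difference of the two transforms along the negative half-line. *)
Lemma levy_transform_ray (b : R) : 0 < b ->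
  (forall u, 0 < u -> u < b -> levy_abs F u = levy_abs G u) ->
  forall u, 0 < u -> levy_abs F u = levy_abs G u.
Proof.
move=> b0 FG u u0.
pose f z := levy_transform F z - levy_transform G z.
have N1 : normc (-1 : R[i]) = 1 by rewrite normcN normc_one.
have fE (x : R) : 0 < x -> f (x%:C * -1) = - (levy_abs F x - levy_abs G x)%:C.
  by move=> x0; rewrite mulrN1 /f !levy_transform_neg// rmorphB; ring.
have cx (x : R) : 0 < x -> cut_plane (x%:C * -1 : R[i]).
  move=> x0; rewrite mulrN1; apply: (@wedge_cut_plane _ 2^-1); first by lra.
  by apply: wedge_neg => //; lra.
have : f (u%:C * -1) = 0.
  apply: (@expandable_ray _ f (-1) (u + 1) b) => //; last by rewrite ltrDl.
    by move=> x x0 _; apply: expandableB; apply: expandable_levy; exact: cx.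
  by move=> x x0 xb _; rewrite fE// FG// subrr oppr0.
by rewrite fE// => /eqP; rewrite oppr_eq0 => /eqP /complexI /eqP; rewrite subr_eq0 => /eqP.
Qed.

Hypothesis FG : forall u, 0 < u -> levy_abs F u = levy_abs G u.

(** Away from u = 1 the factor u - 1 of the difference formulas cancels. At u = 1 the equality is
    recovered by letting v tend to 1, with the bound of [resolvent_moment_lipschitz]. *)
Lemma eq_resolvent_moment j u : 0 < u ->
  (\int[F]_t resolvent_moment j u t)%R = (\int[G]_t resolvent_moment j u t)%R.
Proof.
have at_one i : (forall u, 0 < u -> u != 1 ->
    (\int[F]_t resolvent_moment i u t)%R = (\int[G]_t resolvent_moment i u t)%R) ->
    (\int[F]_t resolvent_moment i 1 t)%R = (\int[G]_t resolvent_moment i 1 t)%R.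
  move=> H; apply/eqP; rewrite -subr_eq0 -normr_eq0 eq_le normr_ge0 andbT.
  apply/ler_addgt0Pl => e e0; rewrite addr0.
  pose M := fine (F [set: R]) + fine (G [set: R]) + 1.
  have [F0 G0] : 0 <= fine (F [set: R]) /\ 0 <= fine (G [set: R]) by rewrite !fine_ge0.
  have M0 : 0 < M by rewrite /M; lra.
  pose v := 1 + e / M.
  have eM : 0 < e / M by rewrite divr_gt0.
  have v0 : 0 < v by rewrite /v; lra.
  have v1 : v != 1 by rewrite /v -subr_eq0 addrAC subrr add0r gt_eqF.
  have := resolvent_moment_lipschitz F i v0; have := resolvent_moment_lipschitz G i v0.
  rewrite H//; set a := (\int[G]_t _)%R; set b := (\int[G]_t _)%R; set c := (\int[F]_t _)%R.
  rewrite /v opprD addrA subrr add0r normrN (gtr0_norm eM) => h1 h2.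
  have h3 : `|c - b| <= `|a - c| + `|a - b|.
    by rewrite (distrC a c) (le_trans _ (ler_normD _ _))// addrA subrK.
  have : e / M * (fine (F [set: R]) + fine (G [set: R])) <= e.
    rewrite -[leRHS](mulfVK (lt0r_neq0 M0)) ler_wpM2l ?(ltW eM)// /M; lra.
  lra.
elim: j u => [|j IH] u u0; have [->|u1] := eqVneq u 1.
- apply: at_one => v v0 v1; have := levy_absB1 F v0; rewrite !FG// levy_absB1//.
  by move=> /mulfI -> //; rewrite subr_eq0.
- have := levy_absB1 F u0; rewrite !FG// levy_absB1//.
  by move=> /mulfI -> //; rewrite subr_eq0.
- apply: at_one => v v0 v1; have := resolvent_momentB1 F j v0; rewrite !IH// resolvent_momentB1//.
  by move=> /mulfI -> //; rewrite subr_eq0 eq_sym.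
- have := resolvent_momentB1 F j u0; rewrite !IH// resolvent_momentB1//.
  by move=> /mulfI -> //; rewrite subr_eq0 eq_sym.
Qed.

(** As 1/(1 + t^2) = 1 - v with v = [sqr_ratio t], the resolvent moments at u = 1 are the
    differences of consecutive moments of v; the moment of order 0 is the total mass, the value of
    [levy_abs] at 1. *)
Lemma eq_moment j : (\int[F]_t sqr_ratio t ^+ j)%R = (\int[G]_t sqr_ratio t ^+ j)%R.
Proof.
elim: j => [|j IH].
  by rewrite !Rintegral_cst// !mul1r -!levy_abs_one FG.
have := eq_resolvent_moment j ltr01; rewrite !resolvent_moment_one IH; lra.
Qed.

Lemma bc_horner_ratio (P : {poly R}) : bc_fun (fun t => P.[sqr_ratio t]).
Proof.
elim/poly_ind: P => [|P c IH].
  by under eq_fun do rewrite horner0; exact: bc_fun_cst.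
under eq_fun do rewrite hornerMXaddC; apply: bc_funD; last exact: bc_fun_cst.
by apply: bc_funM => //; exact: bc_sqr_ratio.
Qed.

Lemma eq_Rintegral_horner (P : {poly R}) :
  (\int[F]_t P.[sqr_ratio t])%R = (\int[G]_t P.[sqr_ratio t])%R.
Proof.
(* Horner induction multiplies by the variable, so an arbitrary power is carried along. *)
suff H j : (\int[F]_t (P.[sqr_ratio t] * sqr_ratio t ^+ j))%R =
    (\int[G]_t (P.[sqr_ratio t] * sqr_ratio t ^+ j))%R.
  have := H 0%N; under eq_Rintegral do rewrite expr0 mulr1.
  by under [X in _ = X]eq_Rintegral do rewrite expr0 mulr1.
elim/poly_ind: P j => [|P c IH] j.
  under eq_Rintegral do rewrite horner0 mul0r.
  under [in RHS]eq_Rintegral do rewrite horner0 mul0r.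
  by rewrite !Rintegral_cst// !mul0r.
have E (m : {finite_measure set T -> \bar R}) :
    (\int[m]_t ((P * 'X + c%:P).[sqr_ratio t] * sqr_ratio t ^+ j) =
     \int[m]_t (P.[sqr_ratio t] * sqr_ratio t ^+ j.+1) + c * \int[m]_t (sqr_ratio t ^+ j))%R.
  have bj i : bc_fun (fun t => sqr_ratio t ^+ i) by exact/bc_funX/bc_sqr_ratio.
  have bP := bc_horner_ratio P.
  rewrite -bc_RintegralZ// -bc_RintegralD; last 2 first.
  - exact: bc_funM.
  - by apply: bc_funM => //; exact: bc_fun_cst.
  apply: eq_Rintegral => t _; rewrite hornerMXaddC (exprS (sqr_ratio t)); ring.
by rewrite !E IH eq_moment.
Qed.

(** On [0, +oo[ the ratio increases with t, so [flat_poly] with threshold [sqr_ratio a] converges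
    boundedly to the indicator of ]-a, a[. *)
Lemma eq_measure_symmetric_itv (a : R) : 0 < a ->
  fine (F `](- a), a[%classic) = fine (G `](- a), a[%classic).
Proof.
move=> a0; pose th := sqr_ratio a.
have th01 : 0 < th < 1.
  rewrite /th /sqr_ratio divr_gt0 ?exprn_gt0 ?ltr_pwDl ?sqr_ge0//=.
  by rewrite ltr_pdivrMr ?ltr_pwDl ?sqr_ge0// mul1r ltrDr.
pose I : set T := `](- a), a[%classic.
have mI : measurable I by exact: measurable_itv.
have cvg_m (m : {finite_measure set T -> \bar R}) :
    ((\int[m]_t (flat_poly th n).[sqr_ratio t]) @[n --> \oo] --> fine (m I))%R.
  have -> : fine (m I) = (\int[m]_t \1_I t)%R by rewrite /Rintegral integral_indic// setIT.
  apply: (@bounded_cvg_Rintegral _ _ _ _ 1) => //.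
  - by move=> n; exact: continuous_measurable_fun (bc_horner_ratio _).1.
  - by move=> n t; have /andP[h1 h2] := flat_poly_01 th n (sqr_ratio_01 t); rewrite ger0_norm.
  - move=> t; have := cvg_flat_poly th01 (sqr_ratio_01 t); rewrite sqr_ratio_lt//.
    by rewrite indicE mem_setE in_itv/=; case: ifP.
apply: (cvg_unique _ (cvg_m F)); first exact: Rhausdorff.
rewrite (_ : (fun n => _) = (fun n => (\int[G]_t (flat_poly th n).[sqr_ratio t])%R)); last first.
  by apply/funext => n; exact: eq_Rintegral_horner.
exact: cvg_m.
Qed.

Lemma levy_abs_inj : symmetric_measure F -> symmetric_measure G ->
  forall A, measurable A -> F A = G A.
Proof.
move=> sF sG; apply: eq_measure_rays; first by move=> A mA; exact: fin_num_measure.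
suff H x : fine (F `[x, +oo[%classic) = fine (G `[x, +oo[%classic).
  have mI (x : R) : measurable (`[x, +oo[%classic : set T) by exact: measurable_itv.
  move=> x; exact: etrans (esym (fin_measure_fine F (mI x)))
    (etrans (congr1 EFin (H x)) (fin_measure_fine G (mI x))).
have mass : fine (F [set: R]) = fine (G [set: R]) by rewrite -!levy_abs_one FG.
(* For y > 0, symmetry writes the total mass as that of ]-y, y[ plus twice that of [y, +oo[. *)
have pos y : 0 < y -> fine (F `[y, +oo[%classic) = fine (G `[y, +oo[%classic).
  move=> y0.
  have E (m : {finite_measure set T -> \bar R}) : symmetric_measure m ->
      fine (m [set: R]) = fine (m `](- y), y[%classic) + 2 * fine (m `[y, +oo[%classic).
    move=> sm; pose I : set T := `](- y), y[%classic; pose J : set T := `[y, +oo[%classic.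
    have mI : measurable I by exact: measurable_itv.
    have mJ : measurable J by exact: measurable_itv.
    have mNJ := measurable_opp_preimage mJ.
    have -> : [set: R] = I `|` (J `|` (-%R @^-1` J)).
      apply/seteqP; split => // t _ /=; rewrite /I /J /= !in_itv/= !andbT.
      case: (ltP t y) => ty; last by right; left.
      by case: (ltP (- y) t) => yt; [left|right; right; rewrite lerNr].
    rewrite fine_measureU//; last 2 first.
    - exact: measurableU.
    - apply/seteqP; split => t //=; rewrite /I /J /= !in_itv/= !andbT.
      by move=> [/andP[h1 h2]] []; lra.
    rewrite fine_measureU//; last first.
      by apply/seteqP; split => t //=; rewrite /J /= !in_itv/= !andbT; lra.
    have -> : m (-%R @^-1` J) = m J by exact: sm.
    by rewrite mulr2n mulrDl mul1r.
  by have := E F sF; have := E G sG; rewrite -mass (eq_measure_symmetric_itv y0); lra.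
have [x0|x0] := ltP 0 x; first exact: pos.
(* For x <= 0, symmetry turns the complement of [x, +oo[ into ]-x, +oo[, an increasing union of rays
   with positive left end, to which [pos] applies. *)
have E (m : {finite_measure set T -> \bar R}) : symmetric_measure m ->
    (fine (m `[- x + n.+1%:R^-1, +oo[%classic) @[n --> \oo] -->
     fine (m [set: R]) - fine (m `[x, +oo[%classic)).
  move=> sm; pose I n : set T := `[- x + n.+1%:R^-1, +oo[%classic.
  have mI n : measurable (I n) by exact: measurable_itv.
  pose J : set T := `]- x, +oo[%classic; pose K : set T := `[x, +oo[%classic.
  have mJ : measurable J by exact: measurable_itv.
  have mK : measurable K by exact: measurable_itv.
  have mNJ := measurable_opp_preimage mJ.
  have -> : fine (m [set: R]) - fine (m K) = fine (m J).
    have -> : [set: R] = K `|` (-%R @^-1` J).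
      apply/seteqP; split => // t _ /=; rewrite /K /J /= !in_itv/= !andbT ltrN2.
      by case: (leP x t); [left|right].
    rewrite fine_measureU//; last first.
      by apply/seteqP; split => t //=; rewrite /K /J /= !in_itv/= !andbT ltrN2; lra.
    have -> : m (-%R @^-1` J) = m J by exact: sm.
    by rewrite addrAC subrr add0r.
  apply: fine_cvg; rewrite fin_measure_fine//.
  have -> : J = \bigcup_n I n by rewrite /J itvoyEbigcup.
  apply: nondecreasing_cvg_mu => //; first exact: bigcupT_measurable.
  move=> i j ij; apply/subsetPset/subset_itvr; rewrite bnd_simp lerD2l.
  by rewrite lef_pV2 ?posrE ?ltr0n// ler_nat.
have EF := E F sF.
rewrite (_ : (fun n => _) = (fun n => fine (G `[- x + n.+1%:R^-1, +oo[%classic))) in EF.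
  have e : fine (F [set: R]) - fine (F `[x, +oo[%classic) =
      fine (G [set: R]) - fine (G `[x, +oo[%classic).
    exact: (cvg_unique (@Rhausdorff R) EF (E G sG)).
  by move: e; rewrite mass; lra.
apply/funext => n; apply: pos.
by rewrite ltr_wpDl ?oppr_ge0// invr_gt0.
Qed.

End levy_moments.

(** * The limit theorem *)

Section limits.
Context {R : realType}.
Local Notation T := (measurableTypeR R).
Implicit Types (F : set_system nat) (s : R) (y z w : R[i]).

Definition cvg_bc F (m_ : nat -> {finite_measure set T -> \bar R})
    (m : {finite_measure set T -> \bar R}) : Prop :=
  forall f : R -> R, bc_fun f -> (\int[m_ n]_t f t @[n --> F] --> \int[m]_t f t)%R.

Lemma cvg_bc_cint F {FF : Filter F} m_ m f (e : R) : cvg_bc F m_ m -> bc_cfun f -> 0 < e ->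
  \forall n \near F, normc (cint m f - cint (m_ n) f) <= e.
Proof.
move=> mm fb e0; have e20 : 0 < e / 2 by lra.
have /cvgrPdist_le/(_ _ e20) := mm _ (bc_cfun_Re fb).
have /cvgrPdist_le/(_ _ e20) := mm _ (bc_cfun_Im fb).
apply: filterS2 => n h1 h2.
by apply: (le_trans (normc_le_ReIm _)); rewrite cReD cReN cImD cImN /=; lra.
Qed.

Lemma cvg_bc_levy F {FF : Filter F} m_ m z (e : R) : cvg_bc F m_ m -> cut_plane z -> 0 < e ->
  \forall n \near F, normc (levy_transform m z - levy_transform (m_ n) z) <= e.
Proof.
move=> mm cz e0; have nz : 0 < normc z + 1 by rewrite ltr_wpDl ?normc_ge0.
apply: filterS (cvg_bc_cint mm (bc_levy_kernel cz) (divr_gt0 e0 nz)) => n.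
rewrite /levy_transform -mulrBr normcM ler_pdivlMr// => h.
by apply: le_trans h; rewrite mulrC ler_wpM2l ?normc_ge0// lerDl.
Qed.

Lemma cvg_bc_jump F {FF : Filter F} (m_ : nat -> probability T R) (m : probability T R) z (e : R) :
  cvg_bc F (fun n => m_ n) m -> cut_plane z -> 0 < e ->
  \forall n \near F, normc (levy_transform (jump_measure 1 m) z -
                            levy_transform (jump_measure 1 (m_ n)) z) <= e.
Proof.
move=> mm cz e0.
apply: filterS (cvg_bc_cint mm (bc_jump_kernel cz) e0) => n.
by rewrite !levy_jump1.
Qed.

Lemma levy_abs_le_mass (G : {finite_measure set T -> \bar R}) (x : R) : 0 <= x ->
  levy_abs G x <= (1 + x) * fine (G [set: R]).
Proof.
move=> x0; rewrite -Rintegral_cst//; apply: bc_le_Rintegral.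
- exact: bc_levy_kernel_abs.
- exact: bc_fun_cst.
- by move=> t; exact: levy_kernel_abs_le.
Qed.

Lemma Rintegral_jump_opp k (m : {finite_measure set T -> \bar R}) (f : R -> R) :
  symmetric_measure m -> bc_fun f ->
  (\int[jump_measure k m]_t f (- t) = \int[jump_measure k m]_t f t)%R.
Proof.
move=> sm fb; rewrite !Rintegral_jump_measure//; last exact: bc_fun_opp.
have jb := @bc_jump_density R k.
rewrite -(Rintegral_opp sm (bc_funM fb jb)).
by apply: eq_Rintegral => t _; rewrite /jump_density sqrrN.
Qed.

End limits.

Section limit_theorem.
Context {R : realType}.
Local Notation T := (measurableTypeR R).
Variables (lambda : R) (mu : probability T R) (nu rho : nat -> probability T R) (k : nat -> nat).
Hypotheses (lambda01 : 0 <= lambda <= 1) (mu_sym : symmetric_measure mu)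
  (nu_sym : forall n, symmetric_measure (nu n))
  (k_infty : k n @[n --> \oo] --> \oo)
  (rho_pow : forall n, is_rect_pow lambda (nu n) (k n) (rho n))
  (rho_cvg : cvg_bc \oo (fun n => rho n) mu).
Implicit Types (y z w : R[i]) (s e : R).

Local Notation Jmu := (jump_measure 1 mu).
Local Notation J n := (jump_measure 1 (rho n)).
Local Notation Gn n := (jump_measure (k n) (nu n)).

(** Weak convergence is used at the single point -b. Monotonicity then covers all smaller radii and
    [normc_levy] all sectors, so b is independent of n. *)
Lemma levy_abs_jump_small e : 0 < e -> exists b : R, [/\ 0 < b, b <= 1, levy_abs Jmu b <= e &
  \forall n \near \oo, levy_abs (J n) b <= e].
Proof.
move=> e0; have e20 : 0 < e / 2 by lra.
have [b /andP[b0 b1] Jb] := levy_abs_small Jmu e20.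
exists b; split => //; first by rewrite (le_trans (ltW Jb))//; lra.
have cb : cut_plane (- b%:C : R[i]).
  by apply: (@wedge_cut_plane _ 2^-1); [lra|apply: wedge_neg => //; lra].
apply: filterS (cvg_bc_jump rho_cvg cb e20) => n.
rewrite !levy_transform_neg// -opprD -rmorphB normcN normc_real.
by have := ler_norm (levy_abs (J n) b - levy_abs Jmu b); rewrite distrC; lra.
Qed.

Lemma normc_levy_le (G : {finite_measure set T -> \bar R}) s b e y : 0 < s -> s < 1 ->
  levy_abs G b <= s * e -> wedge_disc s b y -> normc (levy_transform G y) <= e.
Proof.
move=> s0 s1 Gb [ys yb]; apply: (le_trans (normc_levy G s0 (ltW s1) ys)).
rewrite ler_pdivrMr// mulrC; apply: le_trans Gb; apply: levy_abs_homo; last exact: ltW.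
exact: normc_ge0.
Qed.

(** The hypothesis yields |M| <= s/64 throughout the truncated sector; one b therefore serves every
    n that satisfies it. *)
Lemma levy_jump_subord_near s : 0 < s -> s < 1 -> forall n b,
  levy_abs (J n) b <= s * (s / 64) -> forall y, wedge_disc s b y ->
  levy_transform (J n) y = levy_transform (Gn n) (subord lambda (rho n) (k n) y).
Proof.
move=> s0 s1 n b Jb; have [k0 srho germ] := is_rect_powP (@nu_sym n) (rho_pow n).
apply: (levy_jump_subord lambda01 (@nu_sym n) srho k0 germ s0 s1) => y.
exact: normc_levy_le.
Qed.

(** Uniform smallness near 0 of the gauges of the jump measures: it gives both the mass bound and
    tightness. *)
Lemma levy_abs_jump_near e : 0 < e -> exists x : R, [/\ 0 < x, x <= 1 &
  \forall n \near \oo, levy_abs (Gn n) x <= e].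
Proof.
move=> e0; have h20 : 0 < 2^-1 :> R by lra. have h21 : 2^-1 < 1 :> R by lra.
have e'0 : 0 < Num.min e (2^-1 * (2^-1 / 64)) by rewrite lt_min e0/=; lra.
have [b [b0 b1 _ Hb]] := levy_abs_jump_small e'0.
(* The 1/2 makes the point lie strictly inside the disc of radius b; the 1/4 is the loss in
   [levy_abs_jump_le]. *)
exists (b / 2 / 4); split; [lra|lra|].
apply: filterS Hb => n; rewrite le_min => /andP[Jb1 Jb2].
have [k0 _ _] := is_rect_powP (@nu_sym n) (rho_pow n).
have b20 : 0 < b / 2 by lra.
have Jx : levy_abs (J n) (b / 2) <= levy_abs (J n) b by apply: levy_abs_homo; lra.
apply: le_trans (le_trans Jx Jb1); apply: (levy_abs_jump_le lambda01 k0) => //.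
  by move: Jx Jb2; lra.
apply: (levy_jump_subord_near h20 h21 Jb2); split; first exact: wedge_neg.
by rewrite normcN normc_real gtr0_norm//; lra.
Qed.

Lemma jump_mass_bounded : exists2 B : R, 0 <= B &
  \forall n \near \oo, fine (Gn n [set: R]) <= B.
Proof.
have [x [x0 x1 Hx]] := levy_abs_jump_near ltr01.
exists x^-1; first by rewrite invr_ge0 ltW.
apply: filterS Hx => n h; rewrite -[leRHS]mulr1 -ler_pdivrMl ?invr_gt0// invrK.
by rewrite (le_trans _ h)// levy_abs_mass.
Qed.

Lemma jump_tight e : 0 < e -> exists A : R,
  \forall n \near \oo, fine (Gn n (~` `](- A), A]%classic)) <= e.
Proof.
move=> e0; have e20 : 0 < e / 2 by lra.
have [x [x0 x1 Hx]] := levy_abs_jump_near e20.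
have xV : 1 <= x^-1 by rewrite invf_ge1.
exists x^-1; apply: filterS Hx => n h.
apply: (@le_trans _ _ (2 * levy_abs (Gn n) x)); last by lra.
apply: levy_abs_tail => //; first by apply: measurableC; exact: measurable_itv.
move=> t /= /negP; rewrite in_itv/= negb_and -!leNgt => H.
have tx : x^-1 <= `|t|.
  move: H => /orP[h1|h1]; last by rewrite (le_trans _ (ler_norm _))// ltW// ltNge.
  by rewrite -normrN (le_trans _ (ler_norm _))// lerNr.
rewrite -real_normK ?num_real// expr2 mulrA.
have h1 : 1 <= x * `|t| by rewrite -ler_pdivrMl// mulr1.
by rewrite -[leLHS]mulr1 ler_pM// (le_trans xV).
Qed.

Section along_ultrafilter.
Variables (U : set_system nat) (UU : UltraFilter U) (ooU : \oo `<=` U).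
Variable G : {finite_measure set T -> \bar R}.
Hypothesis GU : cvg_bc U (fun n => Gn n) G.

Lemma limit_symmetric : symmetric_measure G.
Proof.
apply: symmetric_Rintegral => f fb; apply: (cvg_unique _ (GU (bc_fun_opp fb))).
  exact: Rhausdorff.
rewrite (_ : (fun n => _) = (fun n => (\int[Gn n]_t f t)%R)); first exact: GU.
by apply/funext => n; exact: (Rintegral_jump_opp _ (@nu_sym n) fb).
Qed.

(** M_(rho_n)(y) tends to M_mu(y) and stays bounded while k_n tends to infinity, so the denominator
    T(M_(rho_n)(y) / k_n) tends to 1 and only y T(M_mu(y)) = H_mu(y) remains. *)
Lemma subord_cvg s b y : 0 < s -> s < 1 -> wedge_disc s b y ->
  levy_abs Jmu b <= s * (s / 64) ->
  (\forall n \near \oo, levy_abs (J n) b <= s * (s / 64)) -> forall e, 0 < e ->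
  \forall n \near \oo, normc (subord lambda (rho n) (k n) y - levyH lambda Jmu y) <= e.
Proof.
move=> s0 s1 yD Jb Jnb e e0; have [ys yb] := yD; have ny := wedge_gt0 ys.
have cy : cut_plane y by exact: wedge_cut_plane ys.
(* The numerator error is at most 4 d + 2 * 4 d and the denominator at least 1/2, so 24 d |y| bounds
   the total. *)
pose d := Num.min 1 (e / (32 * normc y)).
have d0 : 0 < d by rewrite lt_min ltr01 divr_gt0// mulr_gt0.
have d1 : d <= 1 by rewrite ge_min lexx.
have dy : d * (32 * normc y) <= e by rewrite -ler_pdivlMr ?mulr_gt0// ge_min lexx orbT.
have Mmu := normc_levy_le s0 s1 Jb yD.
have kd : \forall n \near \oo, d^-1 <= (k n)%:R.
  exact: (k_infty (nbhs_infty_ger d^-1)).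
apply: filterS3 Jnb kd (cvg_bc_jump rho_cvg cy d0) => n Jn kn h.
have Mn := normc_levy_le s0 s1 Jn yD.
have [k0 _ _] := is_rect_powP (@nu_sym n) (rho_pow n).
have [_ t0] := subord_near lambda01 k0 s0 s1 Mn.
rewrite /subord /levyH.
set M := levy_transform Jmu y in Mmu h *; set Mn' := levy_transform (J n) y in Mn h t0 *.
set t := rectT lambda (Mn' / (k n)%:R) in t0 *.
have kR0 : 0 < (k n)%:R :> R by rewrite ltr0n.
have nk : normc (Mn' / (k n)%:R) <= d.
  rewrite normcM normcV -(rmorph_nat (real_complex R)) normc_real normr_nat.
  have : (k n)%:R^-1 <= d by rewrite -[d]invrK lef_pV2 ?posrE ?invr_gt0.
  have := normc_ge0 Mn'; have : 0 <= (k n)%:R^-1 :> R by rewrite invr_ge0 ltW.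
  have : normc Mn' <= 1 by lra.
  move=> h1 h2 h3 h4; apply: le_trans h4; rewrite ler_piMl//.
have M1 : normc M <= 1 by lra. have Mn1 : normc Mn' <= 1 by lra.
have nk1 : normc (Mn' / (k n)%:R) <= 1 by apply: le_trans d1.
have h1 := rectT_near1 lambda01 nk1; rewrite -/t in h1.
have nk2 : normc (Mn' / (k n)%:R) <= s / 64 by rewrite (le_trans (normc_natV k0 _)).
have h1' := rectT_near1 lambda01 nk1; rewrite -/t in h1'.
have t2 : 2^-1 <= normc t.
  have := lerB_normc 1 (1 - t); rewrite normc_one opprB addrCA subrr addr0 (distcC 1).
  lra.
have h2 := rectT_lipschitz lambda01 Mn1 M1; rewrite (distcC Mn') in h2.
have h3 := rectT_near1 lambda01 M1.
have TM2 : normc (rectT lambda M) <= 2.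
  by have := lerB_normc (rectT lambda M) 1; rewrite normc_one; lra.
have -> : y * rectT lambda Mn' / t - y * rectT lambda M =
    y * (((rectT lambda Mn' - rectT lambda M) + rectT lambda M * (1 - t)) / t) by field.
rewrite normcM normcM normcV; apply: le_trans dy.
rewrite (_ : d * (32 * normc y) = normc y * (d * 32)); last by ring.
rewrite ler_wpM2l ?normc_ge0// ler_pdivrMr; last by lra.
have h4 := ler_pM (normc_ge0 _) (normc_ge0 _) TM2 h1.
rewrite (distcC t) -normcM in h4.
have h5 := normcD (rectT lambda Mn' - rectT lambda M) (rectT lambda M * (1 - t)).
have h6 : d * 32 * 2^-1 <= d * 32 * normc t by rewrite ler_wpM2l// mulr_ge0// ltW.
lra.
Qed.

(** In the identity for n both the measure and the point move. Three errors of size e/3 are summed: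
    M_(rho_n)(y) against M_mu(y), the displacement of the point from [subord] to H_mu(y) at fixed n,
    and the convergence of the transforms at the fixed point H_mu(y). *)
Lemma levy_limit s b y : 0 < s -> s < 1 -> wedge_disc s b y ->
  levy_abs Jmu b <= s * (s / 64) ->
  (\forall n \near \oo, levy_abs (J n) b <= s * (s / 64)) ->
  levy_transform Jmu y = levy_transform G (levyH lambda Jmu y).
Proof.
move=> s0 s1 yD Jb Jnb; have [ys yb] := yD; have ny := wedge_gt0 ys.
have cy : cut_plane y by exact: wedge_cut_plane ys.
have [s20 s21] : 0 < s / 2 /\ s / 2 <= 1 by split; lra.
have Mmu := normc_levy_le s0 s1 Jb yD.
have M1 : normc (levy_transform Jmu y) <= 1 by lra.
set w := levyH lambda Jmu y.
have ws : wedge (s / 2) w.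
  apply: (@wedge_perturb _ s (s / 16) y) => //; [exact: ltW|lra|lra|].
  rewrite /w /levyH (_ : _ - y = (rectT lambda (levy_transform Jmu y) - 1) * y); last by ring.
  rewrite normcM ler_wpM2r ?normc_ge0//.
  by have := rectT_near1 lambda01 M1; lra.
have nw := wedge_gt0 ws; have cw : cut_plane w by exact: wedge_cut_plane ws.
have [B B0 HB] := jump_mass_bounded.
(* A Lipschitz constant at w common to all large n, thanks to the mass bound B. *)
pose L := (1 + normc w) * B / (s / 2 * (s / 2) * normc w).
have hD : 0 < s / 2 * (s / 2) * normc w by rewrite mulr_gt0// mulr_gt0.
have L0 : 0 <= L.
  by rewrite /L divr_ge0 ?(ltW hD)// mulr_ge0// addr_ge0// ltW.
apply/eqP; rewrite -subr_eq0 -normc_eq0 eq_le normc_ge0 andbT.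
apply/ler_addgt0Pl => e e0; rewrite addr0.
have e30 : 0 < e / 3 by lra.
pose d := e / 3 / (L + 1).
have L10 : 0 < L + 1 by lra.
have d0 : 0 < d by rewrite divr_gt0.
have Ld : L * d <= e / 3.
  have : (L + 1) * d = e / 3 by rewrite /d mulrC mulfVK// gt_eqF.
  by lra.
have UM : \forall n \near U, normc (levy_transform Jmu y - levy_transform (J n) y) <= e / 3.
  exact: (ooU (cvg_bc_jump rho_cvg cy e30)).
have US : \forall n \near U, normc (subord lambda (rho n) (k n) y - w) <= d.
  exact: (ooU (subord_cvg s0 s1 yD Jb Jnb d0)).
have UG : \forall n \near U, normc (levy_transform G w - levy_transform (Gn n) w) <= e / 3.
  exact: cvg_bc_levy.
have [n [[[h1 h2] h3] [h4 h5]]] :=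
  filter_ex (filterI (filterI (filterI UM US) UG) (filterI (ooU HB) (ooU Jnb))).
have Mn := normc_levy_le s0 s1 h5 yD.
have [k0 _ _] := is_rect_powP (@nu_sym n) (rho_pow n).
have [g1 t0] := subord_near lambda01 k0 s0 s1 Mn.
set w' := subord lambda (rho n) (k n) y in h2 g1.
have ws' : wedge (s / 2) w' by exact: (wedge_quarter s0 (ltW s1) ys g1).
have g2 : normc (levy_transform (Gn n) w - levy_transform (Gn n) w') <= e / 3.
  apply: le_trans Ld; apply: (le_trans (levy_lipschitz (Gn n) s20 s21 s20 s21 ws ws')).
  apply: ler_pM; rewrite ?normc_ge0//.
  - by rewrite divr_ge0 ?(ltW hD)// levy_abs_ge0// normc_ge0.
  - rewrite /L ler_wpM2r ?invr_ge0 ?(ltW hD)//.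
    apply: (le_trans (levy_abs_le_mass _ (normc_ge0 w))).
    by rewrite ler_wpM2l// addr_ge0 ?normc_ge0.
  - by rewrite distcC.
have g3 : levy_transform (J n) y = levy_transform (Gn n) w'.
  exact: (levy_jump_subord_near s0 s1 h5).
have t1 := distc_triangle (levy_transform (J n) y) (levy_transform Jmu y) (levy_transform G w).
have t2 := distc_triangle (levy_transform (Gn n) w) (levy_transform (J n) y) (levy_transform G w).
rewrite -g3 distcC in g2; rewrite distcC in h3; move: h1 h3 g2 t1 t2; rewrite /=; lra.
Qed.

Lemma rectR_limit : eq_germ (rectR lambda mu) (levy_transform G).
Proof.
apply/eq_germP => s /andP[s0 s1].
have [s20 s21] : 0 < s / 2 /\ s / 2 < 1 by split; lra.
have k0 : 0 < s / 2 * (s / 2 / 64) by rewrite !mulr_gt0// divr_gt0.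
have [b [b0 b1 Jb Jnb]] := levy_abs_jump_small k0.
have [c c0 Hc] := rectR_rectHinv lambda01 mu_sym s0 s1 b0.
exists c => // z /Hc[y [yD Hy ->]].
by rewrite -Hy; exact: (levy_limit s20 s21 yD Jb Jnb).
Qed.

End along_ultrafilter.

Lemma ultra_limit (U : set_system nat) : UltraFilter U -> \oo `<=` U ->
  exists G : {finite_measure set T -> \bar R}, cvg_bc U (fun n => Gn n) G.
Proof.
move=> UU ooU; have [B _ HB] := jump_mass_bounded.
apply: (@helly _ U UU (fun n => Gn n) B); first exact: ooU.
by move=> e e0; have [A HA] := jump_tight e0; exists A; exact: ooU.
Qed.

End limit_theorem.

(** The two transforms agree on a short segment of the negative half-line, which
    [levy_transform_ray] extends to the whole half-line. *)
Lemma rectR_levy_inj {R : realType} (lambda : R) (mu : probability (measurableTypeR R) R)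
    (F G : {finite_measure set (measurableTypeR R) -> \bar R}) :
  symmetric_measure F -> symmetric_measure G ->
  eq_germ (rectR lambda mu) (levy_transform F) ->
  eq_germ (rectR lambda mu) (levy_transform G) ->
  forall A : set (measurableTypeR R), measurable A -> F A = G A.
Proof.
move=> sF sG /eq_germP germF /eq_germP germG.
have h2 : 0 < (2^-1 : R) < 1 by apply/andP; split; lra.
have [b b0 Hb] := germF _ h2; have [c c0 Hc] := germG _ h2.
have bc0 : 0 < Num.min b c by rewrite lt_min b0.
apply: levy_abs_inj => //; apply: (levy_transform_ray bc0) => u u0.
rewrite lt_min => /andP[ub uc].
have uD (d : R) : u < d -> wedge_disc 2^-1 d (- u%:C : R[i]).
  move=> ud; split; first by apply: wedge_neg => //; case/andP: h2.
  by rewrite normcN normc_real gtr0_norm.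
have := Hb _ (uD b ub); rewrite (Hc _ (uD c uc)) !levy_transform_neg//.
by move=> /oppr_inj /complexI.
Qed.

Theorem theorem2p5 (R : realType) (lambda : R)
    (mu : probability (measurableTypeR R) R)
    (nu rho : nat -> probability (measurableTypeR R) R) (k : nat -> nat)
    (lambda01 : 0 <= lambda <= 1)
    (mu_sym : symmetric_measure mu)
    (nu_sym : forall n, symmetric_measure (nu n))
    (k_infty : k n @[n --> \oo] --> \oo)
    (rho_pow : forall n, is_rect_pow lambda (nu n) (k n) (rho n))
    (rho_cvg : weak_cvg (fun n => rho n) mu) :
  exists G : {finite_measure set (measurableTypeR R) -> \bar R},
    [/\ symmetric_measure G,
        weak_cvg (fun n => jump_measure (k n) (nu n)) G,
        analytic_on cut_plane (levy_transform G) /\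
          eq_germ (rectR lambda mu) (levy_transform G) &
        forall F : {finite_measure set (measurableTypeR R) -> \bar R},
          symmetric_measure F ->
          eq_germ (rectR lambda mu) (levy_transform F) ->
          forall A : set (measurableTypeR R), measurable A -> F A = G A].
Proof.
have rho_bc : cvg_bc \oo (fun n => rho n) mu.
  by move=> f /bc_fun_bounded[cf bf]; exact: rho_cvg.
have limU U : UltraFilter U -> \oo `<=` U ->
    exists G : {finite_measure set (measurableTypeR R) -> \bar R},
    [/\ cvg_bc U (fun n => jump_measure (k n) (nu n)) G, symmetric_measure G &
        eq_germ (rectR lambda mu) (levy_transform G)].
  move=> UU ooU.
  have [G GU] := ultra_limit lambda01 nu_sym rho_pow rho_bc UU ooU.
  exists G; split => //; first exact: (limit_symmetric nu_sym UU GU).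
  exact: (rectR_limit lambda01 mu_sym nu_sym k_infty rho_pow rho_bc UU ooU GU).
have [U0 [UU0 ooU0]] := @ultraFilterLemma nat \oo _.
have [G [_ sG germG]] := limU U0 UU0 ooU0.
exists G; split => //.
- move=> f cf bf; have fb : bc_fun f by apply/bc_fun_bounded.
  (* Along any other ultrafilter the limit G' is symmetric with the same transform, hence equal to
     G. *)
  apply: nbhs_ultra => U UU ooU; have [G' [G'U sG' germG']] := limU U UU ooU.
  have -> : (\int[G]_t f t = \int[G']_t f t)%R.
    congr fine; apply: eq_measure_integral => A mA _.
    exact: (rectR_levy_inj sG sG' germG germG').
  exact: G'U.
- by split => // z cz; apply/expandable_derivable/expandable_levy.
- by move=> F sF germF; exact: rectR_levy_inj germG.
Qed.
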